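(* Let $p:\mathbb{R}\to(1,\infty)$ be a measurable function in the class $LH$, and let $U\in h^{p(\cdot)}(\mathbb{C}_+)$. Then there exists a unique $u\in L^{p(\cdot)}(\mathbb{R})$ such that for every $x\in\mathbb{R}$ and $y>0$, $$U(x+iy)=\int_{-\infty}^{\infty}P_y(x-t)\,u(t)\,dt,\qquad P_y(x)=\frac1\pi\frac{y}{x^2+y^2}.$$ Moreover, $\sup_{y>0}\|U_y\|_{L^{p(\cdot)}(\mathbb{R})}\sim\|u\|_{L^{p(\cdot)}(\mathbb{R})}$, i.e. there are constants $c,C>0$ independent of $U$ with $c\|u\|_{L^{p(\cdot)}(\mathbb{R})}\le\sup_{y>0}\|U_y\|_{L^{p(\cdot)}(\mathbb{R})}\le C\|u\|_{L^{p(\cdot)}(\mathbb{R})}$, where $U_y(x)=U(x+iy)$.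
   Context: $\mathbb{C}_+=\{z\in\mathbb{C}:\operatorname{Im}z>0\}$. A measurable $p:\mathbb{R}\to(1,\infty)$ is in the class $LH$ if (i) there is $C_{\log}>0$ with $|p(x)-p(y)|\le C_{\log}/\log(1/|x-y|)$ for all $x,y\in\mathbb{R}$ with $|x-y|<1/2$, and (ii) there are constants $p_\infty\in\mathbb{R}$, $C_\infty>0$ with $|p(x)-p_\infty|\le C_\infty/\log(e+|x|)$ for all $x\in\mathbb{R}$. $L^{p(\cdot)}(\mathbb{R})$ is the space of measurable $f:\mathbb{R}\to\mathbb{C}$ with $\int_{\mathbb{R}}|f(x)|^{p(x)}dx<\infty$, with norm $\|f\|_{L^{p(\cdot)}(\mathbb{R})}=\inf\{\lambda>0:\int_{\mathbb{R}}|f(x)/\lambda|^{p(x)}dx\le1\}$. The space $h^{p(\cdot)}(\mathbb{C}_+)$ consists of harmonic functions $U$ on $\mathbb{C}_+$ with $\sup_{y>0}\int_{-\infty}^{\infty}|U(x+iy)|^{p(x)}\,dx<\infty$. *)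

(* Defs.v *)
From HB Require Import structures.
From mathcomp Require Import all_boot all_order all_algebra.
From mathcomp Require Import all_classical all_reals all_analysis.
Set Implicit Arguments. Unset Strict Implicit. Unset Printing Implicit Defensive.
Import Order.TTheory GRing.Theory Num.Theory.
Import numFieldNormedType.Exports.
Local Open Scope classical_set_scope.
Local Open Scope ring_scope.

(* Complex numbers z = a + i b are represented by pairs of reals; a
   complex-valued function is given by its real and imaginary parts. *)
Section Defs.
Variable R : realType.

Definition cmod (a b : R) : R := Num.sqrt (a ^+ 2 + b ^+ 2).

Definition modular (p : R -> R) (fr fi : R -> R) : \bar R :=
  (\int[@lebesgue_measure R]_x ((cmod (fr x) (fi x)) `^ (p x))%:E)%E.

Definition in_Lp (p : R -> R) (fr fi : R -> R) : Prop :=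
  [/\ measurable_fun setT fr, measurable_fun setT fi &
      (modular p fr fi < +oo)%E].

(* Luxemburg norm  inf {lambda > 0 : int |f/lambda|^{p(x)} <= 1}
   (taken in the extended reals; inf of the empty set is +oo) *)
Definition lp_norm (p : R -> R) (fr fi : R -> R) : \bar R :=
  ereal_inf [set l%:E | l in
    [set l : R | 0 < l /\ (modular p (fun x => (fr x / l)%R) (fun x => (fi x / l)%R) <= 1)%E]].

Definition LH (p : R -> R) : Prop :=
  (exists Clog : R, 0 < Clog /\ forall x y : R, `|x - y| < 2^-1 ->
       `|p x - p y| <= Clog / ln (`|x - y|)^-1) /\
  (exists pinf Cinf : R, 0 < Cinf /\ forall x : R,
       `|p x - pinf| <= Cinf / ln (expR 1 + `|x|)).

Definition upper_half_plane : set (R * R) := [set z | 0 < z.2].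

Definition e1 : R * R := (1, 0).
Definition e2 : R * R := (0, 1).
Definition dx (f : R * R -> R) : R * R -> R := 'D_e1 f.
Definition dy (f : R * R -> R) : R * R -> R := 'D_e2 f.

Definition harmonic_on (D : set (R * R)) (f : R * R -> R) : Prop :=
  open D /\ forall z, D z ->
  [/\ (derivable f z e1 /\ derivable f z e2),
      [/\ derivable (dx f) z e1, derivable (dx f) z e2,
          derivable (dy f) z e1 & derivable (dy f) z e2],
      [/\ {for z, continuous f}, {for z, continuous (dx f)}
        & {for z, continuous (dy f)}],
      [/\ {for z, continuous (dx (dx f))}, {for z, continuous (dy (dx f))},
          {for z, continuous (dx (dy f))} & {for z, continuous (dy (dy f))}] &
      dx (dx f) z + dy (dy f) z = 0].

Definition in_hp (p : R -> R) (Ur Ui : R * R -> R) : Prop :=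
  [/\ harmonic_on upper_half_plane Ur, harmonic_on upper_half_plane Ui &
      exists M : R, forall y : R, 0 < y ->
        (modular p (fun x => Ur (x, y)) (fun x => Ui (x, y)) <= M%:E)%E].

Definition poisson (y x : R) : R := pi^-1 * (y / (x ^+ 2 + y ^+ 2)).

Definition poisson_rep (Ur Ui : R * R -> R) (ur ui : R -> R) : Prop :=
  forall x y : R, 0 < y ->
    (\int[@lebesgue_measure R]_t (poisson y (x - t) * ur t)%:E = (Ur (x, y))%:E)%E /\
    (\int[@lebesgue_measure R]_t (poisson y (x - t) * ui t)%:E = (Ui (x, y))%:E)%E.

Definition sup_norm_hp (p : R -> R) (Ur Ui : R * R -> R) : \bar R :=
  ereal_sup [set lp_norm p (fun x => Ur (x, y)) (fun x => Ui (x, y)) | y in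
             [set y : R | 0 < y]].

End Defs.

(* Main.v *)
(** Existence. Comparison with a logarithmic barrier, using the four-point
    Laplacian in place of second derivatives, shows that a bounded harmonic
    function on [Im z >= s] is the Poisson integral of its trace on [Im z = s].
    The modular bound controls the horizontal averages of [U], which makes [U]
    bounded on each such half-plane. As [p > 1], the weighted traces
    [U(t + is) / (1 + t^2)] are equi-integrable, so an ultrafilter limit as [s]
    tends to [0+] is an absolutely continuous charge, and its Radon-Nikodym
    density gives [u]. Uniqueness and the lower norm bound follow from the a.e.
    convergence of Poisson integrals at Lebesgue points, together with Fatou's
    lemma. For the upper bound, the splitting [a <= K + K^(1-q) a^q] replaces
    Jensen's inequality: for [m = P_y * |f|^p(.)] one takes [K = m^(1/p(x))], and
    since [m <= 1/(pi y)] the log-Hoelder condition makes [K^(p(x)-p(t))] bounded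
    for [|x - t| < sqrt y]; the part [|f| <= 1] is compared with the constant
    exponent [p_oo]. *)
Require Import Defs.
From HB Require Import structures.
From mathcomp Require Import all_boot all_order all_algebra.
From mathcomp Require Import all_classical all_reals all_analysis.
From mathcomp Require Import measurable_realfun ring lra.
Set Implicit Arguments. Unset Strict Implicit. Unset Printing Implicit Defensive.
Import Order.TTheory GRing.Theory Num.Theory.
Import numFieldNormedType.Exports.
Local Open Scope classical_set_scope.
Local Open Scope ring_scope.

(** Each value of p exceeds 1, but the infimum of p may be 1, approached at infinity. In that case
    L^p(.) is not reflexive and the maximal operator is unbounded on it, so neither weak compactness
    of balls nor a maximal function bound can be invoked. For existence, p is bounded away from 1
    only on compact segments, and far out the smallness comes from the weight 1/(1+t^2), a multiple
    of which dominates every Poisson kernel. For the norm, the Poisson integral is estimated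
    directly, and comparison with p_oo leaves only integrable errors. The pointwise bound on U does
    not use mean values over discs. The integral of U over [x, x+h] is bounded and again has a small
    four-point Laplacian, so it is the Poisson integral of its own trace and is Lipschitz in x. Its
    x-derivative is U(x+h, y) - U(x, y), so the increments of U are bounded, and every unit segment
    contains a point where |U| is controlled. Real and imaginary parts are treated separately, which
    puts a factor 2 into the upper constant; Fatou's lemma gives the lower constant 1. *)

Section RealIntegrable.
Context d (T : measurableType d) (R : realType) (mu : {measure set T -> \bar R}).
Variables (D : set T) (mD : measurable D).
Implicit Types f g : T -> R.

Lemma integrable_addr f g : mu.-integrable D (EFin \o f) -> mu.-integrable D (EFin \o g) ->
  mu.-integrable D (EFin \o (fun x => f x + g x)).
Proof. by move=> fi gi; apply: eq_integrable (integrableD mD fi gi). Qed.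

Lemma integrable_subr f g : mu.-integrable D (EFin \o f) -> mu.-integrable D (EFin \o g) ->
  mu.-integrable D (EFin \o (fun x => f x - g x)).
Proof. by move=> fi gi; apply: eq_integrable (integrableB mD fi gi). Qed.

Lemma integrable_mulrl c f : mu.-integrable D (EFin \o f) ->
  mu.-integrable D (EFin \o (fun x => c * f x)).
Proof. by move=> fi; apply: eq_integrable (integrableZl mD c fi). Qed.

Lemma integrable_normr f : mu.-integrable D (EFin \o f) ->
  mu.-integrable D (EFin \o (fun x => `|f x|)).
Proof. by move=> fi; apply: eq_integrable (integrable_abse fi). Qed.

End RealIntegrable.

(** * The Poisson kernel *)

Section PoissonKernel.
Context {R : realType}.
Local Notation mu := (@lebesgue_measure R).
Implicit Types x y t s d : R.

Lemma sqrD_gt0 x y : 0 < y -> 0 < x ^+ 2 + y ^+ 2.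
Proof. by move=> y0; rewrite ltr_wpDl ?sqr_ge0// exprn_gt0. Qed.

Lemma poisson_gt0 y x : 0 < y -> 0 < poisson y x.
Proof. by move=> y0; rewrite mulr_gt0 ?invr_gt0 ?pi_gt0// divr_gt0// sqrD_gt0. Qed.

Lemma poisson_ge0 y x : 0 < y -> 0 <= poisson y x.
Proof. by move=> /poisson_gt0/ltW. Qed.

Lemma poissonN y x : poisson y (- x) = poisson y x.
Proof. by rewrite /poisson sqrrN. Qed.

Lemma poissonBC y x t : poisson y (x - t) = poisson y (t - x).
Proof. by rewrite -poissonN opprB. Qed.

Lemma continuous_poisson y : 0 < y -> continuous (poisson y).
Proof.
move=> y0 x; apply: cvgM; first exact: cvg_cst.
apply: cvgM; first exact: cvg_cst.
apply: cvgV; first by rewrite gt_eqF// sqrD_gt0.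
apply: cvgD; last exact: cvg_cst.
exact: exprn_continuous.
Qed.

Lemma continuous_poissonB y x : 0 < y -> continuous (fun t => poisson y (x - t)).
Proof.
move=> y0 t; apply: (@continuous_comp _ _ _ (fun t => x - t) (poisson y)).
  by apply: cvgB; [exact: cvg_cst|exact: cvg_id].
exact: continuous_poisson.
Qed.

Lemma measurable_poissonB y x : 0 < y ->
  measurable_fun setT (fun t => poisson y (x - t)).
Proof. by move=> y0; apply: continuous_measurable_fun; exact: continuous_poissonB. Qed.

Lemma integral_oneDsqrV :
  (\int[mu]_t ((1 + t ^+ 2)^-1)%:E = (pi : R)%:E)%E.
Proof.
rewrite (ge0_symfun_integralT (f := fun t : R => (1 + t ^+ 2)^-1)); last 3 first.
- by move=> t; rewrite invr_ge0 addr_ge0// sqr_ge0.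
- by move=> t; exact: continuous_oneDsqrV.
- by move=> t /=; rewrite sqrrN.
rewrite -set_itvcy.
have -> : (\int[mu]_(x in `[0%R, +oo[) ((1 + x ^+ 2)^-1)%:E = (pi / 2)%:E)%E.
  exact: integral0y_oneDsqr.
by rewrite -EFinM; congr EFin; field.
Qed.

Lemma integral_poissonB y x : 0 < y ->
  (\int[mu]_t (poisson y (x - t))%:E = 1%:E)%E.
Proof.
move=> y0.
have yn0 : y != 0 by rewrite gt_eqF.
pose F t := (t - x) / y.
have dF t : is_derive t 1 F y^-1.
  rewrite /F; apply: is_derive_eq.
  by rewrite scaler0 add0r subr0 /GRing.scale/= mulr1.
have F'E : derive1 F = cst y^-1.
  by apply/funext => t; rewrite derive1E; apply: derive_val.
pose G t : R := pi^-1 * (1 + t ^+ 2)^-1.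
have cG : continuous G.
  by move=> t; apply: cvgM; [exact: cvg_cst|exact: continuous_oneDsqrV].
have G0 t : 0 <= G t.
  by rewrite mulr_ge0 ?invr_ge0 ?pi_ge0// addr_ge0// sqr_ge0.
transitivity (\int[mu]_t (((G \o F) * derive1 F) t)%:E)%E.
  apply: eq_integral => t _; congr EFin; rewrite F'E /= /G /F /poisson.
  rewrite -[in LHS](sqrrN (x - t)) opprB -mulrA; congr (_ * _).
  have h := sqrD_gt0 (t - x) y0.
  rewrite -[RHS]/((1 + ((t - x) / y) ^+ 2)^-1 * y^-1).
  have h' : 1 + ((t - x) / y) ^+ 2 != 0 by rewrite gt_eqF// ltr_pwDl// sqr_ge0.
  by field; rewrite yn0 !gt_eqF// addrC.
rewrite -increasing_ge0_integration_by_substitutionT//.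
- transitivity (\int[mu]_t ((pi^-1)%:E * ((1 + t ^+ 2)^-1)%:E))%E => //.
  rewrite ge0_integralZl//=; last 3 first.
  + apply/measurable_EFinP; apply: continuous_measurable_fun.
    exact: continuous_oneDsqrV.
  + by move=> t _; rewrite lee_fin invr_ge0 addr_ge0// sqr_ge0.
  + by rewrite lee_fin invr_ge0 pi_ge0.
  by rewrite integral_oneDsqrV -EFinM mulVf// gt_eqF// pi_gt0.
- by move=> a b ab; rewrite /F ltr_pM2r ?invr_gt0// ltrD2r.
- by rewrite F'E => t; exact: cvg_cst.
- by rewrite F'E; exact: is_cvg_cst.
- by rewrite F'E; exact: is_cvg_cst.
- apply/cvgrNyPle => A; exists (A * y + x); split; first exact: num_real.
  by move=> t tA; rewrite /F ler_pdivrMr// lerBlDr ltW.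
- apply/cvgryPge => A; exists (A * y + x); split; first exact: num_real.
  by move=> t tA; rewrite /F ler_pdivlMr// lerBrDr ltW.
Qed.

Lemma integral_poissonBl y t : 0 < y ->
  (\int[mu]_x (poisson y (x - t))%:E = 1%:E)%E.
Proof.
move=> y0; rewrite -(integral_poissonB t y0).
by apply: eq_integral => x _; rewrite poissonBC.
Qed.

Lemma integrable_poissonB y x : 0 < y ->
  mu.-integrable setT (EFin \o (fun t => poisson y (x - t))).
Proof.
move=> y0; apply/integrableP; split.
  by apply/measurable_EFinP; exact: measurable_poissonB.
under eq_integral do rewrite /= ger0_norm ?poisson_ge0//.
by rewrite integral_poissonB// ltry.
Qed.

Lemma Rintegral_poissonB y x : 0 < y -> \int[mu]_t poisson y (x - t) = 1.
Proof. by move=> y0; rewrite /Rintegral integral_poissonB. Qed.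

Lemma poisson_le y s : 0 < y -> poisson y s <= pi^-1 / y.
Proof.
move=> y0; rewrite /poisson ler_pM2l ?invr_gt0 ?pi_gt0//.
rewrite ler_pdivrMr ?sqrD_gt0// mulrC ler_pdivlMr// -expr2.
by rewrite lerDr sqr_ge0.
Qed.

(** Trades the tail of one kernel for a multiple of another, whose total mass is known; the factor
    2y/d tends to 0 with y. *)
Lemma poisson_tail y d s : 0 < y -> 0 < d -> d <= `|s| ->
  poisson y s <= 2 * y / d * poisson d s.
Proof.
move=> y0 d0 ds.
rewrite /poisson [leRHS]mulrCA ler_pM2l ?invr_gt0 ?pi_gt0//.
have ds2 : d ^+ 2 <= s ^+ 2.
  by rewrite -(real_normK (num_real s)) lerXn2r// nnegrE ltW.
have -> : 2 * y / d * (d / (s ^+ 2 + d ^+ 2)) = 2 * y / (s ^+ 2 + d ^+ 2).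
  by field; rewrite !gt_eqF ?sqrD_gt0.
rewrite ler_pdivrMr ?sqrD_gt0// mulrAC ler_pdivlMr ?sqrD_gt0//.
rewrite -mulrA mulrCA ler_pM2l//; nra.
Qed.

(** The kernel varies by a relative amount of order (displacement)/y. Having the kernel itself on
    the right lets the estimate be integrated against bounded functions. *)
Lemma poisson_ratio y y' s s' : 0 < y ->
  `|s' - s| <= y / 2 -> `|y' - y| <= y / 2 ->
  `|poisson y' s' - poisson y s| <=
  4 / y * (`|s' - s| + `|y' - y|) * poisson y s.
Proof.
move=> y0 sy yy.
have y'0 : 0 < y' by move: yy; rewrite ler_norml => /andP[]; lra.
rewrite /poisson -mulrBr normrM ger0_norm ?invr_ge0 ?pi_ge0// [leRHS]mulrCA.
rewrite ler_pM2l ?invr_gt0 ?pi_gt0//.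
set N := s ^+ 2 + y ^+ 2; set N' := s' ^+ 2 + y' ^+ 2.
have N0 : 0 < N by exact: sqrD_gt0.
have N'0 : 0 < N' by exact: sqrD_gt0.
have -> : y' / N' - y / N = (y' * N - y * N') / (N' * N).
  by field; rewrite !gt_eqF.
rewrite normrM (ger0_norm (_ : 0 <= (N' * N)^-1)); last first.
  by rewrite invr_ge0 mulr_ge0// ltW.
rewrite ler_pdivrMr ?mulr_gt0//.
set a := `|s' - s|; set b := `|y' - y|.
have a0 : 0 <= a by exact: normr_ge0.
have b0 : 0 <= b by exact: normr_ge0.
have -> : 4 / y * (a + b) * (y / N) * (N' * N) = 4 * (a + b) * N'.
  by field; rewrite !gt_eqF.
(* Each term of this rearrangement is bounded by a multiple of [N'], which then cancels against the
   denominator [N' * N]. *)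
have -> : y' * N - y * N' =
    (y' - y) * N' - y' * ((s' - s) * (s' + s) + (y' - y) * (y' + y)).
  by rewrite /N /N'; ring.
rewrite (le_trans (ler_normB _ _))// !normrM -/b (gtr0_norm N'0) (gtr0_norm y'0).
have h1 : `|(s' - s) * (s' + s) + (y' - y) * (y' + y)| <=
    a * (2 * `|s'| + y') + b * (3 * y').
  rewrite (le_trans (ler_normD _ _))// !normrM -/a -/b lerD// ler_wpM2l//.
    have -> : s' + s = 2 * s' - (s' - s) by ring.
    rewrite (le_trans (ler_normB _ _))// normrM ger0_norm// lerD2l.
    by rewrite (le_trans sy)//; move: yy; rewrite ler_norml => /andP[]; lra.
  rewrite ger0_norm ?addr_ge0 ?(ltW y'0) ?(ltW y0)//.
  by move: yy; rewrite ler_norml => /andP[]; lra.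
apply: (@le_trans _ _ (b * N' + y' * (a * (2 * `|s'| + y') + b * (3 * y')))).
  by rewrite lerD2l ler_wpM2l// ltW.
have h2 : y' * (2 * `|s'| + y') <= 2 * N'.
  by rewrite /N' -(real_normK (num_real s')); have := sqr_ge0 (`|s'| - y');
  have := sqr_ge0 `|s'|; lra.
have h3 : y' * (3 * y') <= 3 * N' by rewrite /N'; have := sqr_ge0 s'; lra.
have := ler_wpM2l a0 h2; have := ler_wpM2l b0 h3; have := mulr_ge0 a0 (ltW N'0).
lra.
Qed.

End PoissonKernel.

(** * A maximum principle for the four-point Laplacian *)

Section MaxPrinciple.
Context {R : realType}.
Implicit Types (x y r L e : R) (V : R -> R -> R).

(** The usual difference quotient for the Laplacian, not divided by r^2. Harmonicity enters as a
    bound o(r^2), which passes through integrals by linearity alone. *)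
Definition lap4 V x y r :=
  V (x + r) y + V (x - r) y + V x (y + r) + V x (y - r) - 4 * V x y.

(* With [z = x + i y], the four shifted factors multiply to [|z^4 - r^4|^2]. *)
Lemma four_factors x y r :
  ((x + r) ^+ 2 + y ^+ 2) * ((x - r) ^+ 2 + y ^+ 2) *
  (x ^+ 2 + (y + r) ^+ 2) * (x ^+ 2 + (y - r) ^+ 2) =
  (x ^+ 2 + y ^+ 2) ^+ 4 - 2 * r ^+ 4 * (x ^+ 4 - 6 * x ^+ 2 * y ^+ 2 + y ^+ 4) + r ^+ 8.
Proof. by ring. Qed.

(* The four-point Laplacian of [- Im (1 / z)] is [- Im (4 r^4 / (z (z^4 - r^4)))]. *)
Lemma lap4_poisson y x r : 0 < y -> 0 < r <= y / 2 ->
  `|lap4 (fun x y => poisson y x) x y r| <= 176 / y ^+ 4 * poisson y x * r ^+ 4.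
Proof.
move=> y0 /andP[r0 ry].
set N := x ^+ 2 + y ^+ 2.
have N0 : 0 < N by exact: sqrD_gt0.
have D1 : 0 < (x + r) ^+ 2 + y ^+ 2 by exact: sqrD_gt0.
have D2 : 0 < (x - r) ^+ 2 + y ^+ 2 by exact: sqrD_gt0.
have D3 : 0 < x ^+ 2 + (y + r) ^+ 2 by apply: sqrD_gt0; lra.
have D4 : 0 < x ^+ 2 + (y - r) ^+ 2 by apply: sqrD_gt0; lra.
pose D := ((x + r) ^+ 2 + y ^+ 2) * ((x - r) ^+ 2 + y ^+ 2) *
  (x ^+ 2 + (y + r) ^+ 2) * (x ^+ 2 + (y - r) ^+ 2).
have D0 : 0 < D by rewrite /D !mulr_gt0.
(* With z = x + i y, [y * Q] is the imaginary part of z (z^4 - r^4), and [D] is |z^4 - r^4|^2. *)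
pose Q := 5 * x ^+ 4 - 10 * x ^+ 2 * y ^+ 2 + y ^+ 4 - r ^+ 4.
have E : lap4 (fun x y => poisson y x) x y r =
    poisson y x * (4 * r ^+ 4 * Q / D).
  rewrite /lap4 /poisson /D /Q; have := @pi_gt0 R; move: (pi : R) => q q0.
  by field; rewrite !gt_eqF.
have rN : r ^+ 4 <= N ^+ 2 / 16.
  have r2 : r ^+ 2 <= N / 4.
    have : r ^+ 2 <= (y / 2) ^+ 2 by rewrite lerXn2r ?nnegrE//; lra.
    by rewrite /N; have := sqr_ge0 x; lra.
  have -> : r ^+ 4 = r ^+ 2 ^+ 2 by ring.
  have -> : N ^+ 2 / 16 = (N / 4) ^+ 2 by field.
  by rewrite lerXn2r ?nnegrE// ?sqr_ge0//; lra.
have x20 := sqr_ge0 x; have y20 := sqr_ge0 y.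
have N2 : 0 <= N ^+ 2 by exact: sqr_ge0.
(* The constant is 176 = 4 * 11 * 4: the factor 4 r^4, this bound on [Q], and D >= N^4 / 4 >= N^2
   y^4 / 4. *)
have Q11 : `|Q| <= 11 * N ^+ 2.
  have h : 0 <= x ^+ 2 * y ^+ 2 by exact: mulr_ge0.
  have h4 : 0 <= x ^+ 4 by rewrite -[4%N]/(2 * 2)%N exprM sqr_ge0.
  have h5 : 0 <= y ^+ 4 by rewrite -[4%N]/(2 * 2)%N exprM sqr_ge0.
  have h6 : 0 <= r ^+ 4 by rewrite -[4%N]/(2 * 2)%N exprM sqr_ge0.
  have NE : N ^+ 2 = x ^+ 4 + 2 * (x ^+ 2 * y ^+ 2) + y ^+ 4 by rewrite /N; ring.
  by rewrite /Q ler_norml -(mulrA 10); apply/andP; split; lra.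
have DN : N ^+ 4 / 4 <= D.
  rewrite /D four_factors -/N.
  have NE : x ^+ 4 - 6 * x ^+ 2 * y ^+ 2 + y ^+ 4 <= N ^+ 2.
    have h : 0 <= x ^+ 2 * y ^+ 2 by exact: mulr_ge0.
    by have -> : N ^+ 2 = x ^+ 4 + 2 * (x ^+ 2 * y ^+ 2) + y ^+ 4; rewrite /N; lra.
  have h6 : 0 <= r ^+ 4 by rewrite -[4%N]/(2 * 2)%N exprM sqr_ge0.
  have := ler_wpM2l h6 NE.
  have -> : r ^+ 8 = r ^+ 4 * r ^+ 4 by ring.
  have -> : N ^+ 4 = N ^+ 2 * N ^+ 2 by ring.
  have := ler_wpM2l N2 rN; have := mulr_ge0 h6 h6; have := mulr_ge0 N2 N2.
  by rewrite -!mulrA; nra.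
rewrite E normrM (ger0_norm (poisson_ge0 _ y0)) [leRHS]mulrAC mulrC ler_pM2r ?poisson_gt0//.
rewrite normrM (ger0_norm (_ : 0 <= D^-1)) ?invr_ge0 ?(ltW D0)//.
rewrite normrM (ger0_norm (_ : 0 <= 4 * r ^+ 4)); last first.
  by rewrite mulr_ge0// exprn_ge0// ltW.
rewrite ler_pdivrMr//.
have yN : y ^+ 4 <= N ^+ 2.
  have -> : y ^+ 4 = y ^+ 2 ^+ 2 by ring.
  by rewrite lerXn2r ?nnegrE// ?sqr_ge0 ?(ltW N0)//; rewrite /N; lra.
have y40 : 0 < y ^+ 4 by rewrite exprn_gt0.
have r40 : 0 < r ^+ 4 by rewrite exprn_gt0.
apply: (@le_trans _ _ (4 * r ^+ 4 * (11 * N ^+ 2))).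
  by rewrite ler_wpM2l// mulr_ge0// ltW.
have -> : 176 / y ^+ 4 * r ^+ 4 * D = 176 * r ^+ 4 * D / y ^+ 4.
  by field; rewrite gt_eqF.
rewrite ler_pdivlMr//.
have h1 : N ^+ 2 * y ^+ 4 <= 4 * D.
  have : N ^+ 2 * y ^+ 4 <= N ^+ 2 * N ^+ 2 by rewrite ler_wpM2l.
  have NE : N ^+ 4 = N ^+ 2 * N ^+ 2 by ring.
  by move: DN; rewrite NE; lra.
have := ler_wpM2l (ltW r40) h1; lra.
Qed.

(** The first logarithm is ln |z + i|^2, which is harmonic and tends to infinity with |z|. The
    second has Laplacian -1/(1+y)^2 and makes the sum strictly superharmonic. *)
Definition barrier x y := ln (x ^+ 2 + (1 + y) ^+ 2) + ln (1 + y).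

Lemma ln_le_sub1 (t : R) : 0 < t -> ln t <= t - 1.
Proof. by move=> t0; rewrite -{1}(subrKC 1 t) le_ln1Dx//; lra. Qed.

(** By [four_factors] the first logarithm contributes ln (|w^4 - r^4|^2 / |w|^8) with w = z + i,
    which is O(r^4); the second contributes ln (1 - r^2/(1+y)^2). For small r the negative term
    wins. *)
Lemma lap4_barrier x y r : 0 <= y -> 0 < r <= 1 / 2 ->
  lap4 barrier x y r <= 4 * r ^+ 4 - r ^+ 2 / (1 + y) ^+ 2.
Proof.
move=> y0 /andP[r0 r1].
set Y := 1 + y; have Y1 : 1 <= Y by rewrite /Y; lra.
have Y0 : 0 < Y by lra.
set N := x ^+ 2 + Y ^+ 2.
have x20 := sqr_ge0 x.
have Y21 : 1 <= Y ^+ 2 by rewrite -(expr1n _ 2) lerXn2r ?nnegrE//; lra.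
have N1 : 1 <= N by rewrite /N; lra.
have N0 : 0 < N by lra.
have D1 : 0 < (x + r) ^+ 2 + Y ^+ 2 by exact: sqrD_gt0.
have D2 : 0 < (x - r) ^+ 2 + Y ^+ 2 by exact: sqrD_gt0.
have D3 : 0 < x ^+ 2 + (Y + r) ^+ 2 by apply: sqrD_gt0; lra.
have D4 : 0 < x ^+ 2 + (Y - r) ^+ 2 by apply: sqrD_gt0; lra.
have E : lap4 barrier x y r = ln ((((x + r) ^+ 2 + Y ^+ 2) * ((x - r) ^+ 2 + Y ^+ 2) *
    (x ^+ 2 + (Y + r) ^+ 2) * (x ^+ 2 + (Y - r) ^+ 2)) / N ^+ 4) +
    ln ((Y + r) * (Y - r) / Y ^+ 2).
  rewrite !ln_div ?posrE ?exprn_gt0 ?mulr_gt0//; try lra.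
  rewrite !lnM ?posrE ?mulr_gt0//; try lra.
  rewrite /lap4 /barrier !addrA -!/Y -/N.
  by lra.
have le1 : ln ((((x + r) ^+ 2 + Y ^+ 2) * ((x - r) ^+ 2 + Y ^+ 2) *
    (x ^+ 2 + (Y + r) ^+ 2) * (x ^+ 2 + (Y - r) ^+ 2)) / N ^+ 4) <= 4 * r ^+ 4.
  rewrite (le_trans (ln_le_sub1 _))//; first by rewrite divr_gt0 ?mulr_gt0 ?exprn_gt0.
  rewrite lerBlDr ler_pdivrMr ?exprn_gt0// four_factors -/N.
  have Re : - N ^+ 2 <= x ^+ 4 - 6 * x ^+ 2 * Y ^+ 2 + Y ^+ 4.
    have -> : x ^+ 4 - 6 * x ^+ 2 * Y ^+ 2 + Y ^+ 4 =
      2 * (x ^+ 2 - Y ^+ 2) ^+ 2 - N ^+ 2 by rewrite /N; ring.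
    by have := sqr_ge0 (x ^+ 2 - Y ^+ 2); lra.
  have r40 : 0 <= r ^+ 4 by rewrite exprn_ge0// ltW.
  have r41 : r ^+ 4 <= 1 by rewrite exprn_ile1//; lra.
  have N21 : 1 <= N ^+ 2 by rewrite -(expr1n _ 2) lerXn2r ?nnegrE//; lra.
  have := ler_wpM2l r40 Re.
  have -> : r ^+ 8 = r ^+ 4 * r ^+ 4 by ring.
  have -> : N ^+ 4 = N ^+ 2 * N ^+ 2 by ring.
  have h1 : r ^+ 4 * r ^+ 4 <= r ^+ 4 by rewrite -[leRHS]mulr1 ler_wpM2l.
  have h2 : N ^+ 2 <= N ^+ 2 * N ^+ 2 by rewrite ler_peMr//; lra.
  have h3 : r ^+ 4 <= r ^+ 4 * (N ^+ 2 * N ^+ 2) by rewrite ler_peMr//; lra.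
  have := ler_wpM2l r40 h2; lra.
have le2 : ln ((Y + r) * (Y - r) / Y ^+ 2) <= - (r ^+ 2 / Y ^+ 2).
  have hp : 0 < (Y + r) * (Y - r) / Y ^+ 2.
    by rewrite divr_gt0 ?exprn_gt0 ?mulr_gt0//; lra.
  rewrite (le_trans (ln_le_sub1 hp))//.
  by rewrite le_eqVlt; apply/orP; left; apply/eqP; field; rewrite gt_eqF.
by rewrite E; lra.
Qed.

Lemma barrier_continuous x y : 0 < y ->
  {for (x, y), continuous (fun z : R * R => barrier z.1 z.2)}.
Proof.
move=> y0.
have c1 : (fun z : R * R => z.1) @ (x, y) --> x by exact: cvg_fst.
have c2 : (fun z : R * R => 1 + z.2) @ (x, y) --> 1 + y.
  by apply: cvgD; [exact: cvg_cst|exact: cvg_snd].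
apply: cvgD.
  apply: (@continuous_comp _ _ _ (fun z : R * R => z.1 ^+ 2 + (1 + z.2) ^+ 2) (@ln R)); last first.
    by apply: continuous_ln; apply: sqrD_gt0 => /=; lra.
  by apply: cvgD; rewrite expr2; apply: cvgM.
apply: (@continuous_comp _ _ _ (fun z : R * R => 1 + z.2) (@ln R)) => //.
by apply: continuous_ln => /=; lra.
Qed.

Lemma barrier_ge0 x y : 0 <= y -> 0 <= barrier x y.
Proof.
move=> y0; rewrite addr_ge0// ln_ge0//; last lra.
by have := sqr_ge0 x; have : 1 <= (1 + y) ^+ 2; [rewrite -(expr1n _ 2) lerXn2r ?nnegrE//|]; lra.
Qed.

Lemma barrier_coercive (B : R) : exists2 L : R, 0 < L &
  forall x y, 0 <= y -> L <= `|x| \/ L <= y -> B <= barrier x y.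
Proof.
exists (expR `|B|); first exact: expR_gt0.
move=> x y y0 xy; have L1 : 1 <= expR `|B| by rewrite -expR0 ler_expR.
rewrite -[B]addr0 lerD ?ln_ge0//; try lra.
rewrite (le_trans (ler_norm B))// -[leLHS]expRK ler_ln ?posrE ?expR_gt0//; last first.
  by apply: sqrD_gt0; lra.
have LL : expR `|B| <= expR `|B| ^+ 2 by rewrite expr2 ler_peMr//; lra.
case: xy => [xL|yL].
  have : expR `|B| ^+ 2 <= x ^+ 2.
    by rewrite -(real_normK (num_real x)) lerXn2r ?nnegrE//; lra.
  have := sqr_ge0 (1 + y); lra.
have : expR `|B| ^+ 2 <= (1 + y) ^+ 2 by rewrite lerXn2r ?nnegrE//; lra.
have := sqr_ge0 x; lra.
Qed.

(** Here [r] plays the role of a scale tending to 0+; compactness of the segment turns locally valid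
    scales into a common one. *)
Lemma near_covering_segment (P : R -> R -> Prop) (a b : R) :
  (forall x, a <= x <= b -> exists2 d : R, 0 < d &
     forall x' r, `|x' - x| < d -> 0 < r < d -> P x' r) ->
  exists2 d : R, 0 < d & forall x r, a <= x <= b -> 0 < r < d -> P x r.
Proof.
move=> H.
have /compact_near_coveringP : compact `[a, b] by exact: segment_compact.
move=> /(_ R (at_right 0) (fun r x => P x r)) [].
  move=> x /= xab; have [|d d0 dP] := H x; first by move: xab; rewrite in_itv.
  exists (ball x d, [set r | 0 < r < d]).
    split; first exact: nbhsx_ballx.
    exists d => //= r /=; rewrite sub0r normrN => rd r0.
    by rewrite r0/= (le_lt_trans (ler_norm _)).
  move=> [x' r]/= [x'x rd]; apply: dP => //.
  by move: x'x; rewrite /ball/= distrC.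
move=> d /= d0 dP; exists d => // x r xab /andP[r0 rd].
by apply: (dP r) => //=; rewrite ?sub0r ?normrN ?gtr0_norm// in_itv.
Qed.

(** If V were positive somewhere, V - e * barrier would have a positive maximum over a large box,
    attained away from its edges: the barrier excludes the far part and the boundary hypothesis the
    bottom. At that point the four-point Laplacian of the difference is at most 0, so that of V is
    at most e times that of the barrier, a negative multiple of r^2, against the hypothesis
    o(r^2). *)
Lemma max_principle V (B : R) :
  (forall x y, 0 < y -> {for (x, y), continuous (fun z : R * R => V z.1 z.2)}) ->
  (forall x y, 0 < y -> V x y <= B) ->
  (forall x e, 0 < e -> exists2 d : R, 0 < d &
     forall x' y, `|x' - x| < d -> 0 < y < d -> V x' y <= e) ->
  (forall x y e, 0 < y -> 0 < e -> exists2 d : R, 0 < d &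
     forall r, 0 < r < d -> `|lap4 V x y r| <= e * r ^+ 2) ->
  forall x y, 0 < y -> V x y <= 0.
Proof.
move=> cV VB V0 lapV x0 y0 y00; rewrite leNgt; apply/negP => V00.
pose eta := V x0 y0; have eta0 : 0 < eta by [].
have b0 : 0 < barrier x0 y0 + 1 by have := barrier_ge0 x0 (ltW y00); lra.
pose e := eta / (2 * (barrier x0 y0 + 1)).
have e0 : 0 < e by rewrite divr_gt0// mulr_gt0.
have eb : e * barrier x0 y0 <= eta / 2.
  have -> : eta / 2 = e * (barrier x0 y0 + 1) by rewrite /e; field; rewrite gt_eqF.
  by rewrite ler_wpM2l ?(ltW e0)//; lra.
(* At distance [L0] or more the barrier is at least B / e, so the difference [W] is at most 0 there,
   while it is at least eta / 2 at (x0, y0). *)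
have [L0 L00 coer] := barrier_coercive (B / e).
pose L := L0 + `|x0| + y0 + 1.
have L0L : L0 + 1 <= L by rewrite /L; have := normr_ge0 x0; lra.
have [d d0 dV] : exists2 d : R, 0 < d & forall x y, - L <= x <= L -> 0 < y < d -> V x y <= eta / 4.
  by apply: near_covering_segment => x _; apply: V0; rewrite divr_gt0.
pose d' := Num.min (d / 2) (y0 / 2).
have d'0 : 0 < d' by rewrite lt_min; lra.
have d'd : d' <= d / 2 by rewrite ge_min lexx.
have d'y : d' <= y0 / 2 by rewrite ge_min lexx orbT.
pose W (z : R * R) := V z.1 z.2 - e * barrier z.1 z.2.
pose K : set (R * R) := `[- L, L]%classic `*` `[d', L]%classic.
have cK : compact K by apply: compact_setX; exact: segment_compact.
have Kz x y : K (x, y) <-> (- L <= x <= L) /\ (d' <= y <= L).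
  by rewrite /K /= !in_itv.
have cW : {within K, continuous W}.
  apply: continuous_in_subspaceT => -[x y]; rewrite inE Kz => -[_ /andP[dy _]].
  have y'0 : 0 < y by lra.
  apply: cvgB; first exact: cV.
  by apply: cvgM; [exact: cvg_cst|exact: barrier_continuous].
have Kx0 : K (x0, y0).
  have := ler_norm x0; have hx : - `|x0| <= x0 by rewrite lerNl -normrN ler_norm.
  by rewrite Kz /L; have := normr_ge0 x0; split; apply/andP; split; lra.
have [[cx cy] cK' cmax] : exists2 c, K c & forall z, K z -> W z <= W c.
  have [|c /[1!inE] Kc cm] := compact_EVT_max _ cK cW; first by exists (x0, y0).
  by exists c => // z Kz'; apply: cm; rewrite inE.
move: (cK'); rewrite Kz => -[cxL /andP[dcy cyL]].
have cy0 : 0 < cy by lra.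
have Wc : eta / 2 <= W (cx, cy).
  by apply: le_trans (cmax _ Kx0); rewrite /W/= -/eta; lra.
have far : L0 <= `|cx| \/ L0 <= cy -> False.
  move=> /(coer _ _ (ltW cy0)); rewrite ler_pdivrMr// => h.
  by have := VB cx cy cy0; move: Wc; rewrite /W/=; lra.
have cxL0 : `|cx| < L0 by rewrite ltNge; apply/negP => ?; apply: far; left.
have cyL0 : cy < L0 by rewrite ltNge; apply/negP => ?; apply: far; right.
have dcy' : d <= cy.
  rewrite leNgt; apply/negP => cyd.
  have := dV cx cy cxL; rewrite cy0 cyd => /(_ isT).
  have := mulr_ge0 (ltW e0) (barrier_ge0 cx (ltW cy0)).
  by move: Wc; rewrite /W/= /eta; lra.
(* A quarter of the gain e/(1+cy)^2. The last bound in [r] keeps the fourth-order error below e'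
   r^2, so the barrier side is at most -3 e' r^2, while [lap4] of V is at least -e' r^2. *)
pose e' := e / (4 * (1 + cy) ^+ 2).
have cy1 : 0 < (1 + cy) ^+ 2 by rewrite exprn_gt0//; lra.
have e'0 : 0 < e' by rewrite divr_gt0// mulr_gt0.
have [d1 d10 d1V] := lapV cx cy e' cy0 e'0.
pose r := Num.min (d1 / 2) (Num.min (d / 2) (Num.min (1 / 2) ((1 + cy)^-1 / 4))).
have cyV : 0 < (1 + cy)^-1 by rewrite invr_gt0; lra.
have r0 : 0 < r by rewrite /r !lt_min; apply/and4P; split; lra.
have rd1 : r <= d1 / 2 by rewrite ge_min lexx.
have rd : r <= d / 2 by rewrite !ge_min lexx orbT.
have r2 : r <= 1 / 2 by rewrite !ge_min lexx !orbT.
have rcy : r <= (1 + cy)^-1 / 4 by rewrite !ge_min lexx !orbT.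
have := d1V r; rewrite r0/=.
have -> : r < d1 by lra.
move=> /(_ isT); rewrite ler_norml => /andP[lapV1 _].
move: cxL0; rewrite ltr_norml => /andP[cx1 cx2].
have W1 := cmax (cx + r, cy); have W2 := cmax (cx - r, cy).
have W3 := cmax (cx, cy + r); have W4 := cmax (cx, cy - r).
have {}W1 : W (cx + r, cy) <= W (cx, cy) by apply: W1; rewrite Kz; lra.
have {}W2 : W (cx - r, cy) <= W (cx, cy) by apply: W2; rewrite Kz; lra.
have {}W3 : W (cx, cy + r) <= W (cx, cy) by apply: W3; rewrite Kz; lra.
have {}W4 : W (cx, cy - r) <= W (cx, cy) by apply: W4; rewrite Kz; lra.
have lapW : lap4 V cx cy r <= e * lap4 barrier cx cy r.
  by move: W1 W2 W3 W4; rewrite /W /lap4 /=; lra.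
have hb : lap4 barrier cx cy r <= 4 * r ^+ 4 - r ^+ 2 / (1 + cy) ^+ 2.
  by apply: lap4_barrier; rewrite ?r0// ltW.
have := ler_wpM2l (ltW e0) hb.
have eE : e / (1 + cy) ^+ 2 = 4 * e' by rewrite /e'; field; lra.
have r22 : r ^+ 2 <= ((1 + cy) ^+ 2)^-1 / 16.
  have -> : ((1 + cy) ^+ 2)^-1 / 16 = ((1 + cy)^-1 / 4) ^+ 2 by field; lra.
  by rewrite lerXn2r ?nnegrE//; lra.
have r20 : 0 < r ^+ 2 by rewrite exprn_gt0.
have h4 : e * r ^+ 4 * 4 <= e' * r ^+ 2.
  have -> : r ^+ 4 = r ^+ 2 * r ^+ 2 by ring.
  have -> : e' = e * (((1 + cy) ^+ 2)^-1 / 16) * 4 by rewrite /e'; field; lra.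
  by have := ler_wpM2l (mulr_ge0 (ltW e0) (ltW r20)) r22; lra.
have -> : e * (4 * r ^+ 4 - r ^+ 2 / (1 + cy) ^+ 2) = 4 * (e * r ^+ 4) - r ^+ 2 * (e / (1 + cy) ^+ 2).
  by field; lra.
by rewrite eE; have := mulr_gt0 e'0 r20; lra.
Qed.

End MaxPrinciple.

(** * Poisson representation of bounded functions *)

Section PoissonIntegral.
Context {R : realType}.
Local Notation mu := (@lebesgue_measure R).
Implicit Types (x y r e B c : R) (f g : R -> R).

Definition pint f x y := \int[mu]_t (poisson y (x - t) * f t).

(** Every kernel has mass one, so a pointwise bound by kernels yields integrability and the value
    [c1 + c2] together. The second height serves tails treated by [poisson_tail]. *)
Lemma dominated_by_poisson g x y1 y2 c1 c2 : 0 < y1 -> 0 < y2 ->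
  measurable_fun setT g ->
  (forall t, `|g t| <= c1 * poisson y1 (x - t) + c2 * poisson y2 (x - t)) ->
  mu.-integrable setT (EFin \o g) /\ `|\int[mu]_t g t| <= c1 + c2.
Proof.
move=> y10 y20 mg gle.
have i12 : mu.-integrable setT
    (EFin \o (fun t => c1 * poisson y1 (x - t) + c2 * poisson y2 (x - t))).
  by apply: integrable_addr => //; apply: integrable_mulrl => //; exact: integrable_poissonB.
have ig : mu.-integrable setT (EFin \o g).
  apply: le_integrable i12 => //; first exact/measurable_EFinP.
  by move=> t _ /=; rewrite lee_fin (le_trans (gle t))// ler_norm.
split => //.
apply: (le_trans (le_normr_Rintegral measurableT ig)).
apply: (@le_trans _ _ (\int[mu]_t (c1 * poisson y1 (x - t) + c2 * poisson y2 (x - t)))).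
  by apply: le_Rintegral => //; exact: integrable_normr.
have i1' := integrable_poissonB x y10; have i2' := integrable_poissonB x y20.
have i1 := integrable_mulrl measurableT c1 i1'.
have i2 := integrable_mulrl measurableT c2 i2'.
rewrite RintegralD// (RintegralZl _ measurableT i1') (RintegralZl _ measurableT i2').
by rewrite !Rintegral_poissonB// !mulr1.
Qed.

Lemma integrable_pint_bounded f x y B : 0 < y -> measurable_fun setT f ->
  (forall t, `|f t| <= B) ->
  mu.-integrable setT (EFin \o (fun t => poisson y (x - t) * f t)) /\
  `|pint f x y| <= B.
Proof.
move=> y0 mf fB.
have [|t|ig] := @dominated_by_poisson (fun t => poisson y (x - t) * f t) x y y B 0 y0 y0.
- by apply: measurable_funM => //; exact: measurable_poissonB.
- rewrite mul0r addr0 normrM ger0_norm ?poisson_ge0// mulrC ler_wpM2r//.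
  exact: poisson_ge0.
- by rewrite addr0.
Qed.

Lemma pint_lipschitz f x y x' y' B : 0 < y -> measurable_fun setT f ->
  (forall t, `|f t| <= B) -> `|x' - x| <= y / 2 -> `|y' - y| <= y / 2 ->
  `|pint f x' y' - pint f x y| <= 4 / y * (`|x' - x| + `|y' - y|) * B.
Proof.
move=> y0 mf fB xx yy.
have y'0 : 0 < y' by move: yy; rewrite ler_norml => /andP[]; lra.
have [i1 _] := integrable_pint_bounded x y0 mf fB.
have [i2 _] := integrable_pint_bounded x' y'0 mf fB.
rewrite /pint -RintegralB//.
set C := 4 / y * _.
have [|t|_ +] := @dominated_by_poisson
    (fun t => poisson y' (x' - t) * f t - poisson y (x - t) * f t) x y y (C * B) 0 y0 y0.
- by apply: measurable_funB; apply: measurable_funM => //; exact: measurable_poissonB.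
- rewrite mul0r addr0 -mulrBl normrM mulrAC ler_pM//.
  have := @poisson_ratio _ y y' (x - t) (x' - t) y0.
  by rewrite (_ : x' - t - (x - t) = x' - x); [exact|ring].
- by rewrite addr0.
Qed.

(** The kernel estimate integrated against [f], in place of differentiating twice under the integral
    sign. *)
Lemma pint_lap4 f x y r B : 0 < y -> measurable_fun setT f ->
  (forall t, `|f t| <= B) -> 0 < r <= y / 2 ->
  `|lap4 (pint f) x y r| <= 176 / y ^+ 4 * B * r ^+ 4.
Proof.
move=> y0 mf fB /andP[r0 ry].
have yr0 : 0 < y + r by lra.
have ry0 : 0 < y - r by lra.
have [i0 _] := integrable_pint_bounded x y0 mf fB.
have [i1 _] := integrable_pint_bounded (x + r) y0 mf fB.
have [i2 _] := integrable_pint_bounded (x - r) y0 mf fB.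
have [i3 _] := integrable_pint_bounded x yr0 mf fB.
have [i4 _] := integrable_pint_bounded x ry0 mf fB.
have i04 := integrable_mulrl measurableT 4 i0.
have i12 := integrable_addr measurableT i1 i2.
have i123 := integrable_addr measurableT i12 i3.
have i1234 := integrable_addr measurableT i123 i4.
have E : lap4 (pint f) x y r =
    \int[mu]_t (lap4 (fun x y => poisson y x) (x - t) y r * f t).
  rewrite /lap4 /pint -RintegralZl// -!RintegralD// -RintegralB//.
  apply: eq_Rintegral => t _ /=.
  rewrite (_ : x + r - t = x - t + r); last ring.
  by rewrite (_ : x - r - t = x - t - r); ring.
rewrite E; set C := 176 / y ^+ 4.
have [||_ +] := @dominated_by_poisson
    (fun t => lap4 (fun x y => poisson y x) (x - t) y r * f t) x y y (C * B * r ^+ 4) 0 y0 y0.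
- apply: measurable_funM => //.
  rewrite /lap4; apply: measurable_funB.
    apply: measurable_funD; last exact: measurable_poissonB.
    apply: measurable_funD; last exact: measurable_poissonB.
    apply: measurable_funD.
      under eq_fun do rewrite addrAC; exact: measurable_poissonB.
    under eq_fun do rewrite addrAC; exact: measurable_poissonB.
  by apply: measurable_funM => //; exact: measurable_poissonB.
- move=> t; rewrite mul0r addr0 normrM.
  have /= h := @lap4_poisson _ y (x - t) r y0.
  have -> : C * B * r ^+ 4 * poisson y (x - t) = (C * poisson y (x - t) * r ^+ 4) * B.
    by ring.
  by apply: ler_pM => //; apply: h; rewrite r0.
- by rewrite addr0.
Qed.

Lemma pint_boundary f x B e : measurable_fun setT f -> (forall t, `|f t| <= B) ->
  {for x, continuous f} -> 0 < e ->
  exists2 d : R, 0 < d & forall x' y, `|x' - x| < d -> 0 < y < d ->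
    `|pint f x' y - f x| <= e.
Proof.
move=> mf fB cf e0.
have B0 : 0 <= B by rewrite (le_trans _ (fB 0)).
have [d d0 dP] : exists2 d : R, 0 < d & forall t, `|t - x| < 2 * d -> `|f t - f x| <= e / 2.
  have /cvgrPdist_le /(_ (e / 2)) := cf; rewrite divr_gt0// => /(_ isT) [d /= d0 dP].
  exists (d / 2); first by rewrite divr_gt0.
  move=> t td; rewrite distrC; apply: dP => /=; rewrite distrC.
  by rewrite (lt_le_trans td)//; lra.
(* The second entry makes the tail contribution 4yB/d at most e/2; the [+ 1] keeps the denominator
   positive when B = 0. *)
pose d1 := Num.min d (e * d / (8 * B + 1)).
have h8 : 0 < 8 * B + 1 by lra.
exists d1; first by rewrite lt_min d0/= divr_gt0// mulr_gt0.
move=> x' y; rewrite lt_min => /andP[xd _] /andP[y0]; rewrite lt_min => /andP[_ yd].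
have [i1 _] := integrable_pint_bounded x' y0 mf fB.
have i2 := integrable_poissonB x' y0.
have -> : pint f x' y - f x = \int[mu]_t (poisson y (x' - t) * (f t - f x)).
  under eq_Rintegral do rewrite mulrBr.
  rewrite RintegralB//; last first.
    by have := integrableZr measurableT (f x) i2; apply: eq_integrable.
  by rewrite (RintegralZr _ measurableT i2) Rintegral_poissonB// mul1r.
have [||_ +] := @dominated_by_poisson
    (fun t => poisson y (x' - t) * (f t - f x)) x' y d (e / 2) (2 * y / d * (2 * B)) y0 d0.
- apply: measurable_funM; first exact: measurable_poissonB.
  exact: measurable_funB.
- move=> t; rewrite normrM ger0_norm ?poisson_ge0//.
  have P0 := poisson_ge0 (x' - t) y0; have P1 := poisson_ge0 (x' - t) d0.
  have f2B : `|f t - f x| <= 2 * B.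
    by rewrite (le_trans (ler_normB _ _))//; have := fB t; have := fB x; lra.
  have c0 : 0 <= 2 * y / d * (2 * B).
    by rewrite !mulr_ge0// ?invr_ge0 ltW.
  have [ltd|led] := ltP `|x' - t| d.
    have ft : `|f t - f x| <= e / 2.
      apply: dP; rewrite (le_lt_trans (ler_distD x' _ _))// distrC; lra.
    rewrite (le_trans _ (ler_wpDr (mulr_ge0 c0 P1) (lexx _)))//.
    by rewrite mulrC ler_wpM2r.
  have e20 : 0 <= e / 2 by lra.
  rewrite (le_trans _ (ler_wpDl (mulr_ge0 e20 P0) (lexx _)))//.
  by rewrite [leRHS]mulrAC; apply: ler_pM => //; exact: poisson_tail.
- move=> /le_trans; apply.
  have : y * (8 * B + 1) <= e * d by rewrite -ler_pdivlMr// ltW.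
  rewrite (_ : 2 * y / d * (2 * B) = 4 * y * B / d); last by ring.
  rewrite -lerBrDl ler_pdivrMr//; lra.
Qed.

Lemma cvg_pair_cst (x s : R) : (t, s) @[t --> x] --> (x, s).
Proof.
move=> A [[A1 A2] /= [h1 h2] hA]; apply: filterS h1 => t A1t.
by apply: hA; split => //=; exact: nbhs_singleton.
Qed.

Lemma cvg_pair_addr (s x y : R) :
  (z.1, s + z.2) @[z --> (x, y)] --> (x, s + y).
Proof.
have c1 : z.1 @[z --> (x, y)] --> x by exact: cvg_fst.
have c2 : s + z.2 @[z --> (x, y)] --> s + y.
  by apply: cvgD; [exact: cvg_cst|exact: cvg_snd].
exact: (cvg_pair c1 c2).
Qed.

(** The difference of the two sides is bounded, tends to 0 at the boundary by [pint_boundary] and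
    the continuity of [G] up to height [s], and satisfies the four-point condition, so
    [max_principle] applies to it and to its opposite. [G] is only assumed continuous with small
    [lap4], so that the statement also covers horizontal averages of harmonic functions. *)
Lemma bounded_representation (G : R -> R -> R) s B :
  (forall x y, s <= y -> {for (x, y), continuous (fun z : R * R => G z.1 z.2)}) ->
  (forall x y, s <= y -> `|G x y| <= B) ->
  (forall x y e, s < y -> 0 < e -> exists2 d : R, 0 < d &
     forall r, 0 < r < d -> `|lap4 G x y r| <= e * r ^+ 2) ->
  forall x y, 0 < y -> G x (s + y) = pint (G^~ s) x y.
Proof.
move=> cG GB lapG.
pose f := G^~ s.
have cf : continuous f.
  move=> x; apply: (@continuous_comp _ _ _ (fun x => (x, s)) (fun z : R * R => G z.1 z.2)).
    exact: cvg_pair_cst.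
  exact: cG.
have mf : measurable_fun setT f by exact: continuous_measurable_fun.
have fB t : `|f t| <= B by exact: GB.
have B0 : 0 <= B by rewrite (le_trans _ (fB 0)).
pose V x y := G x (s + y) - pint f x y.
have cV x y : 0 < y -> {for (x, y), continuous (fun z : R * R => V z.1 z.2)}.
  move=> y0; apply: cvgB.
    apply: (@continuous_comp _ _ _ (fun z : R * R => (z.1, s + z.2)) (fun z : R * R => G z.1 z.2)).
      exact: cvg_pair_addr.
    by apply: cG; rewrite /=; lra.
  apply/cvgrPdist_le => e e0 /=.
  pose d := Num.min (y / 2) (e * y / (8 * B + 1)).
  have h8 : 0 < 8 * B + 1 by lra.
  have d0 : 0 < d by rewrite lt_min !divr_gt0// mulr_gt0.
  exists (ball x d, ball y d); first by split; exact: nbhsx_ballx.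
  move=> [x' y'] /= [xd yd]; rewrite distrC.
  move: xd yd; rewrite /ball/= (distrC x x') (distrC y y') !lt_min.
  move=> /andP[/ltW xy xd] /andP[/ltW yy yd].
  rewrite (le_trans (pint_lipschitz y0 mf fB xy yy))//.
  apply: (@le_trans _ _ (4 / y * (2 * (e * y / (8 * B + 1))) * B)).
    rewrite ler_wpM2r// ler_wpM2l ?divr_ge0 ?(ltW y0)//; lra.
  have -> : 4 / y * (2 * (e * y / (8 * B + 1))) * B = e * (8 * B) / (8 * B + 1).
    by field; rewrite !gt_eqF.
  by rewrite ler_pdivrMr// ler_wpM2l ?(ltW e0)//; lra.
have VB x y : 0 < y -> `|V x y| <= B + B.
  move=> y0; rewrite (le_trans (ler_normB _ _))// lerD//; first by apply: GB; lra.
  exact: (integrable_pint_bounded x y0 mf fB).2.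
have V0 x e : 0 < e -> exists2 d : R, 0 < d &
     forall x' y, `|x' - x| < d -> 0 < y < d -> `|V x' y| <= e.
  move=> e0; have e20 : 0 < e / 2 by lra.
  have [d1 d10 d1P] := pint_boundary mf fB (cf x) e20.
  have /cvgrPdist_le /(_ (e / 2) e20) [[A1 A2]] := cG x s (lexx s).
  move=> /= [[a1 a10 A1P] [a2 a20 A2P]] AP.
  exists (Num.min d1 (Num.min a1 a2)); first by rewrite !lt_min d10 a10.
  move=> x' y; rewrite !lt_min => /and3P[x1 x2 x3] /andP[y0 /and3P[y1 y2 y3]].
  have h1 : `|pint f x' y - f x| <= e / 2 by apply: d1P => //; rewrite y0.
  have h2 : `|G x s - G x' (s + y)| <= e / 2.
    apply: (AP (x', s + y)); split; [apply: A1P|apply: A2P].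
      by rewrite /ball_ /= distrC.
    by rewrite /ball_ /= opprD addNKr normrN gtr0_norm.
  have -> : V x' y = - (G x s - G x' (s + y)) - (pint f x' y - f x).
    by rewrite /V /f; ring.
  by rewrite (le_trans (ler_normB _ _))// normrN; lra.
have lapV x y e : 0 < y -> 0 < e -> exists2 d : R, 0 < d &
     forall r, 0 < r < d -> `|lap4 V x y r| <= e * r ^+ 2.
  move=> y0 e0; have e20 : 0 < e / 2 by lra.
  have sy : s < s + y by lra.
  have [d d0 dP] := lapG x (s + y) (e / 2) sy e20.
  pose C := 176 / y ^+ 4 * B.
  have C0 : 0 <= C by rewrite mulr_ge0// divr_ge0// exprn_ge0// ltW.
  exists (Num.min d (Num.min (y / 2) (Num.min 1 (e / 2 / (C + 1))))).
    by rewrite !lt_min d0 ltr01/= !divr_gt0//; lra.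
  move=> r /andP[r0]; rewrite !lt_min => /and4P[rd ry r1 re].
  have -> : lap4 V x y r = lap4 G x (s + y) r - lap4 (pint f) x y r.
    by rewrite /lap4 /V !addrA; ring.
  rewrite (le_trans (ler_normB _ _))//.
  have h1 : `|lap4 G x (s + y) r| <= e / 2 * r ^+ 2 by apply: dP; rewrite r0.
  have h2 : `|lap4 (pint f) x y r| <= C * r ^+ 4.
    by apply: pint_lap4 => //; rewrite r0 ltW.
  have h3 : C * r ^+ 4 <= e / 2 * r ^+ 2.
    rewrite (_ : r ^+ 4 = r ^+ 2 * r ^+ 2); last ring.
    rewrite mulrA ler_wpM2r ?sqr_ge0//.
    have r2r : r ^+ 2 <= r by rewrite expr2 ler_piMr// ltW.
    have : r * (C + 1) <= e / 2 by rewrite -ler_pdivlMr ?ltW//; lra.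
    by have := ler_wpM2l C0 r2r; lra.
  lra.
move=> x y y0; apply/eqP; rewrite -subr_eq0 -/f -/(V x y) eq_le; apply/andP; split.
  apply: (@max_principle _ V (B + B)) => //.
  - by move=> *; rewrite (le_trans (ler_norm _))// VB.
  - move=> x0 e e0; have [d d0 dP] := V0 x0 e e0; exists d => // x' y' h1 h2.
    by rewrite (le_trans (ler_norm _))// dP.
rewrite -oppr_le0.
apply: (@max_principle _ (fun x y => - V x y) (B + B)) => //.
- by move=> x1 y1 y10; apply: cvgN; exact: cV.
- by move=> *; rewrite (le_trans (ler_norm _))// normrN VB.
- move=> x0 e e0; have [d d0 dP] := V0 x0 e e0; exists d => // x' y' h1 h2.
  by rewrite (le_trans (ler_norm _))// normrN dP.
- move=> x0 y1 e y10 e0; have [d d0 dP] := lapV x0 y1 e y10 e0; exists d => // r rd.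
  rewrite (_ : lap4 _ _ _ _ = - lap4 V x0 y1 r); first by rewrite normrN dP.
  by rewrite /lap4; ring.
Qed.

End PoissonIntegral.

(** * Harmonic functions in a half-plane *)

Section SecondDifference.
Context {R : realType}.
Local Notation mu := (@lebesgue_measure R).
Implicit Types (x y r e d : R) (g : R -> R) (f : R * R -> R).

Lemma is_derive_shift g x t l : is_derive (x + t) 1 g l ->
  is_derive t 1 (fun t => g (x + t)) l.
Proof.
move=> dg.
have d1 : is_derive t 1 (fun t => x + t) 1.
  by have := is_deriveD (is_derive_cst x t 1) (is_derive_id t 1); rewrite add0r.
have := @is_derive1_comp _ g (fun t => x + t) t _ _ dg d1.
by rewrite mulr1.
Qed.

Lemma is_derive_reflect g x t l : is_derive (x - t) 1 g l ->
  is_derive t 1 (fun t => g (x - t)) (- l).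
Proof.
move=> dg.
have d1 : is_derive t 1 (fun t => x - t) (-1).
  by have := is_deriveB (is_derive_cst x t 1) (is_derive_id t 1); rewrite sub0r.
have := @is_derive1_comp _ g (fun t => x - t) t _ _ dg d1.
by rewrite mulrN1.
Qed.

Lemma is_derive_within_continuous g dg (i : interval R) :
  (forall t, t \in i -> is_derive t 1 g (dg t)) -> {within [set` i], continuous g}.
Proof. by move=> h; apply: derivable_within_continuous => t ti; have [] := h t ti. Qed.

(** Two mean value steps: for g(x+t) + g(x-t) - K t^2 on [0, r], then for [dg] on [x-c, x+c]. [K]
    need not be the second derivative at [x]: it is later taken at a fixed nearby point, which makes
    the bound uniform in [x]. *)
Lemma second_difference g (dg d2g : R -> R) x d (K : R) e r :
  (forall t, `|t - x| < d -> is_derive t 1 g (dg t)) ->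
  (forall t, `|t - x| < d -> is_derive t 1 dg (d2g t)) ->
  (forall t, `|t - x| < d -> `|d2g t - K| <= e) ->
  0 < r < d -> `|g (x + r) + g (x - r) - 2 * g x - K * r ^+ 2| <= 2 * e * r ^+ 2.
Proof.
move=> dgP d2gP Ke /andP[r0 rd].
pose psi t := g (x + t) + g (x - t) - K * t ^+ 2.
pose dpsi t := dg (x + t) - dg (x - t) - K * (2 * t).
have near1 t : `|t| < d -> `|x + t - x| < d by rewrite addrAC subrr add0r.
have near2 t : `|t| < d -> `|x - t - x| < d by rewrite addrAC subrr add0r normrN.
have e0 : 0 <= e by apply: le_trans (Ke x _) => //; rewrite subrr normr0; lra.
have dpsiP (t : R) : `|t| < d -> is_derive t 1 psi (dpsi t).
  move=> td; have h1 := is_derive_shift (dgP _ (near1 t td)).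
  have h2 := is_derive_reflect (dgP _ (near2 t td)).
  have h3 : is_derive t 1 (fun t : R => K * t ^+ 2) (K * (2 * t)).
    by apply: is_derive_eq; rewrite /GRing.scale/=; ring.
  exact: is_deriveB (is_deriveD h1 h2) h3.
have [||c] := @MVT _ psi dpsi 0 r r0.
- by move=> t; rewrite in_itv/= => /andP[t0 tr]; apply: dpsiP; rewrite gtr0_norm//; lra.
- apply: (@is_derive_within_continuous _ dpsi) => t; rewrite in_itv/= => /andP[t0 tr].
  by apply: dpsiP; rewrite ger0_norm//; lra.
rewrite in_itv/= => /andP[c0 cr].
have -> : psi r - psi 0 = g (x + r) + g (x - r) - 2 * g x - K * r ^+ 2.
  by rewrite /psi addr0 subr0 expr0n/=; ring.
rewrite subr0 => ->; rewrite normrM (gtr0_norm r0) expr2 mulrA ler_wpM2r ?(ltW r0)//.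
have [|||xi] := @MVT _ dg d2g (x - c) (x + c); first lra.
- move=> t; rewrite in_itv/= => /andP[t1 t2]; apply: d2gP.
  by rewrite ltr_norml; apply/andP; split; lra.
- apply: (@is_derive_within_continuous _ d2g) => t; rewrite in_itv/= => /andP[t1 t2].
  by apply: d2gP; rewrite ltr_norml; apply/andP; split; lra.
rewrite in_itv/= => /andP[xi1 xi2] E.
have -> : dpsi c = (d2g xi - K) * (2 * c) by rewrite /dpsi E; ring.
have xid : `|xi - x| < d by rewrite ltr_norml; apply/andP; split; lra.
rewrite normrM (_ : 2 * e * r = e * (2 * r)); last ring.
apply: ler_pM => //; first exact: Ke.
by rewrite gtr0_norm; lra.
Qed.

Lemma is_derive_dx f x y : derivable f (x, y) (@e1 R) ->
  is_derive x 1 (fun t => f (t, y)) (dx f (x, y)).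
Proof.
move=> df.
have E : (fun h : R => h^-1 *: (((fun t => f (t, y)) \o shift x) (h *: 1) - f (x, y))) =
    (fun h : R => h^-1 *: ((f \o shift (x, y)) (h *: @e1 R) - f (x, y))).
  apply/funext => h /=; congr (_ *: (f _ - _)).
  by rewrite -[RHS]/(h *: (1 : R) + x, h *: (0 : R) + y) scaler0 add0r.
split.
  by rewrite /derivable E.
by rewrite /dx /derive E.
Qed.

Lemma is_derive_dy f x y : derivable f (x, y) (@e2 R) ->
  is_derive y 1 (fun t => f (x, t)) (dy f (x, y)).
Proof.
move=> df.
have E : (fun h : R => h^-1 *: (((fun t => f (x, t)) \o shift y) (h *: 1) - f (x, y))) =
    (fun h : R => h^-1 *: ((f \o shift (x, y)) (h *: @e2 R) - f (x, y))).
  apply/funext => h /=; congr (_ *: (f _ - _)).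
  by rewrite -[RHS]/(h *: (0 : R) + x, h *: (1 : R) + y) scaler0 add0r.
split.
  by rewrite /derivable E.
by rewrite /dy /derive E.
Qed.

Lemma continuous_box f x y e : {for (x, y), continuous f} -> 0 < e ->
  exists2 d : R, 0 < d & forall x' y', `|x' - x| < d -> `|y' - y| < d ->
    `|f (x', y') - f (x, y)| <= e.
Proof.
move=> /cvgrPdist_le cf e0; have [[A1 A2] /= [[a1 a10 A1P] [a2 a20 A2P]] AP] := cf e e0.
exists (Num.min a1 a2); first by rewrite lt_min a10.
move=> x' y'; rewrite !lt_min => /andP[x1 x2] /andP[y1 y2]; rewrite distrC.
by apply: (AP (x', y')); split; [apply: A1P|apply: A2P]; rewrite /ball_/= distrC.
Qed.

(** Both second differences are compared with the second derivatives at the fixed point (x0, y0),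
    whose sum is zero. The resulting bound is uniform near that point, as the later compactness
    arguments require. *)
Lemma harmonic_lap4 f x0 y0 e : harmonic_on (@upper_half_plane R) f ->
  0 < y0 -> 0 < e -> exists2 d : R, 0 < d & forall x y r,
    `|x - x0| < d -> `|y - y0| < d -> 0 < r < d ->
    `|lap4 (fun x y => f (x, y)) x y r| <= e * r ^+ 2.
Proof.
move=> [_ hf] y00 e0.
have [_ _ _ [cxx _ _ cyy] lap0] := hf (x0, y0) y00.
have hx x y : 0 < y -> derivable f (x, y) (@e1 R) by move=> yy; case: (hf (x, y) yy) => -[].
have hy x y : 0 < y -> derivable f (x, y) (@e2 R) by move=> yy; case: (hf (x, y) yy) => -[].
have hxx x y : 0 < y -> derivable (dx f) (x, y) (@e1 R).
  by move=> yy; case: (hf (x, y) yy) => _ [].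
have hyy x y : 0 < y -> derivable (dy f) (x, y) (@e2 R).
  by move=> yy; case: (hf (x, y) yy) => _ [].
have e80 : 0 < e / 8 by lra.
have [d1 d10 d1P] := continuous_box cxx e80.
have [d2 d20 d2P] := continuous_box cyy e80.
pose d := Num.min (Num.min d1 d2) y0 / 2.
have d0 : 0 < d by rewrite divr_gt0// !lt_min d10 d20.
have dd1 : 2 * d <= d1 by rewrite /d mulrC divfK// !ge_min lexx.
have dd2 : 2 * d <= d2 by rewrite /d mulrC divfK// !ge_min lexx orbT.
have ddy : 2 * d <= y0 by rewrite /d mulrC divfK// !ge_min lexx !orbT.
exists d => // x y r xd yd /andP[r0 rd].
have yy0 : 0 < y by move: yd; rewrite ltr_norml => /andP[]; lra.
move: (yd); rewrite ltr_norml => /andP[yd1 yd2].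
have yp t : `|t - y| < d -> 0 < t.
  by rewrite ltr_norml => /andP[]; lra.
have tr (t z z0 : R) : `|t - z| < d -> `|z - z0| < d -> `|t - z0| < 2 * d.
  by move=> h1 h2; rewrite (le_lt_trans (ler_distD z _ _))//; lra.
have dX : `|f (x + r, y) + f (x - r, y) - 2 * f (x, y) - dx (dx f) (x0, y0) * r ^+ 2|
    <= 2 * (e / 8) * r ^+ 2.
  apply: (@second_difference (fun t => f (t, y)) (fun t => dx f (t, y))
    (fun t => dx (dx f) (t, y)) x d); last by rewrite r0.
  - by move=> t _; apply: (@is_derive_dx f); exact: hx.
  - by move=> t _; apply: (@is_derive_dx (dx f)); exact: hxx.
  - by move=> t td; apply: d1P; [have := tr _ _ _ td xd|]; lra.
have dY : `|f (x, y + r) + f (x, y - r) - 2 * f (x, y) - dy (dy f) (x0, y0) * r ^+ 2|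
    <= 2 * (e / 8) * r ^+ 2.
  apply: (@second_difference (fun t => f (x, t)) (fun t => dy f (x, t))
    (fun t => dy (dy f) (x, t)) y d); last by rewrite r0.
  - by move=> t /yp t0; apply: (@is_derive_dy f); exact: hy.
  - by move=> t /yp t0; apply: (@is_derive_dy (dy f)); exact: hyy.
  - by move=> t td; apply: d2P; [|have := tr _ _ _ td yd]; lra.
have -> : lap4 (fun x y => f (x, y)) x y r =
   (f (x + r, y) + f (x - r, y) - 2 * f (x, y) - dx (dx f) (x0, y0) * r ^+ 2) +
   (f (x, y + r) + f (x, y - r) - 2 * f (x, y) - dy (dy f) (x0, y0) * r ^+ 2) +
   (dx (dx f) (x0, y0) + dy (dy f) (x0, y0)) * r ^+ 2 by rewrite /lap4; ring.
rewrite lap0 mul0r addr0 (le_trans (ler_normD _ _))//.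
apply: (le_trans (lerD dX dY)); rewrite -mulrDl ler_wpM2r ?sqr_ge0//.
by clear -e0; lra.
Qed.

Lemma derive_le_lipschitz g x (l K d : R) : is_derive x 1 g l -> 0 < d ->
  (forall t, `|t| <= d -> `|g (x + t) - g x| <= K * `|t|) -> `|l| <= K.
Proof.
move=> [dg lE] d0 gK; rewrite leNgt; apply/negP => Kl.
have c : h^-1 *: ((g \o shift x) (h *: 1) - g x) @[h --> 0^'] --> l.
  by rewrite -lE; exact: dg.
have e0 : 0 < `|l| - K by rewrite subr_gt0.
move: c => /cvgrPdist_lt /(_ _ e0) [d' /= d'0 H].
pose h := Num.min d d' / 2.
have h0 : 0 < h by rewrite divr_gt0// lt_min d0.
have hd : 2 * h <= d by rewrite /h mulrC divfK// ge_min lexx.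
have hd' : 2 * h <= d' by rewrite /h mulrC divfK// ge_min lexx orbT.
have := H h; rewrite /ball_/= sub0r normrN gtr0_norm// => {}H.
have {H} : `|l - h^-1 *: (g (h *: 1 + x) - g x)| < `|l| - K.
  by apply: H; [lra|rewrite gt_eqF].
apply/negP; rewrite -leNgt.
have := gK h; rewrite gtr0_norm// => {}gK.
have {}gK : `|g (x + h) - g x| <= K * h by apply: gK; lra.
set q := h^-1 *: _.
have qK : `|q| <= K.
  rewrite /q /GRing.scale/= mulr1 (addrC h) normrM gtr0_norm ?invr_gt0//.
  by rewrite mulrC ler_pdivrMr.
by have := ler_normD (l - q) q; rewrite subrK; lra.
Qed.

End SecondDifference.

(** * Boundedness on half-planes from control of horizontal averages *)

Section InteriorBound.
Context {R : realType}.
Local Notation mu := (@lebesgue_measure R).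
Implicit Types (x y r e d h s : R) (g : R -> R).

Lemma continuous_integrable g (a b : R) : continuous g ->
  mu.-integrable `[a, b] (EFin \o g).
Proof.
move=> cg; apply: continuous_compact_integrable; first exact: segment_compact.
exact: continuous_subspaceT.
Qed.

Lemma FTC2_is_derive (g G : R -> R) (a b : R) : a < b -> continuous g ->
  (forall t, a <= t <= b -> is_derive t 1 G (g t)) ->
  \int[mu]_(t in `[a, b]) g t = G b - G a.
Proof.
move=> ab cg dG; rewrite /Rintegral (@continuous_FTC2 _ g G)//.
- exact: continuous_subspaceT.
- have cG t : a <= t <= b -> {for t, continuous G}.
    move=> tab; apply: differentiable_continuous.
    by apply/derivable1_diffP; have [] := dG t tab.
  split.
  + by move=> t; rewrite in_itv/= => /andP[t1 t2]; have [] := dG t; rewrite ?(ltW t1) ?(ltW t2).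
  + by apply: cvg_at_right_filter; apply: cG; rewrite lexx ltW.
  + by apply: cvg_at_left_filter; apply: cG; rewrite lexx ltW.
- move=> t; rewrite in_itv/= => /andP[t1 t2]; rewrite derive1E.
  by have [] := dG t; rewrite ?(ltW t1) ?(ltW t2).
Qed.

Lemma is_derive_integral g (c t : R) : continuous g -> c < t ->
  is_derive t 1 (fun t => \int[mu]_(u in `[c, t]) g u) (g t).
Proof.
move=> cg ct.
have tt : t < t + 1 by rewrite ltrDl.
have ig := continuous_integrable c (t + 1) cg.
have [d1 d2] := @continuous_FTC1_closed R g c t (t + 1) tt ig ct (cg t).
by split; [exact: d1|rewrite -derive1E; exact: d2].
Qed.

(** Translation through the fundamental theorem of calculus. The base point [c] lies strictly to the
    left of [x] because the primitive is differentiated at [x] itself. *)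
Lemma Rintegral_shift g (c x h : R) : continuous g -> c < x -> 0 < h ->
  \int[mu]_(a in `[0, h]) g (x + a) =
  \int[mu]_(u in `[c, x + h]) g u - \int[mu]_(u in `[c, x]) g u.
Proof.
move=> cg cx h0.
transitivity ((fun a => \int[mu]_(u in `[c, x + a]) g u) h -
  (fun a => \int[mu]_(u in `[c, x + a]) g u) 0); last by rewrite /= addr0.
apply: (@FTC2_is_derive _ (fun a => \int[mu]_(u in `[c, x + a]) g u)) => //.
- move=> a; apply: (@continuous_comp _ _ _ (fun a => x + a) g); last exact: cg.
  by apply: cvgD; [exact: cvg_cst|exact: cvg_id].
- move=> t /andP[t0 th].
  have := @is_derive_shift _ (fun t => \int[mu]_(u in `[c, t]) g u) x t (g (x + t)).
  by apply; apply: is_derive_integral => //; lra.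
Qed.

Lemma Rintegral_shift_itv g (x h : R) : continuous g -> 0 < h ->
  \int[mu]_(a in `[0, h]) g (x + a) = \int[mu]_(u in `[x, x + h]) g u.
Proof.
move=> cg h0; have x1 : x - 1 < x by rewrite ltrBlDr ltrDl.
rewrite (@Rintegral_shift _ (x - 1))//.
apply/esym; apply: (@FTC2_is_derive _ (fun t => \int[mu]_(u in `[x - 1, t]) g u) x) => //.
  by rewrite ltrDl.
by move=> t /andP[t0 th]; apply: is_derive_integral => //; lra.
Qed.

Variables (f : R * R -> R) (M : R).
Hypothesis hf : harmonic_on (@upper_half_plane R) f.
(** To be obtained from the modular bound through |f| <= 1 + |f|^p; it is the only growth
    information used to bound [f]. *)
Hypothesis fM : forall a b y : R, a < b -> 0 < y ->
  \int[mu]_(t in `[a, b]) `|f (t, y)| <= b - a + M.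

Lemma harmonic_continuous x y : 0 < y -> {for (x, y), continuous f}.
Proof. by move=> y0; case: hf => _ /(_ (x, y) y0) [_ _ []]. Qed.

Lemma harmonic_slice y : 0 < y -> continuous (fun t => f (t, y)).
Proof.
move=> y0 x; apply: (@continuous_comp _ _ _ (fun t => (t, y)) f).
  exact: cvg_pair_cst.
exact: harmonic_continuous.
Qed.

Let M0 : 0 <= M + 1.
Proof.
have := @fM 0 1 1 ltr01 ltr01; rewrite subr0 addrC; apply: le_trans.
by apply: Rintegral_ge0 => t _.
Qed.

(** The integral over [x, x+h] at height y. It is bounded by [fM], and its x-derivative is the
    increment f(x+h, y) - f(x, y): this turns control of averages into control of values. *)
Let J h x y := \int[mu]_(a in `[0, h]) f (x + a, y).

Let slice_shift x y : 0 < y -> continuous (fun a => f (x + a, y)).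
Proof.
move=> y0 a; apply: (@continuous_comp _ _ _ (fun a => x + a) (fun t => f (t, y))).
  by apply: cvgD; [exact: cvg_cst|exact: cvg_id].
exact: harmonic_slice.
Qed.

Let iJ h x y : 0 < y -> mu.-integrable `[0, h] (EFin \o (fun a => f (x + a, y))).
Proof. by move=> y0; apply: continuous_integrable; exact: slice_shift. Qed.

Let J_bounded h x y : 0 < h <= 1 -> 0 < y -> `|J h x y| <= M + 1.
Proof.
move=> /andP[h0 h1] y0; rewrite /J (@Rintegral_shift_itv (fun t => f (t, y)))//; last first.
  exact: harmonic_slice.
have i1 := continuous_integrable x (x + h) (harmonic_slice y0).
apply: le_trans (le_normr_Rintegral _ i1) _ => //.
apply: le_trans (fM _ y0) _; first lra.
by lra.
Qed.

Let J_close h (x y x' y' e : R) : 0 < h <= 1 -> 0 < y -> 0 < y' -> 0 <= e ->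
  (forall a, 0 <= a <= h -> `|f (x' + a, y') - f (x + a, y)| <= e) ->
  `|J h x' y' - J h x y| <= e.
Proof.
move=> /andP[h0 h1] y0 y'0 e0 He.
have i1 := iJ h x y0; have i2 := iJ h x' y'0.
rewrite /J -RintegralB//.
have i3 : mu.-integrable `[0, h]
    (EFin \o (fun a => f (x' + a, y') - f (x + a, y))) by exact: integrable_subr.
apply: le_trans (le_normr_Rintegral _ i3) _ => //.
apply: (@le_trans _ _ (\int[mu]_(a in `[0, h]) e)).
  apply: le_Rintegral; [by []| | |].
  - exact: integrable_normr.
  - by apply: continuous_integrable => ?; exact: cvg_cst.
  - by move=> a; rewrite /= in_itv/= => ah; exact: He.
rewrite Rintegral_cst//= lebesgue_measure_itv/= lte_fin h0/= subr0.
by rewrite ler_piMr.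
Qed.

Let J_continuous h x y : 0 < h <= 1 -> 0 < y ->
  {for (x, y), continuous (fun z : R * R => J h z.1 z.2)}.
Proof.
move=> h01 y0; apply/cvgrPdist_le => e e0 /=.
have [d d0 dP] : exists2 d : R, 0 < d & forall a r, 0 <= a <= h -> 0 < r < d ->
    forall x' y', `|x' - x| <= r -> `|y' - y| <= r ->
    `|f (x' + a, y') - f (x + a, y)| <= e.
  apply: near_covering_segment => a _.
  have e20 : 0 < e / 2 by lra.
  have [d d0 dP] := continuous_box (@harmonic_continuous (x + a) y y0) e20.
  exists (d / 2); first by lra.
  move=> a' r a'd /andP[r0 rd] x' y' xr yr.
  have xd : `|x' + a' - (x + a)| < d.
    rewrite (_ : x' + a' - (x + a) = (x' - x) + (a' - a)); last by ring.
    by rewrite (le_lt_trans (ler_normD _ _))//; lra.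
  have yd : `|y' - y| < d by lra.
  have xd' : `|x + a' - (x + a)| < d.
    by rewrite (_ : x + a' - (x + a) = a' - a); [lra|ring].
  have h1 := dP _ _ xd yd.
  have h2 := dP (x + a') y xd'; rewrite subrr normr0 in h2; have {}h2 := h2 d0.
  rewrite (le_trans (ler_distD (f (x + a, y)) _ _))// (distrC (f (x + a, y))).
  lra.
pose d1 := Num.min d y / 2.
have d10 : 0 < d1 by rewrite divr_gt0// lt_min d0.
have d1d : d1 < d.
  have : 2 * d1 <= d by rewrite /d1 mulrC divfK// ge_min lexx.
  lra.
have d1y : d1 < y.
  have : 2 * d1 <= y by rewrite /d1 mulrC divfK// ge_min lexx orbT.
  lra.
exists (ball x d1, ball y d1); first by split; exact: nbhsx_ballx.
move=> [x' y'] /= [xd yd]; rewrite distrC.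
move: xd yd; rewrite /ball/= (distrC x x') (distrC y y') => xd yd.
apply: J_close => //; [|exact: ltW|].
  by move: yd; rewrite ltr_norml => /andP[]; lra.
by move=> a ah; apply: (dP a d1) => //; [rewrite d10|exact: ltW..].
Qed.

(** Integration over [a] commutes with [lap4], and the threshold on r is made uniform along [0, h]
    by [near_covering_segment]. *)
Let J_lap4 h x y e : 0 < h <= 1 -> 0 < y -> 0 < e -> exists2 d : R, 0 < d &
  forall r, 0 < r < d -> `|lap4 (J h) x y r| <= e * r ^+ 2.
Proof.
move=> /andP[h0 h1] y0 e0.
have [d d0 dP] : exists2 d : R, 0 < d & forall a r, 0 <= a <= h -> 0 < r < d ->
    `|lap4 (fun x y => f (x, y)) (x + a) y r| <= e * r ^+ 2.
  apply: near_covering_segment => a _.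
  have [d d0 dP] := harmonic_lap4 (x + a) hf y0 e0.
  exists d => // a' r a'd rd; apply: dP => //; last by rewrite subrr normr0.
  by rewrite (_ : x + a' - (x + a) = a' - a)//; ring.
exists (Num.min d y); first by rewrite lt_min d0.
move=> r /andP[r0]; rewrite lt_min => /andP[rd ry].
have yr : 0 < y + r by lra.
have yr' : 0 < y - r by lra.
have i0 := iJ h x y0.
have i1 := iJ h (x + r) y0; have i2 := iJ h (x - r) y0.
have i3 := iJ h x yr; have i4 := iJ h x yr'.
have i04 : mu.-integrable `[0, h] (EFin \o (fun a => 4 * f (x + a, y))).
  exact: integrable_mulrl.
have i12 : mu.-integrable `[0, h] (EFin \o (fun a => f (x + r + a, y) + f (x - r + a, y))).
  exact: integrable_addr.
have i123 : mu.-integrable `[0, h]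
    (EFin \o (fun a => f (x + r + a, y) + f (x - r + a, y) + f (x + a, y + r))).
  exact: integrable_addr.
have i1234 : mu.-integrable `[0, h] (EFin \o (fun a =>
    f (x + r + a, y) + f (x - r + a, y) + f (x + a, y + r) + f (x + a, y - r))).
  exact: integrable_addr.
have iL : mu.-integrable `[0, h] (EFin \o (fun a => f (x + r + a, y) + f (x - r + a, y) +
    f (x + a, y + r) + f (x + a, y - r) - 4 * f (x + a, y))).
  exact: integrable_subr.
have EL a : lap4 (fun x y => f (x, y)) (x + a) y r =
    f (x + r + a, y) + f (x - r + a, y) + f (x + a, y + r) + f (x + a, y - r) - 4 * f (x + a, y).
  by rewrite /lap4 (addrAC x r) (addrAC x (- r)).
have E : lap4 (J h) x y r = \int[mu]_(a in `[0, h]) lap4 (fun x y => f (x, y)) (x + a) y r.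
  rewrite /lap4 /J -RintegralZl// -!RintegralD// -RintegralB//.
  by apply: eq_Rintegral => a _ /=; rewrite (addrAC x r) (addrAC x (- r)).
have iL' : mu.-integrable `[0, h] (EFin \o (fun a => lap4 (fun x y => f (x, y)) (x + a) y r)).
  by apply: eq_integrable iL => // a _ /=; rewrite EL.
rewrite E; apply: le_trans (le_normr_Rintegral _ iL') _ => //.
apply: (@le_trans _ _ (\int[mu]_(a in `[0, h]) (e * r ^+ 2))).
  apply: le_Rintegral; [by []| | |].
  - exact: integrable_normr.
  - by apply: continuous_integrable => ?; exact: cvg_cst.
  - by move=> a; rewrite /= in_itv/= => ah; apply: dP => //; rewrite r0.
rewrite Rintegral_cst//= lebesgue_measure_itv/= lte_fin h0/= subr0.
by rewrite ler_piMr// mulr_ge0 ?sqr_ge0// ltW.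
Qed.

Let J_derive h x y : 0 < h -> 0 < y ->
  is_derive x 1 (fun x => J h x y) (f (x + h, y) - f (x, y)).
Proof.
move=> h0 y0.
pose F t := \int[mu]_(u in `[x - 1, t]) f (u, y).
have cf := harmonic_slice y0.
have x1 : x - 1 < x by rewrite ltrBlDr ltrDl.
have dF t : x - 1 < t -> is_derive t 1 F (f (t, y)).
  by move=> t1; apply: (@is_derive_integral (fun t => f (t, y))).
have d1 : is_derive x 1 (fun t => F (t + h)) (f (x + h, y)).
  have : is_derive (h + x) 1 F (f (h + x, y)) by apply: dF; lra.
  move=> /is_derive_shift; rewrite addrC.
  by under eq_fun do rewrite addrC.
have := is_deriveB d1 (dF x x1).
apply: near_eq_is_derive => //.
exists 1 => //= t; rewrite /ball_/= ltr_norml => /andP[t1 t2].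
by rewrite /J (@Rintegral_shift (fun t => f (t, y)) (x - 1))//; lra.
Qed.

(** Above height [s], [J] is bounded by M + 1 and hence is the Poisson integral of its trace. By
    [pint_lipschitz] it is then Lipschitz in x with constant 4/s (M + 1) as soon as y >= s, and this
    constant bounds its x-derivative, the increment of [f]. *)
Let increment_bound s x y h : 0 < s -> s <= y -> 0 < h <= 1 ->
  `|f (x + h, s + y) - f (x, s + y)| <= 4 / s * (M + 1).
Proof.
move=> s0 sy h01; have /andP[h0 h1] := h01.
have y0 : 0 < y by lra.
have rep x' y' : 0 < y' -> J h x' (s + y') = pint (fun t => J h t s) x' y'.
  move=> y'0; apply: (@bounded_representation _ (J h) s (M + 1)) => //.
  - by move=> *; apply: J_continuous => //; lra.
  - by move=> *; apply: J_bounded => //; lra.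
  - by move=> *; apply: J_lap4 => //; lra.
have mJ : measurable_fun setT (fun t => J h t s).
  apply: continuous_measurable_fun => t.
  apply: (@continuous_comp _ _ _ (fun t => (t, s)) (fun z : R * R => J h z.1 z.2)).
    exact: cvg_pair_cst.
  exact: J_continuous.
have Jl t : `|t| <= s / 2 -> `|J h (x + t) (s + y) - J h x (s + y)| <= 4 / s * (M + 1) * `|t|.
  move=> ts; rewrite !rep//.
  have hx : `|x + t - x| <= y / 2 by rewrite addrAC subrr add0r; lra.
  have hy : `|y - y| <= y / 2 by rewrite subrr normr0; lra.
  have := pint_lipschitz y0 mJ (fun t => J_bounded t h01 s0) hx hy.
  rewrite subrr normr0 addr0 addrAC subrr add0r => /le_trans; apply.
  rewrite mulrAC ler_wpM2r// ler_wpM2r//.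
  by rewrite ler_pM2l// lef_pV2 ?posrE.
have sy0 : 0 < s + y by lra.
have s20 : 0 < s / 2 by lra.
exact: derive_le_lipschitz (J_derive x h0 sy0) s20 Jl.
Qed.

(** The mean of |f| over [x, x+1] is at most 1 + M, so |f| <= 2 + M at some point of that segment,
    and [increment_bound] leads back to x. The height is divided as s/2 for the trace and y - s/2 >=
    s/2 above it. *)
Lemma harmonic_bounded s : 0 < s -> exists B, forall x y, s <= y -> `|f (x, y)| <= B.
Proof.
move=> s0; exists (2 + M + 4 / (s / 2) * (M + 1)) => x y sy.
have y0 : 0 < y by lra.
have [a a01 fa] : exists2 a, 0 <= a <= 1 & `|f (x + a, y)| <= 2 + M.
  apply: contrapT => H.
  have H1 t : x <= t <= x + 1 -> 2 + M <= `|f (t, y)|.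
    move=> /andP[t0 t1]; rewrite leNgt; apply/negP => ft; apply: H.
    exists (t - x); last by rewrite addrC subrK ltW.
    by apply/andP; split; lra.
  have x1 : x < x + 1 by rewrite ltrDl.
  have := fM x1 y0; apply/negP; rewrite -ltNge.
  have i1 := continuous_integrable x (x + 1) (harmonic_slice y0).
  apply: (@lt_le_trans _ _ (\int[mu]_(t in `[x, x + 1]) (2 + M))).
    by rewrite Rintegral_cst//= lebesgue_measure_itv/= lte_fin x1/= (_ : x + 1 - x = 1); [lra|ring].
  apply: le_Rintegral; [by []| | |].
  - by apply: continuous_integrable => ?; exact: cvg_cst.
  - exact: integrable_normr.
  - by move=> t; rewrite /= in_itv/=; exact: H1.
have s20 : 0 < s / 2 by lra.
have c0 : 0 <= 4 / (s / 2) * (M + 1) by rewrite mulr_ge0// divr_ge0// ltW.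
have /andP[a0 a1] := a01.
have [aE|an0] := eqVneq a 0; first by move: fa; rewrite aE addr0; lra.
have := @increment_bound (s / 2) x (y - s / 2) a s20.
rewrite (addrC (s / 2)) subrK => /(_ _)/(_ _).
have -> : s / 2 <= y - s / 2 by lra.
rewrite lt_neqAle eq_sym an0 a0 a1 => /(_ isT isT) h1.
rewrite -(subKr (f (x + a, y)) (f (x, y))) (le_trans (ler_normB _ _))//.
by rewrite lerD.
Qed.

Lemma harmonic_representation s x y : 0 < s -> 0 < y ->
  f (x, s + y) = pint (fun t => f (t, s)) x y.
Proof.
move=> s0 y0; have [B fB] := harmonic_bounded s0.
apply: (@bounded_representation _ (fun x y => f (x, y)) s B) => //.
- move=> x' y' sy; rewrite (_ : (fun z : R * R => f (z.1, z.2)) = f).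
    by apply: harmonic_continuous; lra.
  by apply/funext => -[].
- move=> x' y' e sy e0; have y'0 : 0 < y' by lra.
  have [d d0 dP] := harmonic_lap4 x' hf y'0 e0.
  by exists d => // r rd; apply: dP; rewrite ?subrr ?normr0.
Qed.

End InteriorBound.

(** * Weak limits of equi-integrable families *)

Section UltrafilterLimit.
Context {R : realType} (F : set_system R).
Hypothesis UF : UltraFilter F.

(** Along an ultrafilter every bounded quantity converges, so the limits over all measurable sets
    exist simultaneously and no subsequence has to be extracted. *)
Lemma ultra_cvg_bounded (h : R -> R) (N : R) :
  (\forall s \near F, `|h s| <= N) -> exists l : R, h @ F --> l.
Proof.
move=> hN; have PF : ProperFilter F by exact: ultra_proper.
have [l [_ cl]] : `[- N, N]%classic `&` cluster (h @ F) !=set0.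
  apply: segment_compact; apply: filterS hN => s.
  by rewrite ler_norml /= in_itv.
exists l => V lV; have [//|FV] := in_ultra_setVsetC (h @^-1` V) UF.
by have [z [/=]] := cl (~` V) V FV lV.
Qed.

Lemma cvg_norm_le (h : R -> R) (l c : R) : h @ F --> l ->
  (\forall s \near F, `|h s| <= c) -> `|l| <= c.
Proof.
move=> hl hc; have PF : ProperFilter F by exact: ultra_proper.
by apply: ler_cvg_to (cvg_norm hl) (cvg_cst _) hc.
Qed.

End UltrafilterLimit.

Section ChargeOf.
Context d (T : measurableType d) (R : realType) (nu : set T -> \bar R).
Hypothesis nu0 : nu set0 = 0%E.
Hypothesis nufin : forall A, measurable A -> nu A \is a fin_num.
Hypothesis nusigma : semi_sigma_additive nu.

(** The [let]s make the three proofs parameters of [charge_of] once the section is closed, so that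
    its charge structure can be inferred from the term itself. *)
Definition charge_of : set T -> \bar R := let _ := nu0 in let _ := nufin in
  let _ := nusigma in nu.

HB.instance Definition _ := isCharge.Build _ T R charge_of nu0 nufin nusigma.

Lemma charge_density (mu : {sigma_finite_measure set T -> \bar R}) :
  (forall A, measurable A -> mu A = 0%E -> nu A = 0%E) ->
  exists2 v : T -> R, mu.-integrable setT (EFin \o v) &
    forall A, measurable A -> nu A = (\int[mu]_(t in A) (v t)%:E)%E.
Proof.
move=> numu; have dom : charge_of `<< mu by apply/null_content_dominatesP.
have E t : (fine (Radon_Nikodym charge_of mu t))%:E = Radon_Nikodym charge_of mu t.
  by rewrite fineK// Radon_Nikodym_fin_num.
exists (fine \o (Radon_Nikodym charge_of mu)).
  apply: eq_integrable (Radon_Nikodym_integrable dom) => //.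
  by move=> t _ /=; rewrite E.
move=> A mA; rewrite -[LHS]/(charge_of A) (Radon_Nikodym_integral dom mA).
by apply: eq_integral => t _ /=; rewrite E.
Qed.

End ChargeOf.

Section WeakLimit.
Context d (T : measurableType d) (R : realType).
Variable mu : {sigma_finite_measure set T -> \bar R}.
Variables (g : R -> T -> R) (w : T -> R).
Hypothesis iw : mu.-integrable setT (EFin \o w).
Hypothesis w0 : forall t, 0 <= w t.
Hypothesis ig : forall s : R, 0 < s -> mu.-integrable setT (EFin \o g s).
(** Absolute continuity, uniform in [s], with respect to the finite measure of density [w]. As [mu]
    may be infinite, comparing with [w] also prevents mass from escaping to infinity. *)
Hypothesis equi : forall e : R, 0 < e -> exists2 K : R, 0 <= K & forall (s : R) A,
  0 < s -> measurable A ->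
  \int[mu]_(t in A) `|g s t| <= K * \int[mu]_(t in A) w t + e.
Variable F : set_system R.
Hypothesis UF : UltraFilter F.
Hypothesis F0 : \forall s \near F, 0 < s.

Let PF : ProperFilter F. Proof. exact: ultra_proper. Qed.

Let iA (A : set T) (h : T -> R) : measurable A -> mu.-integrable setT (EFin \o h) ->
  mu.-integrable A (EFin \o h).
Proof. by move=> mA; exact: integrableS. Qed.

(** A uniform L^1 bound for the family. It exists by [equi] with e = 1 on the whole space, so the
    default 0 is never reached for want of a candidate. *)
Let N := xget 0 [set N : R | 0 <= N /\ forall s : R, 0 < s -> \int[mu]_t `|g s t| <= N].

Let NP : 0 <= N /\ forall s : R, 0 < s -> \int[mu]_t `|g s t| <= N.
Proof.
rewrite /N; case: xgetP => [//|/(_ _)/(_ _) H]; exfalso.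
have [K K0 KP] := equi ltr01.
apply: (H (K * \int[mu]_t w t + 1)); split.
  by rewrite addr_ge0// mulr_ge0// Rintegral_ge0.
by move=> s s0; exact: KP.
Qed.

Let norm_int (h : T -> R) (s c : R) A : 0 < s -> measurable A -> measurable_fun setT h ->
  0 <= c -> (forall t, `|h t| <= c) ->
  mu.-integrable setT (EFin \o (fun t => h t * g s t)) /\
  `|\int[mu]_(t in A) (h t * g s t)| <= c * N.
Proof.
move=> s0 mA mh c0 hc.
have ic := integrable_mulrl measurableT c (integrable_normr measurableT (ig s0)).
have ih : mu.-integrable setT (EFin \o (fun t => h t * g s t)).
  apply: le_integrable ic => //.
    apply/measurable_EFinP; apply: measurable_funM => //.
    by apply/measurable_EFinP; exact: measurable_int (ig s0).
  by move=> t _ /=; rewrite lee_fin !normrM normr_id (ger0_norm c0) ler_wpM2r.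
split => //.
have ihA := iA mA ih.
apply: le_trans (le_normr_Rintegral mA ihA) _.
apply: (@le_trans _ _ (\int[mu]_(t in A) (c * `|g s t|))).
  apply: le_Rintegral => //.
  - exact: integrable_normr.
  - exact: iA.
  - by move=> t _; rewrite normrM ler_wpM2r.
rewrite RintegralZl//; last by apply: iA => //; apply: integrable_normr => //; exact: ig.
rewrite ler_wpM2l// (le_trans _ (NP.2 s s0))//.
rewrite /Rintegral fine_le//.
- by apply: integrable_fin_num => //; apply: iA => //; apply: integrable_normr => //; exact: ig.
- by apply: integrable_fin_num => //; apply: integrable_normr => //; exact: ig.
- apply: ge0_subset_integral => //.
  by apply: measurable_int; apply: integrable_normr => //; exact: ig.
Qed.

Let nu0 (A : set T) : R := lim ((\int[mu]_(t in A) g s t) @[s --> F]).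

Let nu0P A : measurable A -> (\int[mu]_(t in A) g s t) @[s --> F] --> nu0 A.
Proof.
move=> mA.
have [|l hl] := @ultra_cvg_bounded _ F UF (fun s => \int[mu]_(t in A) g s t) N.
  apply: filterS F0 => s s0.
  have [|_] := @norm_int (cst 1) s 1 A s0 mA (measurable_cst _) ler01.
    by move=> t; rewrite normr1.
  by rewrite mul1r; under eq_Rintegral do rewrite mul1r.
exact: (cvgP l hl).
Qed.

Let nu0_le (e : R) A (K : R) : measurable A ->
  (forall s : R, 0 < s -> \int[mu]_(t in A) `|g s t| <= K * \int[mu]_(t in A) w t + e) ->
  `|nu0 A| <= K * \int[mu]_(t in A) w t + e.
Proof.
move=> mA KP; apply: (cvg_norm_le UF (nu0P mA)); apply: filterS F0 => s s0.
apply: le_trans (KP s s0); apply: le_normr_Rintegral => //.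
by apply: iA => //; exact: ig.
Qed.

Let D (G : nat -> set T) n := \bigcup_(i in [set i | (n <= i)%N]) G i.

Let split_tail (G : nat -> set T) (h : T -> R) n : (forall i, measurable (G i)) ->
  trivIset setT G -> mu.-integrable setT (EFin \o h) ->
  \int[mu]_(t in \bigcup_i G i) h t =
  \sum_(0 <= i < n) \int[mu]_(t in G i) h t + \int[mu]_(t in D G n) h t.
Proof.
move=> mG tG ih.
have mD k : measurable (D G k) by apply: bigcup_measurable => i _; exact: mG.
have DS k : D G k = G k `|` D G k.+1.
  apply/seteqP; split => t.
    move=> [i /= ki Git]; have [kE|ki'] := eqVneq k i; first by left; rewrite kE.
    by right; exists i => //=; rewrite ltn_neqAle ki'.
  by move=> [Gt|[i /= ki Git]]; [exists k => /=|exists i => //=; exact: ltnW].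
elim: n => [|n ->].
  by rewrite big_geq// add0r; congr (Rintegral _ _ _); apply/seteqP; split => t [i _ Gt]; exists i.
rewrite big_nat_recr//= -addrA; congr (_ + _).
rewrite DS Rintegral_setU//; first by apply: iA => //; rewrite -DS.
apply/disj_setPS => t [Gt [i /= ni Git]].
by have := tG n i I I (ex_intro _ t (conj Gt Git)) => nE; rewrite nE ltnn in ni.
Qed.

Let nu A := (nu0 A)%:E.

Let nu_set0 : nu set0 = 0%E.
Proof.
rewrite /nu; congr EFin; apply: cvg_lim => //.
by under eq_cvg do rewrite Rintegral_set0; exact: cvg_cst.
Qed.

(** Finite additivity survives the limit along [F], which leaves the value on the tail unions
    [D G n]. Their [w]-mass tends to 0 because [w] is integrable, and [equi] passes this on to
    [nu0]. *)
Let nu_sigma : semi_sigma_additive nu.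
Proof.
move=> G mG tG mUG.
have mD k : measurable (D G k) by apply: bigcup_measurable => i _; exact: mG.
have sumE n : nu0 (\bigcup_i G i) = \sum_(0 <= i < n) nu0 (G i) + nu0 (D G n).
  have c2 : (\sum_(0 <= i < n) \int[mu]_(t in G i) g s t + \int[mu]_(t in D G n) g s t)
      @[s --> F] --> \sum_(0 <= i < n) nu0 (G i) + nu0 (D G n).
    apply: cvgD; last exact: nu0P.
    elim: n => [|n IHn]; first by under eq_cvg do rewrite big_geq//; rewrite big_geq//; exact: cvg_cst.
    under eq_cvg do rewrite big_nat_recr//=.
    by rewrite big_nat_recr//=; apply: cvgD => //; exact: nu0P.
  apply: cvg_lim => //; apply: cvg_trans c2; apply: near_eq_cvg.
  by apply: filterS F0 => s s0; rewrite -(split_tail n)//; exact: ig.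
have -> : (fun n => (\sum_(0 <= i < n) nu (G i))%E) =
    EFin \o (fun n => nu0 (\bigcup_i G i) - nu0 (D G n)).
  by apply/funext => n /=; rewrite sumEFin (sumE n) addrK.
apply: cvg_EFin; first exact: nearW.
rewrite -[X in _ --> X]subr0 /=; apply: cvgB; first exact: cvg_cst.
apply/cvgr0Pnorm_le => e e0.
have e20 : 0 < e / 2 by rewrite divr_gt0.
have [K K0 KP] := equi e20.
have wD : \int[mu]_(t in D G n) w t @[n --> \oo] --> 0.
  have Dw n : \int[mu]_(t in D G n) w t = \int[mu]_(t in \bigcup_i G i) w t -
      \sum_(0 <= i < n) \int[mu]_(t in G i) w t.
    by rewrite (split_tail n mG tG iw) addrAC subrr add0r.
  rewrite (funext Dw) -[X in _ --> X](subrr (\int[mu]_(t in \bigcup_i G i) w t)).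
  apply: cvgB; first exact: cvg_cst.
  have := @charge_semi_sigma_additive _ _ _ (induced_charge iw) G mG tG mUG.
  rewrite /induced_charge/= => c.
  apply: (@cvg_trans _ (fine (\sum_(0 <= i < n) \int[mu]_(t in G i) (w t)%:E)%E @[n --> \oo])).
    apply: near_eq_cvg; apply: nearW => n; rewrite /Rintegral sum_fine// => i _.
    by apply: integrable_fin_num => //; exact: iA.
  apply: fine_cvg; rewrite /Rintegral fineK//.
  by apply: integrable_fin_num => //; exact: iA.
have K10 : 0 < K + 1 by rewrite ltr_pwDr.
have eK : 0 < e / 2 / (K + 1) by rewrite divr_gt0.
move/cvgr0Pnorm_le : wD => /(_ _ eK); apply: filterS => n wn.
have := @nu0_le (e / 2) (D G n) K (mD n) (fun s s0 => KP s _ s0 (mD n)).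
move=> /le_trans; apply.
have wn0 : 0 <= \int[mu]_(t in D G n) w t by exact: Rintegral_ge0.
rewrite ger0_norm// ler_pdivlMr// in wn.
lra.
Qed.

Let nu_dom A : measurable A -> mu A = 0%E -> nu A = 0%E.
Proof.
move=> mA muA; rewrite /nu; congr EFin; apply: cvg_lim => //.
apply: (@cvg_trans _ ((fun=> 0 : R) @ F)); last exact: cvg_cst.
apply: near_eq_cvg; apply: filterS F0 => s s0.
rewrite /Rintegral null_set_integral//.
by have := measurable_int _ (ig s0); exact: measurable_funTS.
Qed.

(** [v] is the density of the limit charge, so convergence holds on indicators. A bounded [phi] is
    approximated uniformly by combinations of indicators, within B / 2^n, and the resulting errors
    are at most B / 2^n times the masses [N] and [V]. *)
Lemma ultra_weak_limit : exists2 v : T -> R, mu.-integrable setT (EFin \o v) &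
  forall (phi : T -> R) (B l : R), measurable_fun setT phi -> (forall t, 0 <= phi t <= B) ->
  (\int[mu]_t (phi t * g s t)) @[s --> F] --> l -> \int[mu]_t (phi t * v t) = l.
Proof.
have [v iv vE] := charge_density nu_set0 (fun _ _ => isT) nu_sigma nu_dom.
exists v => // phi B l mphi phiB phil.
have mv : measurable_fun setT v by apply/measurable_EFinP; exact: measurable_int iv.
have B0 : 0 <= B by have /andP[] := phiB point; exact: le_trans.
have ipv (psi : T -> R) c : measurable_fun setT psi -> (forall t, `|psi t| <= c) ->
    mu.-integrable setT (EFin \o (fun t => psi t * v t)).
  move=> mpsi psic; apply: le_integrable (integrable_mulrl measurableT c (integrable_normr measurableT iv)) => //.
    by apply/measurable_EFinP; exact: measurable_funM.
  move=> t _ /=; rewrite lee_fin !normrM normr_id ler_wpM2r//.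
  by rewrite (le_trans (psic t))// ler_norm.
have approx n : exists psi : T -> R, [/\ measurable_fun setT psi,
    (forall t, 0 <= psi t), (forall t, 0 <= phi t - psi t <= B / 2 ^+ n) &
    (\int[mu]_t (psi t * g s t)) @[s --> F] --> \int[mu]_t (psi t * v t)].
  elim: n => [|n [psi [mpsi psi0 psile cpsi]]].
    exists (cst 0); split => //.
    - by move=> t; rewrite subr0 expr0 divr1.
    - under eq_cvg do under eq_Rintegral do rewrite mul0r.
      under eq_Rintegral do rewrite mul0r.
      rewrite Rintegral_cst// mul0r; exact: cvg_cst.
  set b := B / 2 ^+ n.+1.
  have bE : B / 2 ^+ n = 2 * b.
    by rewrite /b exprS; field; rewrite expf_neq0.
  have b0 : 0 <= b by rewrite divr_ge0// exprn_ge0.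
  have psiB t : `|psi t| <= B.
    rewrite ger0_norm//; have /andP[] := psile t; have /andP[] := phiB t; lra.
  (* The set where the next binary digit of phi / B is 1: adding [b] on it halves the uniform
     error. *)
  pose A := [set t | b <= phi t - psi t].
  have mA : measurable A.
    rewrite -[A]setTI; apply: (measurable_fun_le (f := cst b) (g := fun t => phi t - psi t)) => //.
    exact: measurable_funB.
  have m1 : measurable_fun setT (fun t => \1_A t : R) by exact: measurable_indic.
  exists (fun t => psi t + b * \1_A t); split.
  - by apply: measurable_funD => //; exact: measurable_funM.
  - by move=> t; rewrite addr_ge0// mulr_ge0.
  - move=> t; have := psile t; rewrite bE indicE.
    have [tA|/negP tA] := boolP (t \in A).
      by move: tA; rewrite inE /A /= mulr1 => ? /andP[? ?]; apply/andP; split; lra.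
    rewrite mulr0; move: tA; rewrite inE /A /= => /negP; rewrite -ltNge => ? /andP[? ?].
    by apply/andP; split; lra.
  have indB (t : T) : `|\1_A t : R| <= 1 by rewrite indicE; case: (_ \in _); rewrite ?normr1 ?normr0.
  have iAv : \int[mu]_t (\1_A t * v t) = nu0 A.
    have -> : nu0 A = \int[mu]_(t in A) v t by rewrite /Rintegral -vE.
    rewrite [RHS]Rintegral_mkcond; apply: eq_Rintegral => t _.
    by rewrite patchE indicE; case: (_ \in _); rewrite ?mul1r ?mul0r.
  have E1 : \int[mu]_t ((psi t + b * \1_A t) * v t) = \int[mu]_t (psi t * v t) + b * nu0 A.
    have i1 := ipv psi B mpsi psiB; have i2 := ipv _ 1 m1 indB.
    have i3 := integrable_mulrl measurableT b i2.
    under eq_Rintegral do rewrite mulrDl -mulrA.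
    by rewrite RintegralD// (RintegralZl _ measurableT i2) iAv.
  rewrite E1.
  apply: (@cvg_trans _ ((\int[mu]_t (psi t * g s t) + b * \int[mu]_(t in A) g s t) @[s --> F])).
    apply: near_eq_cvg; apply: filterS F0 => s s0.
    have [i1 _] := norm_int s0 measurableT mpsi B0 psiB.
    have [i2 _] := norm_int s0 measurableT m1 ler01 indB.
    have i3 := integrable_mulrl measurableT b i2.
    under [RHS]eq_Rintegral do rewrite mulrDl -mulrA.
    rewrite RintegralD// (RintegralZl _ measurableT i2); congr (_ + _ * _).
    rewrite Rintegral_mkcond; apply: eq_Rintegral => t _.
    by rewrite patchE indicE; case: (_ \in _); rewrite ?mul1r ?mul0r.
  apply: cvgD => //; apply: cvgM; [exact: cvg_cst|exact: nu0P].
apply/eqP; rewrite -subr_eq0 -normr_le0.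
set V := \int[mu]_t `|v t|.
have V0 : 0 <= V by exact: Rintegral_ge0.
have [N0 _] := NP.
have key n : `|\int[mu]_t (phi t * v t) - l| <= B * (N + V) / 2 ^+ n.
  have [psi [mpsi psi0 psile cpsi]] := approx n.
  set b := B / 2 ^+ n in psile.
  have b0 : 0 <= b by rewrite divr_ge0// exprn_ge0.
  have psiB t : `|psi t| <= B.
    rewrite ger0_norm//; have /andP[] := psile t; have /andP[] := phiB t; lra.
  have phiB' t : `|phi t| <= B by have /andP[? ?] := phiB t; rewrite ger0_norm.
  have dB t : `|phi t - psi t| <= b by have /andP[? ?] := psile t; rewrite ger0_norm.
  have md : measurable_fun setT (fun t => phi t - psi t) by exact: measurable_funB.
  have h1 : `|l - \int[mu]_t (psi t * v t)| <= b * N.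
    apply: (cvg_norm_le UF (cvgB phil cpsi)); apply: filterS F0 => s s0.
    have [i1 _] := norm_int s0 measurableT mpsi B0 psiB.
    have [i2 _] := norm_int s0 measurableT mphi B0 phiB'.
    rewrite -[leLHS]/(`|\int[mu]_t (phi t * g s t) - \int[mu]_t (psi t * g s t)|).
    rewrite -RintegralB//; under eq_Rintegral do rewrite -mulrBl.
    by have [] := norm_int s0 measurableT md b0 dB.
  have h2 : `|\int[mu]_t (phi t * v t) - \int[mu]_t (psi t * v t)| <= b * V.
    rewrite -RintegralB//; [|exact: ipv phiB'|exact: ipv psiB].
    under eq_Rintegral do rewrite -mulrBl.
    have i1 := ipv _ b md dB.
    apply: le_trans (le_normr_Rintegral measurableT i1) _.
    have iv' := integrable_normr measurableT iv.
    rewrite /V -(RintegralZl _ measurableT iv').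
    apply: le_Rintegral => //; first exact: integrable_normr.
      exact: integrable_mulrl.
    by move=> t _; rewrite normrM ler_wpM2r.
  have -> : B * (N + V) / 2 ^+ n = b * V + b * N by rewrite /b; ring.
  by rewrite (le_trans (ler_distD (\int[mu]_t (psi t * v t)) _ _))// lerD// distrC.
set c := B * (N + V) in key.
have c0 : 0 <= c by rewrite mulr_ge0// addr_ge0.
apply/ler_addgt0Pr => e e0; rewrite add0r.
have [n] : exists n, c / 2 ^+ n <= e.
  have [n _ nP] : \forall n \near \oo, c * (2^-1) ^+ n <= e.
    have : c * (2^-1 : R) ^+ n @[n --> \oo] --> 0.
      rewrite -(mulr0 c); apply: cvgM; first exact: cvg_cst.
      by apply: cvg_expr; rewrite ger0_norm ?invr_ge0// invf_lt1// ltr1n.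
    move=> /cvgr0Pnorm_le /(_ _ e0); apply: filterS => n.
    by apply: le_trans; exact: ler_norm.
  by exists n; have := nP n (leqnn n); rewrite exprVn.
exact: le_trans.
Qed.

End WeakLimit.

(** * The pointwise estimate and the modular bound *)

Section PowerInequalities.
Context {R : realType}.
Implicit Types (a b K q : R).

Lemma le_powR q a b : 0 <= q -> 0 <= a -> a <= b -> a `^ q <= b `^ q.
Proof.
by move=> q0 a0 ab; apply: ge0_ler_powR => //; rewrite nnegrE// (le_trans a0).
Qed.

Lemma powR_le_self q a : 1 <= q -> 0 <= a <= 1 -> a `^ q <= a.
Proof.
move=> q1 /andP[]; rewrite le_eqVlt => /predU1P[<- _|a0 a1].
  by rewrite powR0// gt_eqF// (lt_le_trans ltr01).
by apply: ge1r_powR => //; rewrite a0.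
Qed.

Lemma powRD_le q a b : 0 <= q -> 0 <= a -> 0 <= b ->
  (a + b) `^ q <= 2 `^ q * (a `^ q + b `^ q).
Proof.
move=> q0 a0 b0.
have m0 : 0 <= Num.max a b by rewrite le_max a0.
apply: (@le_trans _ _ ((2 * Num.max a b) `^ q)).
  apply: le_powR => //; first exact: addr_ge0.
  by rewrite mulrDl mul1r lerD// le_max lexx ?orbT.
rewrite powRM// ler_wpM2l ?powR_ge0//.
by have [_|_] := leP a b; rewrite ?lerDr ?lerDl powR_ge0.
Qed.

(* Young-type splitting at height [K], the substitute for Jensen's inequality
   when the exponent varies with the integration variable. *)
Lemma young_split q a K : 1 <= q -> 0 <= a -> 0 < K -> a <= K + K `^ (1 - q) * a `^ q.
Proof.
move=> q1 a0 K0; have [aK|Ka] := leP a K.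
  by rewrite (le_trans aK)// lerDl mulr_ge0// powR_ge0.
have aK1 : 1 <= a / K by rewrite ler_pdivlMr// mul1r ltW.
have h := le1r_powR aK1 q1.
have -> : K `^ (1 - q) * a `^ q = K * (a / K) `^ q.
  rewrite powRD; last by rewrite (gt_eqF K0) implybT.
  rewrite powRr1 ?(ltW K0)// -mulrA; congr (_ * _).
  rewrite powRM ?invr_ge0 ?(ltW K0)// powRN mulrC; congr (_ * _).
  by rewrite -[in RHS](powR_inv1 (ltW K0)) -powRrM mulN1r powRN.
have Kn0 : K != 0 by rewrite gt_eqF.
rewrite -[a in leLHS](divfK Kn0) [leLHS]mulrC.
by rewrite ler_wpDl ?(ltW K0)// ler_wpM2l// ltW.
Qed.

(* This is where the decay condition at infinity is used: changing the exponent
   to its limit only costs an integrable error. *)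
Lemma powR_exchange (x C a q q' : R) : 1 <= q -> 1 <= q' -> 0 <= a <= 1 ->
  `|q - q'| <= C / ln (expR 1 + `|x|) ->
  a `^ q <= expR (2 * C) * a `^ q' + (1 + x ^+ 2)^-1.
Proof.
move=> q1 q'1 /andP[a0 a1] qq.
pose E := expR 1 + `|x|.
have e1 : 2 <= expR 1 :> R by rewrite (le_trans _ (expR_ge1Dx _))//; lra.
have x0 := normr_ge0 x.
have E1 : 1 < E by rewrite /E; lra.
have E0 : 0 < E by lra.
have lE : 0 < ln E by rewrite ln_gt0.
have w0 : 0 <= (1 + x ^+ 2)^-1 by rewrite invr_ge0 addr_ge0// sqr_ge0.
have Ew : (E ^+ 2)^-1 <= (1 + x ^+ 2)^-1.
  rewrite lef_pV2 ?posrE ?exprn_gt0//; last by rewrite ltr_pwDl// sqr_ge0.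
  by rewrite /E -(real_normK (num_real x)); nra.
(* Below the threshold E^-2 the whole power is absorbed by the error 1/(1+x^2). Above it |ln a| <= 2
   ln E, which compensates the decay C / ln E of the exponent difference and leaves the factor
   exp(2C). *)
have [aE|Ea] := leP a (E ^+ 2)^-1.
  rewrite (le_trans (powR_le_self q1 _)) ?a0//.
  by rewrite (le_trans aE)// (le_trans Ew)// lerDr mulr_ge0 ?expR_ge0 ?powR_ge0.
rewrite (le_trans _ (ler_wpDr w0 (lexx _)))//.
have a00 : 0 < a by rewrite (lt_trans _ Ea)// invr_gt0 exprn_gt0.
have an0 : a != 0 by rewrite gt_eqF.
rewrite -(subrK q' q) powRD ?an0 ?implybT// ler_wpM2r ?powR_ge0//.
rewrite /powR (negbTE an0) ler_expR.
have lna : - ln a <= 2 * ln E.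
  rewrite -lnV ?posrE// (_ : 2 * ln E = ln (E ^+ 2)); last first.
    by rewrite lnXn// mulr_natl.
  by rewrite ler_ln ?posrE ?invr_gt0 ?exprn_gt0// -[leRHS]invrK lef_pV2 ?posrE ?invr_gt0 ?exprn_gt0// ltW.
have lna0 : ln a <= 0 by rewrite ln_le0.
apply: (@le_trans _ _ (`|q - q'| * (- ln a))).
  by rewrite mulrN -mulNr ler_wnM2r// lerNl -normrN ler_norm.
apply: (@le_trans _ _ (C / ln E * (2 * ln E))).
  by apply: ler_pM => //; rewrite oppr_ge0.
by rewrite le_eqVlt; apply/orP; left; apply/eqP; field; rewrite gt_eqF.
Qed.

Lemma key_arith (c1 c2 q m W w : R) : 0 <= c1 -> 0 <= c2 -> 0 <= q -> 0 <= m ->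
  0 <= W -> 0 <= w ->
  c1 * m + (c2 * (q * (c2 * m + W)) + w) <= (c1 + c2 * q * c2 + c2 * q + 1) * (m + W + w).
Proof.
move=> c10 c20 q0 m0 W0 w0; have h1 := mulr_ge0 c20 q0; have h2 := mulr_ge0 h1 c20.
have := mulr_ge0 c10 W0; have := mulr_ge0 c10 w0.
have := mulr_ge0 h2 W0; have := mulr_ge0 h2 w0.
have := mulr_ge0 h1 m0; have := mulr_ge0 h1 w0.
lra.
Qed.

End PowerInequalities.

(** * Pointwise bound for the Poisson integral at one point and one height *)

Section KeyEstimate.
Context {R : realType}.
Local Notation mu := (@lebesgue_measure R).
Variables (p : R -> R) (pp Cl pinf Ci : R).
Hypothesis mp : measurable_fun setT p.
Hypothesis p1 : forall x, 1 <= p x.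
Hypothesis ppP : forall x, p x <= pp.
Hypothesis Cl0 : 0 <= Cl.
Hypothesis plog : forall x t : R, `|x - t| < 2^-1 -> `|p x - p t| <= Cl / ln (`|x - t|)^-1.
(** Not a strict inequality: exponents larger than 1 may tend to 1 at infinity. *)
Hypothesis pinf1 : 1 <= pinf.
Hypothesis pdecay : forall x, `|p x - pinf| <= Ci / ln (expR 1 + `|x|).

Let w (t : R) : R := (1 + t ^+ 2)^-1.

(** [powR] distinguishes the base 0, where a nonzero exponent gives the value 0; elsewhere the power
    is exp(q ln h). *)
Lemma measurable_powRf (h q : R -> R) : measurable_fun setT h -> measurable_fun setT q ->
  (forall t, q t != 0) -> measurable_fun setT (fun t => h t `^ q t).
Proof.
move=> mh mq q0.
rewrite (_ : (fun t => _) = (fun t => if h t == 0 then 0 else expR (q t * ln (h t)))).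
  apply: measurable_fun_ifT => //.
    apply: (measurable_fun_bool true).
    rewrite (_ : _ @^-1` _ = h @^-1` [set 0]); first exact: mh.
    by apply/seteqP; split => t /= /eqP.
  apply: measurableT_comp => //; apply: measurable_funM => //.
  exact: measurableT_comp.
by apply/funext => t; rewrite /powR (negbTE (q0 t)).
Qed.

Let pn0 t : p t != 0. Proof. by rewrite gt_eqF// (lt_le_trans ltr01). Qed.
Let p0 t : 0 <= p t. Proof. by rewrite (le_trans ler01). Qed.

Lemma oneDsqrV_integrable : mu.-integrable setT (EFin \o w).
Proof.
apply/integrableP; split.
  by apply/measurable_EFinP; apply: continuous_measurable_fun; exact: continuous_oneDsqrV.
under eq_integral => t _.
  rewrite /= ger0_norm; last by rewrite /w invr_ge0 addr_ge0// sqr_ge0.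
  over.
by rewrite integral_oneDsqrV ltry.
Qed.

Variable f : R -> R.
Hypothesis mf : measurable_fun setT f.
Hypothesis f0 : forall t, 0 <= f t.
Let fp t := f t `^ p t.
Hypothesis ifp : mu.-integrable setT (EFin \o fp).
Hypothesis fp1 : \int[mu]_t fp t <= 1.

Let fp0 t : 0 <= fp t. Proof. exact: powR_ge0. Qed.

Variables (x y : R).
Hypothesis y0 : 0 < y.
Let P t := poisson y (x - t).
Let P0 t : 0 <= P t. Proof. exact: poisson_ge0. Qed.
Let mP : measurable_fun setT P. Proof. exact: measurable_poissonB. Qed.

Let PM (h : R -> R) : mu.-integrable setT (EFin \o h) ->
  mu.-integrable setT (EFin \o (fun t => P t * h t)).
Proof.
move=> ih; apply: le_integrable (integrable_mulrl measurableT (pi^-1 / y) ih) => //.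
  apply/measurable_EFinP; apply: measurable_funM => //.
  by apply/measurable_EFinP; exact: measurable_int ih.
move=> t _ /=; rewrite lee_fin normrM [leRHS]normrM ler_wpM2r// (ger0_norm (P0 t)).
by rewrite (le_trans (poisson_le _ y0))// ler_norm.
Qed.

Let iP : mu.-integrable setT (EFin \o P). Proof. exact: integrable_poissonB. Qed.

Let iPfp := PM ifp.

Let iPf : mu.-integrable setT (EFin \o (fun t => P t * f t)).
Proof.
apply: le_integrable (integrable_addr measurableT iP iPfp) => //.
  by apply/measurable_EFinP; exact: measurable_funM.
move=> t _ /=; rewrite lee_fin (ger0_norm (mulr_ge0 (P0 t) (f0 t))).
rewrite (ger0_norm (addr_ge0 (P0 t) (mulr_ge0 (P0 t) (fp0 t)))).
rewrite -{2}(mulr1 (P t)) -mulrDr ler_wpM2l//.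
by have := young_split (p1 t) (f0 t) ltr01; rewrite powR1 mul1r.
Qed.

Let iS (S : set R) (h : R -> R) : measurable S -> mu.-integrable setT (EFin \o h) ->
  mu.-integrable S (EFin \o h).
Proof. by move=> mS; exact: integrableS. Qed.

Let RZ (B : set R) (h : R -> R) (k : R) : measurable B -> mu.-integrable B (EFin \o h) ->
  \int[mu]_(t in B) (k * h t) = k * \int[mu]_(t in B) h t.
Proof. by move=> mB ih; rewrite RintegralZl. Qed.

Let sub_int (S : set R) (h : R -> R) : measurable S -> mu.-integrable setT (EFin \o h) ->
  (forall t, 0 <= h t) -> \int[mu]_(t in S) h t <= \int[mu]_t h t.
Proof.
move=> mS ih h0; rewrite /Rintegral fine_le//.
- by apply: integrable_fin_num => //; exact: iS.
- exact: integrable_fin_num.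
- apply: ge0_subset_integral => //; first exact: measurable_int ih.
  by move=> t _; rewrite lee_fin.
Qed.

Let m := \int[mu]_t (P t * fp t).

Let m0 : 0 <= m. Proof. by apply: Rintegral_ge0 => t _; rewrite mulr_ge0. Qed.

Let m_le : m <= pi^-1 / y.
Proof.
have c0 : 0 <= pi^-1 / y :> R by rewrite divr_ge0 ?invr_ge0 ?pi_ge0// ltW.
apply: (@le_trans _ _ (\int[mu]_t (pi^-1 / y * fp t))).
  apply: le_Rintegral => //; first exact: integrable_mulrl.
  by move=> t _; rewrite ler_wpM2r// poisson_le.
by rewrite (RintegralZl _ measurableT ifp) ler_piMr.
Qed.

Let A := [set t | 1 < f t].
Let mA : measurable A.
Proof.
rewrite (_ : A = setT `&` f @^-1` `]1, +oo[); first exact: mf.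
by rewrite setTI; apply/seteqP; split => t /=; rewrite in_itv/= andbT.
Qed.

Let f_le_fp t : A t -> f t <= fp t.
Proof. by move=> /ltW At; exact: le1r_powR. Qed.

(** The radius balances two demands. Inside, ln (1/|x-t|) >= ln (1/y) / 2, so the log-Hoelder
    condition controls powers of quantities up to 1/y; outside, the kernel is at most 1. *)
Let S : set R := ball x (Num.sqrt y).
Let mS : measurable S. Proof. exact: measurable_ball. Qed.

Let invpi1 : pi^-1 <= 1 :> R.
Proof. by rewrite invf_le1 ?pi_gt0// (le_trans _ (pi_ge2 R))// ler1n. Qed.

Let part_le_m B : measurable B -> B `<=` A -> \int[mu]_(t in B) (P t * f t) <= m.
Proof.
move=> mB BA; apply: (@le_trans _ _ (\int[mu]_(t in B) (P t * fp t))).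
  apply: le_Rintegral => //; [exact: iS|exact: iS|].
  by move=> t Bt; rewrite ler_wpM2l// f_le_fp//; exact: BA.
by apply: sub_int => // t; rewrite mulr_ge0.
Qed.

Let part_le_c B c : measurable B -> B `<=` A -> 0 <= c -> (forall t, B t -> P t <= c) ->
  \int[mu]_(t in B) (P t * f t) <= c.
Proof.
move=> mB BA c0 Pc; apply: (@le_trans _ _ (\int[mu]_(t in B) (c * fp t))).
  apply: le_Rintegral => //; [exact: iS|by apply: iS => //; exact: integrable_mulrl|].
  by move=> t Bt; apply: ler_pM => //; [exact: Pc|apply: f_le_fp; exact: BA].
have ifpB := iS mB ifp.
rewrite (RZ _ mB ifpB) ler_piMr//.
by rewrite (le_trans (sub_int mB ifp fp0)).
Qed.

Let part_ge0 B : 0 <= \int[mu]_(t in B) (P t * f t).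
Proof. by apply: Rintegral_ge0 => t _; rewrite mulr_ge0. Qed.

(** Off [S] the kernel is at most 1, so the integral is at most that of [fp], hence at most 1, and
    raising it to the power p(x) only decreases it. On [A], f <= f^p then gives [m]. *)
Let tail_part : (\int[mu]_(t in A `\` S) (P t * f t)) `^ p x <= m.
Proof.
have mB : measurable (A `\` S) by exact: measurableD.
apply: (le_trans _ (part_le_m mB (@subDsetl _ _ _))).
apply: powR_le_self => //; rewrite part_ge0/=.
apply: (@part_le_c (A `\` S) 1 mB (@subDsetl _ A S) ler01).
move=> t [_ /negP]; rewrite -leNgt => yt.
rewrite /P /poisson mulr_ile1 ?invr_ge0 ?pi_ge0//.
  by rewrite divr_ge0 ?(ltW y0)// ltW// sqrD_gt0.
rewrite ler_pdivrMr ?sqrD_gt0// mul1r.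
have : Num.sqrt y ^+ 2 <= `|x - t| ^+ 2 by rewrite lerXn2r ?nnegrE ?sqrtr_ge0.
rewrite sqr_sqrtr ?(ltW y0)// (real_normK (num_real _)).
by have := sqr_ge0 y; lra.
Qed.

(** The value of (1/y)^(2 Cl / ln (1/y)), the largest factor lost when p(t) is replaced by p(x)
    inside [S]. *)
Let c := expR (2 * Cl).

(** The threshold 1/4 places [S] within the range |x - t| < 1/2 of the log-Hoelder condition. The
    case m <= 1 is settled by t^p <= t; otherwise 1 <= K <= m <= 1/y, so powers of [K] increase with
    the exponent and are bounded by powers of 1/y. *)
Let near_part : y < 1 / 4 ->
  (\int[mu]_(t in A `&` S) (P t * f t)) `^ p x <= (1 + c) `^ pp * m.
Proof.
move=> y4; have mB : measurable (A `&` S) by exact: measurableI.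
have c0 : 0 < c by exact: expR_gt0.
have c1 : 1 <= (1 + c) `^ pp.
  have c1 : 1 <= 1 + c by lra.
  by have := ler_powR c1 (le_trans (p0 x) (ppP x)); rewrite powRr0.
set N := \int[mu]_(t in _) _.
have N0 : 0 <= N by exact: part_ge0.
have Nm : N <= m by apply: part_le_m => //; exact: subIsetl.
have [m1|m1] := leP m 1.
  rewrite (le_trans (powR_le_self (p1 x) _)) ?N0 ?(le_trans Nm)//.
  by rewrite ler_peMl.
(* The height that balances the splitting: K^(1 - p(x)) m = K. *)
pose K := m `^ (p x)^-1.
have m00 : 0 < m by lra.
have K0 : 0 < K by exact: powR_gt0.
have KE : K `^ p x = m by rewrite -powRrM mulVf// powRr1.
have px0 : 0 < p x by exact: lt_le_trans ltr01 (p1 x).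
have pV : 0 <= (p x)^-1 <= 1 by rewrite invr_ge0 (ltW px0) /= invf_le1 ?p1.
have /andP[pV0 pV1] := pV.
have K1 : 1 <= K by have := le_powR pV0 ler01 (ltW m1); rewrite powR1.
have Km : K <= m by exact: ler1_powR (ltW m1) pV1.
have my : m <= y^-1 by rewrite (le_trans m_le)// ler_piMl// invr_ge0 ltW.
have Ky : K <= y^-1 by exact: le_trans my.
have y01 : y < 1 by lra.
have lny : 0 < ln y^-1 by rewrite ln_gt0// invf_gt1.
have KS t : S t -> K `^ (p x - p t) <= c.
  move=> St; have [->|xt] := eqVneq t x.
    by rewrite subrr powRr0 /c -expR0 ler_expR mulr_ge0.
  have d0 : 0 < `|x - t| by rewrite normr_gt0 subr_eq0 eq_sym.
  have sy2 : Num.sqrt y < 2^-1.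
    rewrite -(@ltr_pXn2r _ 2) ?nnegrE ?sqrtr_ge0 ?invr_ge0//.
    by rewrite sqr_sqrtr ?(ltW y0)// expr2; lra.
  have dd : `|x - t| < 2^-1 by exact: lt_trans sy2.
  have lnd : ln y^-1 / 2 <= ln (`|x - t|)^-1.
    rewrite !lnV ?posrE// mulNr lerN2 -(sqr_sqrtr (ltW y0)) lnXn ?sqrtr_gt0//.
    rewrite (_ : ln (Num.sqrt y) *+ 2 / 2 = ln (Num.sqrt y)); last by field.
    by rewrite ler_ln ?posrE ?sqrtr_gt0// ltW.
  have pd : `|p x - p t| <= 2 * Cl / ln y^-1.
    rewrite (le_trans (plog dd))//.
    have -> : 2 * Cl / ln y^-1 = Cl / (ln y^-1 / 2) by field; rewrite gt_eqF.
    rewrite ler_wpM2l// lef_pV2 ?posrE//; last by rewrite divr_gt0.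
    by rewrite (lt_le_trans _ lnd)// divr_gt0.
  apply: (@le_trans _ _ (K `^ `|p x - p t|)).
    by apply: ler_powR => //; exact: ler_norm.
  apply: (@le_trans _ _ (y^-1 `^ `|p x - p t|)).
    by apply: le_powR => //; exact: ltW.
  rewrite /powR gt_eqF ?invr_gt0// /c ler_expR.
  rewrite (le_trans (ler_wpM2r (ltW lny) pd))//.
  by rewrite divfK// gt_eqF.
have NK : N <= (1 + c) * K.
  have i1 := integrable_mulrl measurableT (c * K `^ (1 - p x)) iPfp.
  have i2 := integrable_mulrl measurableT K iP.
  have i12 := integrable_addr measurableT i2 i1.
  apply: (@le_trans _ _ (\int[mu]_(t in A `&` S)
      (K * P t + c * K `^ (1 - p x) * (P t * fp t)))).
    apply: le_Rintegral => //; [exact: iS|exact: iS|].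
    move=> t [_ St]; have := young_split (p1 t) (f0 t) K0 => h.
    rewrite (le_trans (ler_wpM2l (P0 t) h))// mulrDr (mulrC K) lerD2l.
    rewrite mulrCA -/(fp t); apply: (ler_wpM2r (mulr_ge0 (P0 t) (fp0 t))).
    have -> : 1 - p t = (1 - p x) + (p x - p t) by ring.
    rewrite powRD; last by rewrite (gt_eqF K0) implybT.
    by rewrite mulrC ler_wpM2r ?powR_ge0// KS.
  apply: le_trans (sub_int mB i12 _) _.
    move=> t; apply: addr_ge0; first exact: mulr_ge0 (ltW K0) (P0 t).
    exact: mulr_ge0 (mulr_ge0 (ltW c0) (powR_ge0 _ _)) (mulr_ge0 (P0 t) (fp0 t)).
  rewrite RintegralD// (RintegralZl _ measurableT iP) (RintegralZl _ measurableT iPfp).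
  rewrite Rintegral_poissonB// mulr1 -/m mulrDl mul1r lerD2l -mulrA ler_wpM2l ?(ltW c0)//.
  rewrite -KE -powRD; last by rewrite (gt_eqF K0) implybT.
  by rewrite subrK powRr1// ltW.
rewrite (le_trans (le_powR (p0 x) N0 NK))// powRM ?(ltW K0)//; last by lra.
rewrite KE ler_wpM2r//; apply: ler_powR => //; lra.
Qed.

Let C1 := 2 `^ pp * ((1 + c) `^ pp + 1).

Let large_part : (\int[mu]_(t in A) (P t * f t)) `^ p x <= C1 * m.
Proof.
have c0 : 0 < c by exact: expR_gt0.
have p20 : 0 <= 2 `^ pp :> R by exact: powR_ge0.
have c10 : 0 <= (1 + c) `^ pp by exact: powR_ge0.
(* For y >= 1/4 the kernel is at most 4/pi <= 2, so half of the integral is at most 1 and t^p <= t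
   applies to it. *)
have [y4|y4] := ltP y (1 / 4); last first.
  set I := \int[mu]_(t in _) _.
  have I0 : 0 <= I by exact: part_ge0.
  have Im : I <= m by exact: part_le_m.
  have I2 : I / 2 <= 1.
    rewrite ler_pdivrMr// mul1r; apply: part_le_c => // t _.
    rewrite (le_trans (poisson_le _ y0))// ler_pdivrMr// -(ler_pM2l (pi_gt0 R)).
    rewrite mulfV ?gt_eqF ?pi_gt0//; have := pi_ge2 R; nra.
  have -> : I = 2 * (I / 2) by rewrite mulrC divfK.
  rewrite powRM ?divr_ge0//.
  apply: (@le_trans _ _ (2 `^ pp * m)); last first.
    by rewrite /C1 -mulrA ler_wpM2l// mulrDl mul1r lerDr mulr_ge0.
  apply: ler_pM; rewrite ?powR_ge0//; first by apply: ler_powR => //; lra.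
  rewrite (le_trans (powR_le_self (p1 x) _)) ?I2 ?divr_ge0//.
  by rewrite (le_trans _ Im)// ler_pdivrMr// ler_peMr//; lra.
have mB1 : measurable (A `&` S) by exact: measurableI.
have mB2 : measurable (A `\` S) by exact: measurableD.
have -> : \int[mu]_(t in A) (P t * f t) =
    \int[mu]_(t in A `&` S) (P t * f t) + \int[mu]_(t in A `\` S) (P t * f t).
  rewrite -Rintegral_setU//; first by rewrite setUIDK.
    by rewrite setUIDK; exact: iS.
  by apply/disj_setPS => t [[_ +] [_]].
rewrite (le_trans (powRD_le (p0 x) (part_ge0 _) (part_ge0 _)))//.
rewrite /C1 -mulrA; apply: ler_pM; rewrite ?powR_ge0 ?addr_ge0 ?powR_ge0//.
  by apply: ler_powR => //; lra.
by rewrite mulrDl mul1r; apply: lerD; [exact: near_part|exact: tail_part].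
Qed.

Let b := \int[mu]_(t in ~` A) (P t * f t `^ pinf).

Let mAC : measurable (~` A). Proof. exact: measurableC. Qed.

Let f1 t : (~` A) t -> 0 <= f t <= 1.
Proof. by move=> /negP; rewrite -leNgt f0. Qed.

Let iPq : mu.-integrable (~` A) (EFin \o (fun t => P t * f t `^ pinf)).
Proof.
apply: le_integrable (iS mAC iP) => //.
  apply/measurable_EFinP; apply: measurable_funTS; apply: measurable_funM => //.
  apply: (@measurable_powRf f (cst pinf)) => // t.
  by rewrite gt_eqF// (lt_le_trans ltr01).
move=> t At /=; rewrite lee_fin (ger0_norm (P0 t)).
rewrite (ger0_norm (mulr_ge0 (P0 t) (powR_ge0 _ _))).
rewrite ler_piMr// (le_trans (powR_le_self pinf1 (f1 At)))//.
by have /andP[] := f1 At.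
Qed.

Let C2 := expR (2 * Ci).

Let b_le : b <= C2 * m + \int[mu]_t (P t * w t).
Proof.
have iPw := PM oneDsqrV_integrable.
have w0 t : 0 <= w t by rewrite invr_ge0 addr_ge0// sqr_ge0.
have i1 := integrable_mulrl measurableT C2 iPfp.
have i12 := integrable_addr measurableT i1 iPw.
apply: (@le_trans _ _ (\int[mu]_(t in ~` A) (C2 * (P t * fp t) + P t * w t))).
  apply: le_Rintegral => //; first exact: iS.
  move=> t At; rewrite mulrCA -mulrDr; apply: ler_wpM2l => //.
  by apply: powR_exchange => //; [exact: f1|rewrite distrC].
apply: le_trans (sub_int mAC i12 _) _.
  move=> t; apply: addr_ge0; first exact: mulr_ge0 (expR_ge0 _) (mulr_ge0 (P0 t) (fp0 t)).
  exact: mulr_ge0 (P0 t) (w0 t).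
by rewrite RintegralD// (RintegralZl _ measurableT iPfp).
Qed.

(** Jensen's inequality for the constant exponent, up to the factor 2^pinf, from the splitting at K
    = b^(1/pinf). When b = 0 this K is not positive, and arbitrarily small K are used instead. *)
Let small_mean : (\int[mu]_(t in ~` A) (P t * f t)) `^ pinf <= 2 `^ pinf * b.
Proof.
set a := \int[mu]_(t in _) _.
have a0 : 0 <= a by exact: part_ge0.
have b0 : 0 <= b by apply: Rintegral_ge0 => t _; rewrite mulr_ge0 ?powR_ge0.
have q0 : 0 < pinf by exact: lt_le_trans pinf1.
have aK K : 0 < K -> a <= K + K `^ (1 - pinf) * b.
  move=> K0; have i1 := iS mAC (integrable_mulrl measurableT K iP).
  have i2 : mu.-integrable (~` A) (EFin \o (fun t => K `^ (1 - pinf) * (P t * f t `^ pinf))).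
    exact: integrable_mulrl.
  apply: (@le_trans _ _ (\int[mu]_(t in ~` A)
      (K * P t + K `^ (1 - pinf) * (P t * f t `^ pinf)))).
    apply: le_Rintegral => //; [exact: iS|exact: integrable_addr|].
    move=> t _; rewrite [X in _ <= _ + X]mulrCA (mulrC K) -mulrDr.
    by apply: ler_wpM2l => //; exact: young_split.
  rewrite RintegralD// (RZ _ mAC iPq) (RZ _ mAC (iS mAC iP)) lerD2r.
  rewrite ler_piMr ?(ltW K0)// (le_trans (sub_int mAC iP P0))//.
  by rewrite Rintegral_poissonB.
move: b0; rewrite le_eqVlt => /predU1P[b0|b0].
  have -> : a = 0.
    apply/eqP; rewrite eq_le a0 andbT; apply/ler_addgt0Pr => e e0.
    by have := aK e e0; rewrite -b0 mulr0 addr0 add0r.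
  by rewrite powR0 ?(gt_eqF q0)// -b0 mulr0.
pose K := b `^ pinf^-1.
have K0 : 0 < K by exact: powR_gt0.
have KE : K `^ pinf = b by rewrite -powRrM (mulVf (lt0r_neq0 q0)) (powRr1 (ltW b0)).
have h := aK K K0.
rewrite -[in leRHS]KE -powRM ?(ltW K0)//; apply: le_powR => //; first exact: ltW.
rewrite (le_trans h)// -KE -powRD; last by rewrite (gt_eqF K0) implybT.
by rewrite subrK powRr1 ?(ltW K0)// mulrDl mul1r.
Qed.

(** The exponent is exchanged twice: p(x) for [pinf] outside the integral, with error w(x), and
    [pinf] for p(t) inside it through [b_le], with error P * w. The constant exponent in between is
    where the mean is compared. *)
Let small_part : (\int[mu]_(t in ~` A) (P t * f t)) `^ p x <=
  C2 * (2 `^ pinf * (C2 * m + \int[mu]_t (P t * w t))) + w x.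
Proof.
set a := \int[mu]_(t in _) _.
have a0 : 0 <= a by exact: part_ge0.
have a1 : a <= 1.
  apply: (@le_trans _ _ (\int[mu]_(t in ~` A) P t)).
    apply: le_Rintegral => //; [exact: iS|exact: iS|].
    by move=> t At; rewrite ler_piMr//; have /andP[] := f1 At.
  by rewrite (le_trans (sub_int mAC iP P0))// Rintegral_poissonB.
apply: (le_trans (powR_exchange (p1 x) pinf1 _ (pdecay x))); first by rewrite a0.
rewrite lerD2r ler_wpM2l ?expR_ge0// (le_trans small_mean)//.
by rewrite ler_wpM2l ?powR_ge0.
Qed.

(** The right-hand side is made to be integrated in x: by Tonelli the three terms then contribute at
    most 1, pi and pi. *)
Lemma key_estimate : (\int[mu]_t (P t * f t)) `^ p x <=
  2 `^ pp * ((C1 + C2 * 2 `^ pinf * C2 + C2 * 2 `^ pinf + 1) *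
    (m + \int[mu]_t (P t * w t) + w x)).
Proof.
have w0 t : 0 <= w t by rewrite invr_ge0 addr_ge0// sqr_ge0.
have W0 : 0 <= \int[mu]_t (P t * w t) by apply: Rintegral_ge0 => t _; rewrite mulr_ge0.
have -> : \int[mu]_t (P t * f t) =
    \int[mu]_(t in A) (P t * f t) + \int[mu]_(t in ~` A) (P t * f t).
  rewrite -Rintegral_setU//; first by rewrite setUv.
    by rewrite setUv.
  by apply/disj_setPS => t [].
rewrite (le_trans (powRD_le (p0 x) (part_ge0 _) (part_ge0 _)))//.
apply: ler_pM; rewrite ?powR_ge0 ?addr_ge0 ?powR_ge0//.
  by apply: ler_powR => //; lra.
apply: (le_trans (lerD large_part small_part)).
have C10 : 0 <= C1 by rewrite mulr_ge0 ?addr_ge0 ?powR_ge0.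
have C20 : 0 <= C2 by exact: expR_ge0.
have q0 : 0 <= 2 `^ pinf :> R by exact: powR_ge0.
exact: key_arith.
Qed.

End KeyEstimate.

(** * Uniform modular bound for Poisson integrals *)

Section PoissonModular.
Context {R : realType}.
Local Notation mu := (@lebesgue_measure R).
Implicit Types (p f h : R -> R) (x y t : R).

(** The upper bound for p comes from the decay condition, as ln (e + |x|) >= 1. That [pinf] is at
    least 1 is p > 1 in the limit, tested at x = exp(Ci/e), where p is within e of [pinf]. *)
Lemma LH_constants p : (forall x, 1 < p x) -> LH p ->
  exists pp Cl pinf Ci : R, [/\ (forall x, p x <= pp), 0 <= Cl,
    (forall x t, `|x - t| < 2^-1 -> `|p x - p t| <= Cl / ln (`|x - t|)^-1),
    1 <= pinf & (forall x, `|p x - pinf| <= Ci / ln (expR 1 + `|x|))].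
Proof.
move=> p1 [[Cl [Cl0 plog]] [pinf [Ci [Ci0 pinfP]]]].
exists (pinf + Ci), Cl, pinf, Ci; split => //; first 2 last.
- apply/ler_addgt0Pl => e e0.
  pose x := expR (Ci / e).
  have x0 : 0 < x by exact: expR_gt0.
  have := pinfP x; rewrite (gtr0_norm x0) => h.
  have xle : Ci / e <= ln (expR 1 + x).
    rewrite -[leLHS]expRK ler_ln ?posrE ?expR_gt0 ?addr_gt0 ?expR_gt0//.
    by rewrite lerDr expR_ge0.
  have : Ci / ln (expR 1 + x) <= e.
    have l0 : 0 < ln (expR 1 + x) by rewrite (lt_le_trans _ xle)// divr_gt0.
    by rewrite ler_pdivrMr// mulrC -ler_pdivrMr.
  move: h; rewrite ler_norml => /andP[_ h]; have := p1 x; lra.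
- move=> x; have := pinfP x; rewrite ler_norml => /andP[_ h].
  have l1 : 1 <= ln (expR 1 + `|x|).
    by rewrite -[leLHS]expRK ler_ln ?posrE ?expR_gt0 ?ltr_pwDl ?expR_gt0// lerDl.
  have : Ci / ln (expR 1 + `|x|) <= Ci.
    by rewrite ler_pdivrMr ?ler_peMr ?(ltW Ci0)// (lt_le_trans ltr01).
  lra.
- exact: ltW.
Qed.

Lemma measurable_poisson_kernel y h : 0 < y -> measurable_fun setT h ->
  measurable_fun setT (fun z : R * R => (poisson y (z.1 - z.2) * h z.2)%:E).
Proof.
move=> y0 mh; apply/measurable_EFinP; apply: measurable_funM.
  apply: (measurableT_comp (f := poisson y)).
    by apply: continuous_measurable_fun; exact: continuous_poisson.
  by apply: measurable_funB; [exact: measurable_fst|exact: measurable_snd].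
by apply: (measurableT_comp (f := h)) => //; exact: measurable_snd.
Qed.

Lemma measurable_poisson_integral y h : 0 < y -> measurable_fun setT h ->
  (forall t, 0 <= h t) ->
  measurable_fun setT (fun x => \int[mu]_t (poisson y (x - t) * h t)%:E)%E.
Proof.
move=> y0 mh h0.
apply: (@measurable_fun_fubini_tonelli_F _ _ _ _ R mu
  (fun z : R * R => (poisson y (z.1 - z.2) * h z.2)%:E)).
  exact: measurable_poisson_kernel.
by move=> z; rewrite lee_fin mulr_ge0// poisson_ge0.
Qed.

Lemma poisson_tonelli y h : 0 < y -> measurable_fun setT h -> (forall t, 0 <= h t) ->
  (\int[mu]_x \int[mu]_t (poisson y (x - t) * h t)%:E = \int[mu]_t (h t)%:E)%E.
Proof.
move=> y0 mh h0.
rewrite (@fubini_tonelli _ _ _ _ R mu mu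
  (fun z : R * R => (poisson y (z.1 - z.2) * h z.2)%:E)); last 2 first.
- exact: measurable_poisson_kernel.
- by move=> z; rewrite lee_fin mulr_ge0// poisson_ge0.
apply: eq_integral => t _ /=.
under eq_integral do rewrite mulrC EFinM.
rewrite ge0_integralZl//.
- by rewrite integral_poissonBl// mule1.
- by apply/measurable_EFinP; under eq_fun do rewrite poissonBC; exact: measurable_poissonB.
- by move=> x _; rewrite lee_fin poisson_ge0.
- by rewrite lee_fin.
Qed.

Lemma ge0_integrable_lt_pinfty f : measurable_fun setT f -> (forall t, 0 <= f t) ->
  (\int[mu]_t (f t)%:E < +oo)%E -> mu.-integrable setT (EFin \o f).
Proof.
move=> mf f0 foo; apply/integrableP; split; first exact/measurable_EFinP.
by under eq_integral do rewrite /= ger0_norm//.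
Qed.

Lemma EFin_Rintegral (D : set R) f : measurable D -> mu.-integrable D (EFin \o f) ->
  (\int[mu]_(t in D) f t)%:E = (\int[mu]_(t in D) (f t)%:E)%E.
Proof. by move=> mD fi; rewrite /Rintegral fineK//; exact: integrable_fin_num. Qed.

(** [key_estimate] integrated in x. The constant depends on the exponent only, which gives
    uniformity in the height and, by scaling, a norm bound. *)
Lemma poisson_modular p : measurable_fun setT p -> (forall x, 1 < p x) -> LH p ->
  exists2 C : R, 0 < C & forall f y, measurable_fun setT f -> (forall t, 0 <= f t) ->
    (\int[mu]_t (f t `^ p t)%:E <= 1)%E -> 0 < y ->
    (\int[mu]_x (pint f x y `^ p x)%:E <= C%:E)%E.
Proof.
move=> mp p1 /(LH_constants p1) [pp [Cl [pinf [Ci [ppP Cl0 plog pinf1 pdecay]]]]].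
set K := 2 `^ pp * (2 `^ pp * ((1 + expR (2 * Cl)) `^ pp + 1) +
   expR (2 * Ci) * 2 `^ pinf * expR (2 * Ci) + expR (2 * Ci) * 2 `^ pinf + 1).
have K0 : 0 <= K.
  by rewrite mulr_ge0 ?powR_ge0// !addr_ge0 ?mulr_ge0 ?addr_ge0 ?powR_ge0 ?expR_ge0.
have pi0 := @pi_gt0 R.
have s0 : 0 <= 1 + pi + pi :> R by lra.
exists (K * (1 + pi + pi) + 1); first by rewrite ltr_wpDl// mulr_ge0.
move=> f y mf f0 fle y0.
have p1' x : 1 <= p x by exact: ltW.
have pn0 t : p t != 0 by rewrite gt_eqF// (lt_le_trans ltr01).
pose fp t := f t `^ p t.
have mfp : measurable_fun setT fp by exact: measurable_powRf.
have fp0 t : 0 <= fp t by exact: powR_ge0.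
have ifp : mu.-integrable setT (EFin \o fp).
  by apply: ge0_integrable_lt_pinfty => //; exact: le_lt_trans fle (ltry _).
have fp1 : \int[mu]_t fp t <= 1 by rewrite -lee_fin EFin_Rintegral.
pose w t : R := (1 + t ^+ 2)^-1.
have w0 t : 0 <= w t by rewrite invr_ge0 addr_ge0// sqr_ge0.
have iw : mu.-integrable setT (EFin \o w) by exact: oneDsqrV_integrable.
have mw : measurable_fun setT w by apply/measurable_EFinP; exact: measurable_int iw.
have iP h x : (forall t, 0 <= h t) -> mu.-integrable setT (EFin \o h) ->
    mu.-integrable setT (EFin \o (fun t => poisson y (x - t) * h t)).
  move=> h0 ih; apply: le_integrable (integrable_mulrl measurableT (pi^-1 / y) ih) => //.
    apply/measurable_EFinP; apply: measurable_funM; first exact: measurable_poissonB.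
    by apply/measurable_EFinP; exact: measurable_int ih.
  move=> t _ /=; rewrite lee_fin normrM [leRHS]normrM ler_wpM2r//.
  by rewrite (ger0_norm (poisson_ge0 _ y0)) (le_trans (poisson_le _ y0))// ler_norm.
have key x : ((pint f x y `^ p x)%:E <= K%:E * (\int[mu]_t (poisson y (x - t) * fp t)%:E +
    \int[mu]_t (poisson y (x - t) * w t)%:E + (w x)%:E))%E.
  rewrite -!EFin_Rintegral//; [|exact: iP|exact: iP].
  rewrite -!EFinD -EFinM lee_fin /K -[leRHS]mulrA.
  exact: key_estimate.
have mf1 := measurable_poisson_integral y0 mfp fp0.
have mw1 := measurable_poisson_integral y0 mw w0.
have g1 x : (0 <= \int[mu]_t (poisson y (x - t) * fp t)%:E)%E.
  by apply: integral_ge0 => t _; rewrite lee_fin mulr_ge0// poisson_ge0.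
have g2 x : (0 <= \int[mu]_t (poisson y (x - t) * w t)%:E)%E.
  by apply: integral_ge0 => t _; rewrite lee_fin mulr_ge0// poisson_ge0.
apply: (@le_trans _ _ (\int[mu]_x (K%:E * (\int[mu]_t (poisson y (x - t) * fp t)%:E +
    \int[mu]_t (poisson y (x - t) * w t)%:E + (w x)%:E)))%E).
  apply: ge0_le_integral => //.
  - by move=> x _; rewrite lee_fin powR_ge0.
  - apply/measurable_EFinP; apply: measurable_powRf => //.
    apply: (measurableT_comp (f := fine)) => //.
    exact: measurable_poisson_integral.
  - apply: emeasurable_funM => //; apply: emeasurable_funD; last exact/measurable_EFinP.
    exact: emeasurable_funD.
rewrite ge0_integralZl ?lee_fin//; last 2 first.
- apply: emeasurable_funD; last exact/measurable_EFinP.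
  exact: emeasurable_funD.
- move=> x _; apply: adde_ge0; first by apply: adde_ge0; [exact: g1|exact: g2].
  by rewrite lee_fin; exact: w0.
rewrite ge0_integralD//; last 4 first.
- by move=> x _; rewrite adde_ge0.
- exact: emeasurable_funD.
- by move=> x _; rewrite lee_fin.
- exact/measurable_EFinP.
rewrite ge0_integralD// !poisson_tonelli// integral_oneDsqrV.
apply: (@le_trans _ _ (K%:E * (1 + pi%:E + pi%:E))%E).
  apply: lee_wpmul2l; first by rewrite lee_fin.
  by apply: leeD => //; exact: leeD.
by rewrite -!EFinD -EFinM lee_fin lerDl.
Qed.

End PoissonModular.

(** * Almost everywhere boundary values *)

Section BoundaryValues.
Context {R : realType}.
Local Notation mu := (@lebesgue_measure R).
Implicit Types (x y t : R) (u : R -> R).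

(** This is pi times the Poisson kernel of height one at the origin; integrability against it makes
    all Poisson integrals absolutely convergent. *)
Definition pweight t : R := (1 + t ^+ 2)^-1.

Definition pintegrable u :=
  measurable_fun setT u /\ mu.-integrable setT (EFin \o (fun t => pweight t * u t)).

Lemma pweight_gt0 t : 0 < pweight t.
Proof. by rewrite invr_gt0 ltr_pwDl// sqr_ge0. Qed.

Lemma measurable_pweight : measurable_fun setT pweight.
Proof. by apply: continuous_measurable_fun; exact: continuous_oneDsqrV. Qed.

(** The constant comes from t^2 <= 2 (x-t)^2 + 2 x^2, divided by (x-t)^2 + y^2. *)
Lemma poisson_le_pweight x y : 0 < y ->
  exists2 C : R, 0 <= C & forall t, poisson y (x - t) <= C * pweight t.
Proof.
move=> y0; exists (y * (2 + (1 + 2 * x ^+ 2) / y ^+ 2)).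
  apply: mulr_ge0; first exact: ltW.
  by rewrite addr_ge0// divr_ge0 ?sqr_ge0// addr_ge0// mulr_ge0// sqr_ge0.
move=> t; rewrite /pweight ler_pdivlMr; last by rewrite ltr_pwDl// sqr_ge0.
have N0 := sqrD_gt0 (x - t) y0.
have t0 : 0 < 1 + t ^+ 2 by rewrite ltr_pwDl// sqr_ge0.
have invpi1 : pi^-1 <= 1 :> R.
  by rewrite invf_le1 ?pi_gt0// (le_trans _ (pi_ge2 R))// ler1n.
apply: (@le_trans _ _ (y / ((x - t) ^+ 2 + y ^+ 2) * (1 + t ^+ 2))).
  rewrite ler_wpM2r ?(ltW t0)// /poisson ler_piMl//.
  by rewrite divr_ge0 ?(ltW y0) ?(ltW N0).
rewrite -mulrA ler_wpM2l ?(ltW y0)// mulrC ler_pdivrMr//.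
have y20 : 0 < y ^+ 2 by rewrite exprn_gt0.
have x20 := sqr_ge0 x; have xt := sqr_ge0 (x - t).
have -> : (2 + (1 + 2 * x ^+ 2) / y ^+ 2) * ((x - t) ^+ 2 + y ^+ 2) =
  2 * (x - t) ^+ 2 + 2 * y ^+ 2 + (1 + 2 * x ^+ 2) * ((x - t) ^+ 2 / y ^+ 2) + (1 + 2 * x ^+ 2).
  by field; rewrite gt_eqF.
have h : 0 <= (1 + 2 * x ^+ 2) * ((x - t) ^+ 2 / y ^+ 2).
  by apply: mulr_ge0; [rewrite addr_ge0// mulr_ge0|rewrite divr_ge0// ltW].
have := sqr_ge0 (2 * x - t); nra.
Qed.

Lemma pintegrable_poisson u x y : pintegrable u -> 0 < y ->
  mu.-integrable setT (EFin \o (fun t => poisson y (x - t) * u t)).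
Proof.
move=> [mu_ iu] y0; have [C C0 CP] := poisson_le_pweight x y0.
apply: le_integrable (integrable_mulrl measurableT C iu) => //.
  by apply/measurable_EFinP; apply: measurable_funM => //; exact: measurable_poissonB.
move=> t _ /=; rewrite lee_fin normrM [leRHS]normrM [X in _ <= _ * X]normrM mulrA.
rewrite ler_wpM2r// (ger0_norm (poisson_ge0 _ y0)) (ger0_norm C0).
by rewrite (ger0_norm (ltW (pweight_gt0 t))).
Qed.

Lemma pintegrable_locally u : pintegrable u -> locally_integrable setT u.
Proof.
move=> [mu_ iu]; split => //; first exact: openT.
move=> K _ cK.
have [M [_ MK]] := compact_bounded cK.
have KM t : K t -> `|t| <= M + 1 by apply: MK; rewrite ltrDl.
have mK : measurable K by exact: compact_measurable.
pose B := 1 + (M + 1) ^+ 2.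
have /integrableP[_ ioo] := integrable_mulrl measurableT B iu.
apply: le_lt_trans ioo.
apply: (@le_trans _ _ (\int[mu]_(t in K) `|(B * (pweight t * u t))%:E|)%E).
  apply: ge0_le_integral => //.
  - by apply/measurable_EFinP; apply: measurableT_comp => //; exact: measurable_funTS.
  - apply: measurableT_comp => //; apply/measurable_EFinP; apply: measurable_funTS.
    apply: measurable_funM => //; apply: measurable_funM => //.
    exact: measurable_pweight.
  - move=> t Kt; rewrite /= lee_fin mulrA normrM ler_peMl//.
    have w0 := pweight_gt0 t.
    have B0 : 0 <= B by rewrite addr_ge0// sqr_ge0.
    rewrite ger0_norm ?mulr_ge0 ?(ltW w0)// /pweight ler_pdivlMr ?mul1r; last first.
      by rewrite ltr_pwDl// sqr_ge0.
    rewrite lerD2l -(real_normK (num_real t)) lerXn2r ?nnegrE ?KM//.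
    by rewrite (le_trans _ (KM t Kt)).
apply: ge0_subset_integral => //.
apply: measurableT_comp => //; apply/measurable_EFinP.
by apply: measurable_funM => //; apply: measurable_funM => //; exact: measurable_pweight.
Qed.

Lemma pintegrable_subr u (a : R) : pintegrable u -> pintegrable (fun t => u t - a).
Proof.
move=> [mu_ iu]; split; first exact: measurable_funB.
have iw : mu.-integrable setT (EFin \o pweight) by exact: oneDsqrV_integrable.
apply: eq_integrable (integrable_subr measurableT iu (integrable_mulrl measurableT a iw)) => //.
by move=> t _ /=; rewrite mulrBr (mulrC a).
Qed.

Lemma pintegrable_normr u : pintegrable u -> pintegrable (fun t => `|u t|).
Proof.
move=> [mu_ iu]; split; first exact: measurableT_comp.
apply: eq_integrable (integrable_normr measurableT iu) => // t _ /=.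
by rewrite normrM (ger0_norm (ltW (pweight_gt0 t))).
Qed.

(* Dyadic annuli around [x]: the mass of [P_y] on the [k]-th one is [O(2^-k)]. *)
Lemma poisson_dyadic (g : R -> R) x y e (N : nat) : 0 < y -> 0 <= e ->
  measurable_fun setT g -> (forall t, 0 <= g t) ->
  (forall k, (k <= N)%N ->
    (\int[mu]_(t in ball x (2 ^+ k * y)) (g t)%:E <= (2 * (2 ^+ k * y) * e)%:E)%E) ->
  (\int[mu]_(t in ball x (2 ^+ N * y)) (poisson y (x - t) * g t)%:E <= (10 * e)%:E)%E.
Proof.
move=> y0 e0 mg g0 gk.
have mB k : measurable (ball x (2 ^+ k * y)) by exact: measurable_ball.
have mP D : measurable_fun D (fun t => (poisson y (x - t) * g t)%:E).
  apply/measurable_EFinP; apply: measurable_funTS; apply: measurable_funM => //.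
  exact: measurable_poissonB.
have invpi1 : pi^-1 <= 1 :> R.
  by rewrite invf_le1 ?pi_gt0// (le_trans _ (pi_ge2 R))// ler1n.
have bound (D : set R) (c b : R) k : measurable D -> D `<=` ball x (2 ^+ k * y) -> (k <= N)%N ->
    0 <= c -> (forall t, D t -> poisson y (x - t) <= c) -> c * (2 * (2 ^+ k * y) * e) <= b ->
    (\int[mu]_(t in D) (poisson y (x - t) * g t)%:E <= b%:E)%E.
  move=> mD Dk kN c0 Pc cb.
  have mgD S : measurable_fun S (fun t => (g t)%:E).
    by apply/measurable_EFinP; exact: measurable_funTS.
  apply: (@le_trans _ _ (\int[mu]_(t in D) (c%:E * (g t)%:E))%E).
    apply: ge0_le_integral => //.
    - by move=> t Dt; rewrite lee_fin mulr_ge0// poisson_ge0.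
    - exact: mP.
    - by apply: measurable_funeM; exact: mgD.
    - by move=> t Dt; rewrite -EFinM lee_fin ler_wpM2r// Pc.
  rewrite ge0_integralZl//; last 2 first.
  - exact: mgD.
  - by move=> t _; rewrite lee_fin.
  apply: (@le_trans _ _ (c%:E * (2 * (2 ^+ k * y) * e)%:E)%E); last by rewrite -EFinM lee_fin.
  rewrite lee_wpmul2l ?lee_fin//; apply: le_trans (gk k kN).
  apply: ge0_subset_integral; [exact: mD|exact: mB|exact: mgD| |exact: Dk].
  by move=> t _; rewrite lee_fin.
(* The innermost ball contributes at most 2e and the annulus between radii 2^k y and 2^(k+1) y at
   most 4e / 2^k; the geometric sum is 8e (1 - 2^-k). *)
suff H k : (k <= N)%N -> (\int[mu]_(t in ball x (2 ^+ k * y)) (poisson y (x - t) * g t)%:E <=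
    (2 * e + 8 * e * (1 - (2 ^+ k)^-1))%:E)%E.
  apply: le_trans (H N (leqnn N)) _; rewrite lee_fin.
  have k0 : 0 <= (2 ^+ N)^-1 :> R by rewrite invr_ge0 exprn_ge0.
  have := mulr_ge0 e0 k0; lra.
elim: k => [|k IHk] kN.
  apply: (@bound _ y^-1 _ 0%N) => //.
  - by rewrite invr_ge0 ltW.
  - by move=> t _; rewrite (le_trans (poisson_le _ y0))// ler_piMl// invr_ge0 (ltW y0).
  - rewrite expr0 mul1r invr1 subrr mulr0 addr0 le_eqVlt; apply/orP; left; apply/eqP.
    by field; rewrite gt_eqF.
have sub : ball x (2 ^+ k * y) `<=` ball x (2 ^+ k.+1 * y).
  apply: le_ball; rewrite exprS -mulrA ler_peMl ?ler1n//.
  by rewrite mulr_ge0 ?exprn_ge0 ?(ltW y0).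
have -> : ball x (2 ^+ k.+1 * y) = ball x (2 ^+ k * y) `|`
    (ball x (2 ^+ k.+1 * y) `\` ball x (2 ^+ k * y)) by rewrite setDUK.
have mD' : measurable (ball x (2 ^+ k.+1 * y) `\` ball x (2 ^+ k * y)).
  exact: measurableD.
rewrite ge0_integral_setU//; last 3 first.
- exact: mP.
- by move=> t _; rewrite lee_fin mulr_ge0// poisson_ge0.
- by apply/disj_setPS => t [? []].
apply: (@le_trans _ _ ((2 * e + 8 * e * (1 - (2 ^+ k)^-1))%:E + (4 * e / 2 ^+ k)%:E)%E).
  apply: leeD; first by apply: IHk; exact: ltnW.
  have p4 : 0 < 4 ^+ k :> R by rewrite exprn_gt0.
  apply: (@bound _ (4 ^+ k * y)^-1 _ k.+1 mD' (@subDsetl _ _ _)) => //.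
  - by rewrite invr_ge0 mulr_ge0 ?(ltW p4) ?(ltW y0).
  - move=> t [_ /negP]; rewrite /ball/= -leNgt => kt.
    have k2 : 4 ^+ k * y ^+ 2 <= (x - t) ^+ 2.
      have -> : 4 ^+ k * y ^+ 2 = (2 ^+ k * y) ^+ 2.
        by rewrite exprMn -exprM mulnC exprM; congr (_ ^+ _ * _); rewrite -natrX.
      rewrite -(real_normK (num_real (x - t))) lerXn2r ?nnegrE//.
      by rewrite mulr_ge0 ?exprn_ge0 ?(ltW y0).
    rewrite /poisson; apply: (@le_trans _ _ (y / ((x - t) ^+ 2 + y ^+ 2))).
      by rewrite ler_piMl// divr_ge0 ?(ltW y0)// ltW// sqrD_gt0.
    rewrite ler_pdivrMr ?sqrD_gt0// mulrC ler_pdivlMr ?mulr_gt0//.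
    by have := sqr_ge0 y; rewrite expr2 in k2 *; lra.
  - rewrite le_eqVlt; apply/orP; left; apply/eqP.
    have -> : 4 ^+ k = 2 ^+ k * 2 ^+ k :> R by rewrite -exprMn; congr (_ ^+ _); rewrite -natrM.
    have k0 : 2 ^+ k != 0 :> R by rewrite expf_neq0.
    by rewrite exprS; field; rewrite ?k0 ?(gt_eqF y0).
  rewrite -EFinD lee_fin exprS invfM.
  by rewrite le_eqVlt; apply/orP; left; apply/eqP; field; rewrite expf_neq0.
exact: measurable_ball.
Qed.

(** Within a fixed radius [rho] the averages of |u - u(x)| are small and [poisson_dyadic] applies;
    beyond it [poisson_tail] compares with the kernel of height [rho], at the cost of a factor
    2y/rho. Both [rho] and the heights are powers of 1/2, so the doubling balls end exactly at
    radius [rho]. *)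
Lemma lebesgue_pt_poisson u x : pintegrable u -> lebesgue_pt u x ->
  pint u x (2^-1 ^+ n) @[n --> \oo] --> u x.
Proof.
move=> pu xpt; have [mu_ iu] := pu.
pose g t := `|u t - u x|.
have mg : measurable_fun setT g.
  by apply: measurableT_comp => //; exact: measurable_funB.
have pg : pintegrable g by apply: pintegrable_normr; exact: pintegrable_subr.
have g0 t : 0 <= g t by exact: normr_ge0.
have diff y : 0 < y -> (`|pint u x y - u x|%:E <= \int[mu]_t (poisson y (x - t) * g t)%:E)%E.
  move=> y0; have i1 := pintegrable_poisson x pu y0.
  have i2 := integrable_poissonB x y0.
  have i2' : mu.-integrable setT (EFin \o (fun t => u x * poisson y (x - t))).
    exact: integrable_mulrl.
  have -> : pint u x y - u x = \int[mu]_t (poisson y (x - t) * (u t - u x)).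
    under eq_Rintegral do rewrite mulrBr [X in _ - X]mulrC.
    by rewrite RintegralB// (RintegralZl _ measurableT i2) Rintegral_poissonB// mulr1.
  have i3 := pintegrable_poisson x (pintegrable_subr (u x) pu) y0.
  have i4 := pintegrable_poisson x pg y0.
  rewrite -EFin_Rintegral// lee_fin.
  apply: le_trans (le_normr_Rintegral measurableT i3) _.
  apply: le_Rintegral => //; first exact: integrable_normr.
  by move=> t _; rewrite normrM (ger0_norm (poisson_ge0 _ y0)).
apply/cvgrPdist_le => e e0.
(* Ten shares for the dyadic balls and one for the tail. *)
have e110 : 0 < e / 11 by rewrite divr_gt0.
have [d d0 dP] : exists2 d : R, 0 < d & forall r, 0 < r < d ->
    (\int[mu]_(t in ball x r) (g t)%:E <= (2 * r * (e / 11))%:E)%E.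
  have h11 : (0 < (e / 11)%:E)%E by rewrite lte_fin.
  move: xpt; rewrite /lebesgue_pt => /fine_cvgP [fnum /cvgrPdist_lt /(_ _ e110) cl].
  have [d /= d0 dP] : \forall r \near 0^'+, (davg u x r < (e / 11)%:E)%E.
    near=> r.
    have fr : davg u x r \is a fin_num by near: r; exact: fnum.
    have : `|0 - fine (davg u x r)| < e / 11 by near: r; exact: cl.
    rewrite sub0r normrN ger0_norm; last by rewrite fine_ge0// davg_ge0.
    by rewrite -lte_fin fineK.
  exists d => // r /andP[r0 rd].
  have := dP r; rewrite /ball_/= sub0r normrN gtr0_norm// => /(_ rd r0) /ltW.
  rewrite /davg /iavg lebesgue_measure_ball ?(ltW r0)//.
  have r2 : r *+ 2 != 0 by rewrite mulrn_eq0/= gt_eqF.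
  rewrite inver (negbTE r2) muleC lee_pdivrMr ?lte_fin ?mulrn_wgt0//.
  rewrite -EFinM mulrC -[r *+ 2]mulr_natl.
  move=> h; apply: le_trans h; rewrite le_eqVlt; apply/orP; left; apply/eqP.
  by apply: eq_integral.
have [m mP] : exists m, 2^-1 ^+ m < d :> R.
  have : (2^-1 : R) ^+ n @[n --> \oo] --> 0.
    by apply: cvg_expr; rewrite ger0_norm ?invr_ge0// invf_lt1// ltr1n.
  move=> /cvgrPdist_lt /(_ _ d0) [m _ /(_ m (leqnn m))] /=.
  by rewrite sub0r normrN ger0_norm ?exprn_ge0 ?invr_ge0// => ?; exists m.
pose rho : R := 2^-1 ^+ m.
have rho0 : 0 < rho by rewrite exprn_gt0// invr_gt0.
pose Cx := \int[mu]_t (poisson rho (x - t) * g t).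
have Cx0 : 0 <= Cx by apply: Rintegral_ge0 => t _; rewrite mulr_ge0// poisson_ge0.
have CxE := EFin_Rintegral measurableT (pintegrable_poisson x pg rho0).
have c1 : 0 < e / 11 / (2 / rho * Cx + 1).
  by rewrite divr_gt0// ltr_wpDl// mulr_ge0// divr_ge0// ltW.
have ev : \forall n \near \oo, 2^-1 ^+ n <= e / 11 / (2 / rho * Cx + 1).
  have : (2^-1 : R) ^+ n @[n --> \oo] --> 0.
    by apply: cvg_expr; rewrite ger0_norm ?invr_ge0// invf_lt1// ltr1n.
  move=> /cvgrPdist_le /(_ _ c1); apply: filterS => n.
  by rewrite sub0r normrN; apply: le_trans; exact: ler_norm.
near=> n.
have yc : 2^-1 ^+ n <= e / 11 / (2 / rho * Cx + 1) by near: n; exact: ev.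
have mn : (m <= n)%N by near: n; exact: nbhs_infty_ge.
have y0 : 0 < 2^-1 ^+ n :> R by rewrite exprn_gt0// invr_gt0.
have yE k : (k <= n)%N -> 2 ^+ k * 2^-1 ^+ n = 2^-1 ^+ (n - k) :> R.
  move=> kn; rewrite -{1}(subnK kn) exprD mulrCA -exprMn divff// expr1n mulr1 //.
rewrite distrC -lee_fin (le_trans (diff _ y0))//.
set y : R := 2^-1 ^+ n in y0 yE yc *.
have mB : measurable (ball x rho) by exact: measurable_ball.
rewrite -(setUv (ball x rho)) ge0_integral_setU//; last 4 first.
- exact: measurableC.
- rewrite setUv; apply/measurable_EFinP; apply: measurable_funM => //.
  exact: measurable_poissonB.
- by move=> t _; rewrite lee_fin mulr_ge0// poisson_ge0.
- by apply/disj_setPS => t [].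
have -> : e%:E = ((10 * (e / 11))%:E + (e / 11)%:E)%E by rewrite -EFinD; congr EFin; field.
apply: leeD.
  have -> : rho = 2 ^+ (n - m) * y by rewrite yE ?leq_subr// subKn.
  apply: poisson_dyadic => //; first exact: ltW.
  move=> k kn; apply: dP; rewrite mulr_gt0 ?exprn_gt0//=.
  rewrite yE; last by rewrite (leq_trans kn)// leq_subr.
  apply: le_lt_trans mP; rewrite ler_wiXn2l ?invr_ge0 ?invf_le1 ?ler1n//.
  by rewrite leq_subRL ?(leq_trans kn) ?leq_subr// addnC -leq_subRL.
apply: (@le_trans _ _ (\int[mu]_t ((2 * y / rho)%:E * (poisson rho (x - t) * g t)%:E))%E).
  apply: (@le_trans _ _ (\int[mu]_(t in ~` ball x rho)
      ((2 * y / rho)%:E * (poisson rho (x - t) * g t)%:E))%E).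
    apply: ge0_le_integral => //.
    - exact: measurableC.
    - by move=> t _; rewrite lee_fin mulr_ge0// poisson_ge0.
    - apply/measurable_EFinP; apply: measurable_funTS; apply: measurable_funM => //.
      exact: measurable_poissonB.
    - apply: measurable_funeM; apply/measurable_EFinP; apply: measurable_funTS.
      by apply: measurable_funM => //; exact: measurable_poissonB.
    - move=> t /negP; rewrite /ball/= -leNgt => rt.
      by rewrite -EFinM lee_fin mulrA ler_wpM2r// poisson_tail.
  apply: ge0_subset_integral => //; first exact: measurableC.
    apply: measurable_funeM; apply/measurable_EFinP.
    by apply: measurable_funM => //; exact: measurable_poissonB.
  move=> t _; apply: mule_ge0; rewrite lee_fin.
    by rewrite !mulr_ge0 ?invr_ge0 ?(ltW y0) ?(ltW rho0).
  exact: mulr_ge0 (poisson_ge0 _ rho0) (g0 t).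
rewrite ge0_integralZl//; last 3 first.
- by apply/measurable_EFinP; apply: measurable_funM => //; exact: measurable_poissonB.
- by move=> t _; rewrite lee_fin mulr_ge0// poisson_ge0.
- by rewrite lee_fin !mulr_ge0 ?invr_ge0 ?(ltW y0) ?(ltW rho0).
rewrite -CxE -EFinM lee_fin.
have h0 : 0 <= 2 / rho * Cx by rewrite mulr_ge0// divr_ge0// ltW.
move: yc; rewrite ler_pdivlMr; last by rewrite ltr_wpDl.
rewrite (_ : 2 * y / rho * Cx = y * (2 / rho * Cx)); last by ring.
by move=> yc; apply: le_trans yc; rewrite ler_wpM2l ?(ltW y0)// lerDl.
Unshelve. all: by end_near. Qed.

Lemma ae_poisson_cvg u : pintegrable u ->
  {ae mu, forall x, pint u x (2^-1 ^+ n) @[n --> \oo] --> u x}.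
Proof.
move=> pu; have := lebesgue_differentiation (pintegrable_locally pu).
by apply: negligibleS; apply: subsetC => x xpt; exact: lebesgue_pt_poisson.
Qed.

End BoundaryValues.

(** * Existence of the boundary function *)

Section Existence.
Context {R : realType}.
Local Notation mu := (@lebesgue_measure R).

Lemma LH_continuous (p : R -> R) : LH p -> continuous p.
Proof.
move=> [[C [C0 pC]] _] x; apply/cvgrPdist_le => e e0.
pose d := Num.min 2^-1 (expR (- (C / e))).
have d0 : 0 < d by rewrite lt_min invr_gt0 ltr0n/= expR_gt0.
apply/nbhs_ballP; exists d => //= t; rewrite /ball/= lt_min => /andP[t1 t2].
have [->|tx] := eqVneq t x; first by rewrite subrr normr0 ltW.
have xt0 : 0 < `|x - t| by rewrite normr_gt0 subr_eq0 eq_sym.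
have l1 : C / e <= ln (`|x - t|)^-1.
  by rewrite lnV ?posrE// lerNr -[leRHS]expRK ler_ln ?posrE ?expR_gt0// ltW.
have l0 : 0 < ln (`|x - t|)^-1 by rewrite (lt_le_trans _ l1)// divr_gt0.
rewrite (le_trans (pC x t t1))// ler_pdivrMr// mulrC -ler_pdivrMr//.
Qed.

Variables (p : R -> R) (f : R * R -> R) (M : R).
Hypothesis mp : measurable_fun setT p.
Hypothesis p1 : forall x, 1 < p x.
Hypothesis cp : continuous p.
Hypothesis hf : harmonic_on (@upper_half_plane R) f.
Hypothesis fM : forall y, 0 < y -> (\int[mu]_t (`|f (t, y)| `^ p t)%:E <= M%:E)%E.

Let p1' x : 1 <= p x. Proof. exact: ltW. Qed.
Let pn0 t : p t != 0. Proof. by rewrite gt_eqF// (lt_le_trans ltr01). Qed.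

Let fp y t := `|f (t, y)| `^ p t.
Let fp0 y t : 0 <= fp y t. Proof. exact: powR_ge0. Qed.

Let ms y : 0 < y -> measurable_fun setT (fun t => f (t, y)).
Proof. by move=> y0; apply: continuous_measurable_fun; exact: harmonic_slice. Qed.

Let ifp y : 0 < y -> mu.-integrable setT (EFin \o fp y).
Proof.
move=> y0; apply: ge0_integrable_lt_pinfty.
- by apply: measurable_powRf => //; apply: measurableT_comp => //; exact: ms.
- exact: fp0.
- exact: le_lt_trans (fM y0) (ltry _).
Qed.

Let M0 : 0 <= M.
Proof.
rewrite -lee_fin; apply: le_trans (fM ltr01).
by apply: integral_ge0 => t _; rewrite lee_fin powR_ge0.
Qed.

Let fpM y (A : set R) : 0 < y -> measurable A -> \int[mu]_(t in A) fp y t <= M.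
Proof.
move=> y0 mA; rewrite -lee_fin EFin_Rintegral//; last first.
  by apply: (integrableS measurableT) => //; exact: ifp.
apply: le_trans (fM y0); apply: ge0_subset_integral => //.
- exact: measurable_int (ifp y0).
- by move=> t _; rewrite lee_fin fp0.
Qed.

Let iA (A : set R) (h : R -> R) : measurable A -> mu.-integrable setT (EFin \o h) ->
  mu.-integrable A (EFin \o h).
Proof. by move=> mA; exact: integrableS. Qed.

Let f_le y t (K : R) : 0 < K -> `|f (t, y)| <= K + K `^ (1 - p t) * fp y t.
Proof. by move=> K0; exact: young_split. Qed.

Let segment_bound (a b y : R) : a < b -> 0 < y ->
  \int[mu]_(t in `[a, b]) `|f (t, y)| <= b - a + M.
Proof.
move=> ab y0.
have mI : measurable (`[a, b]%classic : set R) by exact: measurable_itv.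
have i1 : mu.-integrable `[a, b] (EFin \o (fun=> 1 : R)).
  by apply: continuous_integrable => t; exact: cvg_cst.
have i2 : mu.-integrable `[a, b] (EFin \o fp y) by apply: iA => //; exact: ifp.
apply: (@le_trans _ _ (\int[mu]_(t in `[a, b]) (1 + fp y t))).
  apply: le_Rintegral; [by []| | |].
  - by apply: integrable_normr => //; apply: continuous_integrable; exact: harmonic_slice.
  - exact: integrable_addr.
  - by move=> t _; have := f_le y t ltr01; rewrite powR1 mul1r.
rewrite RintegralD// lerD ?fpM//.
by rewrite Rintegral_cst//= lebesgue_measure_itv/= lte_fin ab/= mul1r.
Qed.

Let rep s x y : 0 < s -> 0 < y -> f (x, s + y) = pint (fun t => f (t, s)) x y.
Proof. exact: (harmonic_representation hf segment_bound). Qed.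

Let g s t := pweight t * f (t, s).
Let iw : mu.-integrable setT (EFin \o pweight (R := R)).
Proof. exact: oneDsqrV_integrable. Qed.
Let w0 (t : R) : 0 <= pweight t. Proof. exact: ltW (pweight_gt0 t). Qed.
Let w1 (t : R) : pweight t <= 1.
Proof. by rewrite invf_le1 ?lerDl ?sqr_ge0// ltr_pwDl// sqr_ge0. Qed.

Let ig s : 0 < s -> mu.-integrable setT (EFin \o g s).
Proof.
move=> s0; apply: le_integrable (integrable_addr measurableT iw (ifp s0)) => //.
  apply/measurable_EFinP; apply: measurable_funM; first exact: measurable_pweight.
  exact: ms.
move=> t _ /=; rewrite lee_fin normrM (ger0_norm (w0 t)).
rewrite (ger0_norm (addr_ge0 (w0 t) (fp0 s t))).
have := f_le s t ltr01; rewrite powR1 mul1r => h.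
rewrite (le_trans (ler_wpM2l (w0 t) h))// mulrDr mulr1 lerD2l.
by rewrite ler_piMl.
Qed.

(** On [-L, L] the continuous exponent has a minimum q > 1, so splitting at a large height K leaves
    the factor K^(1-q) in front of |f|^p. Off this segment the weight is at most 1/L, and splitting
    at height 1 is enough, whatever the behaviour of p at infinity. *)
Let equi e : 0 < e -> exists2 K : R, 0 <= K & forall s A,
  0 < s -> measurable A ->
  \int[mu]_(t in A) `|g s t| <= K * \int[mu]_(t in A) pweight t + e.
Proof.
move=> e0.
(* Large enough for M / L <= e / 2, hence for (1/L + 1/L) M <= e. *)
pose L : R := 1 + 2 * M / e.
have L1 : 1 <= L by rewrite lerDl divr_ge0 ?mulr_ge0// ltW.
have LL : - L <= L by lra.
have cL : {within `[- L, L], continuous p} by exact: continuous_subspaceT.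
have [c _ pc] := EVT_min LL cL.
pose q := p c.
have q1 : 0 < q - 1 by rewrite subr_gt0; exact: p1.
(* The solution of K^(1 - q) = 1/L, so that both regions lose the same factor. *)
pose K := L `^ (q - 1)^-1.
have K1 : 1 <= K.
  by have := @le_powR _ (q - 1)^-1 1 L; rewrite powR1; apply => //; rewrite invr_ge0 ltW.
have K0 : 0 < K by lra.
have KE : K `^ (1 - q) = L^-1.
  rewrite -powRrM (_ : (q - 1)^-1 * (1 - q) = -1); first by rewrite powR_inv1//; lra.
  by field; rewrite gt_eqF.
have LM : L^-1 * M <= e / 2.
  rewrite mulrC ler_pdivrMr; last by lra.
  rewrite /L mulrDr mulr1 (_ : e / 2 * (2 * M / e) = M); last by field; rewrite gt_eqF.
  by rewrite lerDr; lra.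
exists K; first exact: ltW.
move=> s A s0 mA.
have ptw t : `|g s t| <= K * pweight t + (L^-1 + L^-1) * fp s t.
  rewrite normrM (ger0_norm (w0 t)).
  have LV : 0 <= L^-1 by rewrite invr_ge0; lra.
  have [tL|tL] := leP `|t| L.
    have h := f_le s t K0.
    have tI : t \in `[- L, L] by rewrite in_itv/= -ler_norml.
    have kq : K `^ (1 - p t) <= L^-1.
      by rewrite -KE; apply: ler_powR => //; rewrite lerD2l lerN2; exact: pc.
    have h' : `|f (t, s)| <= K + L^-1 * fp s t.
      by rewrite (le_trans h)// lerD2l ler_wpM2r.
    rewrite (le_trans (ler_wpM2l (w0 t) h'))// mulrDr (mulrC K) lerD2l.
    rewrite (@le_trans _ _ (L^-1 * fp s t))// ?ler_piMl ?mulr_ge0//.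
    by rewrite ler_wpM2r// lerDl.
  have h := f_le s t ltr01; rewrite powR1 mul1r in h.
  rewrite (le_trans (ler_wpM2l (w0 t) h))// mulrDr mulr1.
  apply: lerD; first by rewrite ler_peMl.
  rewrite ler_wpM2r//.
  have t2 : L <= t ^+ 2.
    rewrite -(real_normK (num_real t)) expr2 (le_trans (ltW tL))// ler_peMl//.
    by rewrite (le_trans L1)// ltW.
  rewrite (@le_trans _ _ L^-1)// ?lerDl//.
  have t20 : 0 < 1 + t ^+ 2 by rewrite ltr_pwDl// sqr_ge0.
  have L0 : 0 < L by exact: lt_le_trans ltr01 L1.
  by rewrite /pweight lef_pV2 ?posrE// (le_trans t2)// lerDr.
have i1 : mu.-integrable A (EFin \o (fun t => K * pweight t)).
  by apply: integrable_mulrl => //; exact: iA.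
have i2 : mu.-integrable A (EFin \o (fun t => (L^-1 + L^-1) * fp s t)).
  by apply: integrable_mulrl => //; apply: iA => //; exact: ifp.
apply: (@le_trans _ _ (\int[mu]_(t in A) (K * pweight t + (L^-1 + L^-1) * fp s t))).
  apply: le_Rintegral; [by []| | |].
  - by apply: integrable_normr => //; apply: iA => //; exact: ig.
  - exact: integrable_addr.
  - by move=> t _; exact: ptw.
rewrite RintegralD// RintegralZl//; last exact: iA.
rewrite RintegralZl//; last by apply: iA => //; exact: ifp.
rewrite lerD2l.
have LV : 0 <= L^-1 + L^-1 by rewrite addr_ge0 ?invr_ge0//; lra.
rewrite (le_trans (ler_wpM2l LV (fpM s0 mA)))//; lra.
Qed.

(** The representation above height s reads f(x, s+y) as the integral of g_s against phi(t) =
    P_y(x-t) (1+t^2), which is bounded. As s tends to 0 the left side tends to f(x, y) by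
    continuity, and the right side is identified by [ultra_weak_limit]; dividing [v] by the weight
    gives [u]. *)
Lemma boundary_value : exists2 u : R -> R, pintegrable u &
  forall x y, 0 < y -> pint u x y = f (x, y).
Proof.
have [F [UF sF]] := @ultraFilterLemma R (0^'+) (at_right_proper_filter 0).
have F0 : \forall s \near F, 0 < s by apply: sF; exact: nbhs_right_gt.
have [v iv vP] := @ultra_weak_limit _ _ R mu g pweight iw w0 ig equi F UF F0.
have wn0 (t : R) : pweight t != 0 by rewrite gt_eqF// pweight_gt0.
have mv : measurable_fun setT v by apply/measurable_EFinP; exact: measurable_int iv.
exists (fun t => v t * (1 + t ^+ 2)).
  split; first by apply: measurable_funM => //; apply: measurable_funD => //; exact: measurable_funX.
  apply: eq_integrable iv => // t _ /=; congr EFin.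
  by rewrite /pweight mulrCA mulVf ?mulr1// gt_eqF// ltr_pwDl// sqr_ge0.
move=> x y y0.
have [C C0 CP] := poisson_le_pweight x y0.
pose phi t := poisson y (x - t) * (1 + t ^+ 2).
have t0 (t : R) : 0 < 1 + t ^+ 2 by rewrite ltr_pwDl// sqr_ge0.
have -> : pint (fun t => v t * (1 + t ^+ 2)) x y = \int[mu]_t (phi t * v t).
  by apply: eq_Rintegral => t _; rewrite /phi; ring.
apply: (vP phi C).
- apply: measurable_funM; first exact: measurable_poissonB.
  by apply: measurable_funD => //; exact: measurable_funX.
- move=> t; rewrite /phi mulr_ge0 ?poisson_ge0 ?(ltW (t0 t))//=.
  by have := CP t; rewrite /pweight ler_pdivlMr.
have PF : ProperFilter F by exact: ultra_proper.
have cf : f (x, s + y) @[s --> 0^'+] --> f (x, y).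
  apply: cvg_at_right_filter; rewrite -{2}(add0r y).
  apply: (@continuous_comp _ _ _ (fun s => (x, s + y)) f); last first.
    by apply: harmonic_continuous => //; rewrite add0r.
  move=> A [[A1 A2] /= [h1 h2] hA].
  have c : (s + y) @[s --> (0 : R)] --> 0 + y by apply: cvgD; [exact: cvg_id|exact: cvg_cst].
  have [d /= d0 dP] := c _ h2; exists d => //= s sd; apply: hA; split => /=.
    exact: nbhs_singleton.
  exact: dP.
have cF : f (x, s + y) @[s --> F] --> f (x, y).
  by move=> A /cf; exact: sF.
apply: cvg_trans cF; apply: near_eq_cvg; apply: filterS F0 => s s0.
rewrite rep//; apply: eq_Rintegral => t _; rewrite /phi /g /pweight.
by field; rewrite gt_eqF.
Qed.

End Existence.

(** * Luxemburg norms *)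

Section Norms.
Context {R : realType}.
Local Notation mu := (@lebesgue_measure R).
Implicit Types (a b l x y : R) (p fr fi u : R -> R).

Lemma cmod_ge0 a b : 0 <= cmod a b.
Proof. exact: sqrtr_ge0. Qed.

Lemma cmod_ge_norml a b : `|a| <= cmod a b.
Proof. by rewrite /cmod -sqrtr_sqr ler_wsqrtr// lerDl sqr_ge0. Qed.

Lemma cmod_ge_normr a b : `|b| <= cmod a b.
Proof. by rewrite /cmod -sqrtr_sqr ler_wsqrtr// lerDr sqr_ge0. Qed.

Lemma cmod_le_normD a b : cmod a b <= `|a| + `|b|.
Proof.
rewrite -(@ler_pXn2r _ 2) ?nnegrE ?cmod_ge0 ?addr_ge0//.
rewrite /cmod sqr_sqrtr ?addr_ge0 ?sqr_ge0// sqrrD !real_normK ?num_real//.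
by rewrite lerD2r lerDl mulrn_wge0// mulr_ge0.
Qed.

Lemma cmodM a b l : 0 <= l -> cmod (a * l) (b * l) = cmod a b * l.
Proof.
move=> l0; rewrite /cmod !exprMn -mulrDl sqrtrM ?addr_ge0 ?sqr_ge0//.
by rewrite sqrtr_sqr ger0_norm.
Qed.

Lemma measurable_cmod fr fi : measurable_fun setT fr -> measurable_fun setT fi ->
  measurable_fun setT (fun t => cmod (fr t) (fi t)).
Proof.
move=> mr mi; apply: (measurableT_comp (f := @Num.sqrt R)).
  by apply: continuous_measurable_fun; exact: sqrt_continuous.
by apply: measurable_funD; exact: measurable_funX.
Qed.

Lemma cvg_cmod (ar br : nat -> R) a b : ar @ \oo --> a -> br @ \oo --> b ->
  cmod (ar n) (br n) @[n --> \oo] --> cmod a b.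
Proof.
move=> ca cb; apply: (@continuous_cvg _ _ _ _ _ (fun n => ar n ^+ 2 + br n ^+ 2)
  (@Num.sqrt R) (a ^+ 2 + b ^+ 2)).
  exact: sqrt_continuous.
by apply: cvgD; rewrite expr2; apply: cvgM.
Qed.

Lemma cvg_powR_base (an : nat -> R) a (q : R) : 0 < q -> (forall n, 0 <= an n) ->
  an @ \oo --> a -> an n `^ q @[n --> \oo] --> a `^ q.
Proof.
move=> q0 an0 ca.
have a0 : 0 <= a.
  by apply: (ler_cvg_to (cvg_cst (0 : R)) ca); exact: nearW.
move: a0; rewrite le_eqVlt => /predU1P[a0|a0].
  rewrite -a0 powR0 ?gt_eqF//; rewrite -a0 in ca.
  apply/cvgr0Pnorm_le => e e0.
  have e'0 : 0 < e `^ q^-1 by exact: powR_gt0.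
  move/cvgr0Pnorm_le : ca => /(_ _ e'0); apply: filterS => n.
  rewrite !ger0_norm ?powR_ge0// => h.
  have := le_powR (ltW q0) (an0 n) h.
  by rewrite -powRrM mulVf ?gt_eqF// powRr1// ltW.
apply: (@continuous_cvg _ _ _ _ _ an (fun z : R => z `^ q) a) => //.
apply: differentiable_continuous; apply/derivable1_diffP.
by apply: derivable_powR; rewrite in_itv/= andbT.
Qed.

Lemma measurable_modular p fr fi : measurable_fun setT p -> (forall x, 1 < p x) ->
  measurable_fun setT fr -> measurable_fun setT fi ->
  measurable_fun setT (fun t => (cmod (fr t) (fi t) `^ p t)%:E).
Proof.
move=> mp p1 mr mi; apply/measurable_EFinP; apply: measurable_powRf => //.
  exact: measurable_cmod.
by move=> t; rewrite gt_eqF// (lt_trans ltr01).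
Qed.

Lemma modular_anti p fr fi l l' : measurable_fun setT p -> (forall x, 1 < p x) ->
  measurable_fun setT fr -> measurable_fun setT fi -> 0 < l -> l <= l' ->
  (modular p (fun x => (fr x / l')%R) (fun x => (fi x / l')%R) <=
   modular p (fun x => (fr x / l)%R) (fun x => (fi x / l)%R))%E.
Proof.
move=> mp p1 mr mi l0 ll'; have l'0 : 0 < l' by exact: lt_le_trans ll'.
apply: ge0_le_integral => //.
- by move=> x _; rewrite lee_fin powR_ge0.
- by apply: measurable_modular => //; exact: measurable_funM.
- by apply: measurable_modular => //; exact: measurable_funM.
- move=> x _; rewrite lee_fin; apply: le_powR; rewrite ?cmod_ge0//.
    by rewrite (le_trans ler01)// ltW.
  rewrite !cmodM ?invr_ge0 ?(ltW l0) ?(ltW l'0)//.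
  by rewrite ler_wpM2l ?cmod_ge0// lef_pV2.
Qed.

Lemma lp_norm_ge0 p fr fi : (0 <= lp_norm p fr fi)%E.
Proof. by apply: le_ereal_inf_tmp => _ [l [l0 _] <-]; rewrite lee_fin ltW. Qed.

Lemma lp_norm_lt p fr fi l : measurable_fun setT p -> (forall x, 1 < p x) ->
  measurable_fun setT fr -> measurable_fun setT fi -> (lp_norm p fr fi < l%:E)%E ->
  (modular p (fun x => (fr x / l)%R) (fun x => (fi x / l)%R) <= 1)%E.
Proof.
move=> mp p1 mr mi /ereal_inf_lt[_ [l' [l'0 ml'] <-]]; rewrite lte_fin => ll'.
by apply: le_trans ml'; apply: modular_anti => //; exact: ltW.
Qed.

(* Fatou's lemma along the a.e. convergent sequence of Poisson averages. *)
Lemma modular_fatou p (ur ui : R -> R) l (c : \bar R) :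
  measurable_fun setT p -> (forall x, 1 < p x) -> pintegrable ur -> pintegrable ui ->
  (forall n, measurable_fun setT (fun x => pint ur x (2^-1 ^+ n))) ->
  (forall n, measurable_fun setT (fun x => pint ui x (2^-1 ^+ n))) ->
  (forall n, modular p (fun x => (pint ur x (2^-1 ^+ n) / l)%R)
                        (fun x => (pint ui x (2^-1 ^+ n) / l)%R) <= c)%E ->
  (modular p (fun x => (ur x / l)%R) (fun x => (ui x / l)%R) <= c)%E.
Proof.
move=> mp p1 pur pui mr mi Hc.
pose F n x := (cmod (pint ur x (2^-1 ^+ n) / l) (pint ui x (2^-1 ^+ n) / l) `^ p x)%:E.
have mF n : measurable_fun setT (F n).
  by apply: measurable_modular => //; exact: measurable_funM.
have F0 n x : (0 <= F n x)%E by rewrite lee_fin powR_ge0.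
have mur : measurable_fun setT ur by case: pur.
have mui : measurable_fun setT ui by case: pui.
have -> : modular p (fun x => ur x / l) (fun x => ui x / l) =
    (\int[mu]_x limn_einf (F^~ x))%E.
  apply: ae_eq_integral => //.
  - by apply: measurable_modular => //; exact: measurable_funM.
  - apply: (measurableT_comp (f := @oppe R)) => //.
    apply: (@measurable_fun_limn_esup _ _ _ setT (fun n x => - F n x)%E) => n.
    exact: (measurableT_comp (f := @oppe R)).
  - have := ae_poisson_cvg pur; have := ae_poisson_cvg pui => hi hr.
    have := negligibleU hr hi; apply: negligibleS => x /= /not_implyP[_ nE].
    apply: contrapT => /not_orP[/contrapT cr /contrapT ci]; apply: nE.
    apply/esym; have : F n x @[n --> \oo] --> (cmod (ur x / l) (ui x / l) `^ p x)%:E.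
      apply: cvg_EFin; first exact: nearW.
      apply: cvg_powR_base; [exact: lt_trans (p1 x)|by move=> n; exact: cmod_ge0|].
      by apply: cvg_cmod; apply: cvgM => //; exact: cvg_cst.
    by move=> /cvg_limn_einf_sup[->].
have Ffatou : (\int[mu]_x limn_einf (F^~ x) <= limn_einf (fun n => \int[mu]_x F n x))%E.
  by apply: fatou => // n x _; exact: F0.
apply: (le_trans Ffatou).
rewrite limn_einf_lim; apply: lime_le; first exact: is_cvg_einfs.
apply: nearW => n; apply: le_trans (Hc n); apply: ereal_inf_lbound.
by exists n => /=.
Qed.

(** From |u| <= 1 + cmod^p, with a weight that is integrable and at most 1. Stated for any [u]
    dominated by the modulus, to serve for both components and for the modulus itself. *)
Lemma in_Lp_pintegrable p fr fi u : measurable_fun setT p -> (forall x, 1 < p x) ->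
  in_Lp p fr fi -> measurable_fun setT u -> (forall t, `|u t| <= cmod (fr t) (fi t)) ->
  pintegrable u.
Proof.
move=> mp p1 [mr mi foo] mk kle; split => //.
have pn0 t : p t != 0 by rewrite gt_eqF// (lt_trans ltr01).
pose h t := cmod (fr t) (fi t) `^ p t.
have mh : measurable_fun setT h by apply: measurable_powRf => //; exact: measurable_cmod.
have ih : mu.-integrable setT (EFin \o h).
  by apply: ge0_integrable_lt_pinfty => // t; exact: powR_ge0.
have iw : mu.-integrable setT (EFin \o pweight (R := R)) by exact: oneDsqrV_integrable.
apply: le_integrable (integrable_addr measurableT iw ih) => //.
  by apply/measurable_EFinP; apply: measurable_funM => //; exact: measurable_pweight.
move=> t _ /=; have w0 := ltW (pweight_gt0 t).
have h0 : 0 <= h t by exact: powR_ge0.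
rewrite lee_fin normrM (ger0_norm w0) (ger0_norm (addr_ge0 w0 h0)).
have := young_split (ltW (p1 t)) (cmod_ge0 (fr t) (fi t)) ltr01.
rewrite powR1 mul1r => kh.
rewrite (le_trans (ler_wpM2l w0 (le_trans (kle t) kh)))// mulrDr mulr1 lerD2l.
rewrite ler_piMl// invf_le1 ?lerDl ?sqr_ge0//.
by rewrite ltr_pwDl// sqr_ge0.
Qed.

Lemma pint_normr_le u h x y : 0 < y -> pintegrable u -> pintegrable h ->
  (forall t, `|u t| <= h t) -> `|pint u x y| <= pint h x y.
Proof.
move=> y0 pu ph uh.
have i1 := pintegrable_poisson x pu y0; have i2 := pintegrable_poisson x ph y0.
apply: le_trans (le_normr_Rintegral measurableT i1) _.
apply: le_Rintegral => //; first exact: integrable_normr.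
move=> t _; rewrite normrM (ger0_norm (poisson_ge0 _ y0)).
by apply: ler_wpM2l => //; exact: poisson_ge0.
Qed.

End Norms.

(** * From the modular bound to the Luxemburg norm *)

Section NormEquivalence.
Context {R : realType}.
Local Notation mu := (@lebesgue_measure R).
Implicit Types (l x y : R) (p u : R -> R).

Lemma pint_divr u l x y : pintegrable u -> 0 < y ->
  pint (fun t => u t / l) x y = pint u x y / l.
Proof.
move=> pu y0; rewrite /pint -RintegralZr//; last exact: pintegrable_poisson.
by apply: eq_Rintegral => t _; rewrite mulrA.
Qed.

Lemma measurable_pint u y : 0 < y -> measurable_fun setT u -> (forall t, 0 <= u t) ->
  measurable_fun setT (fun x => pint u x y).
Proof.
move=> y0 mu_ u0; apply: (measurableT_comp (f := fine)) => //.
exact: measurable_poisson_integral.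
Qed.

(** Since p >= 1, a factor 1/(C+1) <= 1 inside the power may be taken out, so the modular bound C
    becomes C/(C+1) <= 1. The other factor 2 pays for bounding the modulus by the sum of the
    absolute values of the two components. *)
Lemma modular_pint_le p (ur ui : R -> R) (C l y : R) :
  measurable_fun setT p -> (forall x, 1 < p x) -> 0 < C ->
  (forall f : R -> R, measurable_fun setT f -> (forall t, 0 <= f t) ->
    (\int[mu]_t (f t `^ p t)%:E <= 1)%E -> (\int[mu]_x (pint f x y `^ p x)%:E <= C%:E)%E) ->
  pintegrable ur -> pintegrable ui ->
  measurable_fun setT (fun x => pint ur x y) ->
  measurable_fun setT (fun x => pint ui x y) -> 0 < l -> 0 < y ->
  (modular p (fun x => (ur x / l)%R) (fun x => (ui x / l)%R) <= 1)%E ->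
  (modular p (fun x => (pint ur x y / (2 * (C + 1) * l))%R)
             (fun x => (pint ui x y / (2 * (C + 1) * l))%R) <= 1)%E.
Proof.
move=> mp p1 C0 Cbound pur pui mr mi l0 y0 mod1.
have mur : measurable_fun setT ur by case: pur.
have mui : measurable_fun setT ui by case: pui.
have mur' : measurable_fun setT (fun t => ur t / l) by exact: measurable_funM.
have mui' : measurable_fun setT (fun t => ui t / l) by exact: measurable_funM.
have K0 : 0 < C + 1 by lra.
have Kn0 : C + 1 != 0 by rewrite gt_eqF.
have iL : in_Lp p (fun t => ur t / l) (fun t => ui t / l).
  by split => //; exact: le_lt_trans mod1 (ltry _).
pose f t := cmod (ur t / l) (ui t / l).
have f0 t : 0 <= f t by exact: cmod_ge0.
have mf : measurable_fun setT f by exact: measurable_cmod.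
have pf : pintegrable f.
  by apply: (in_Lp_pintegrable mp p1 iL) => // t; rewrite ger0_norm.
have pur' : pintegrable (fun t => ur t / l).
  by apply: (in_Lp_pintegrable mp p1 iL) => // t; exact: cmod_ge_norml.
have pui' : pintegrable (fun t => ui t / l).
  by apply: (in_Lp_pintegrable mp p1 iL) => // t; exact: cmod_ge_normr.
have ptw x : cmod (pint ur x y / (2 * (C + 1) * l)) (pint ui x y / (2 * (C + 1) * l)) <=
    (C + 1)^-1 * pint f x y.
  have hr : `|pint ur x y / l| <= pint f x y.
    by rewrite -pint_divr//; apply: pint_normr_le => // t; exact: cmod_ge_norml.
  have hi : `|pint ui x y / l| <= pint f x y.
    by rewrite -pint_divr//; apply: pint_normr_le => // t; exact: cmod_ge_normr.
  have E z : z / (2 * (C + 1) * l) = z / l * (2 * (C + 1))^-1 by rewrite invfM; ring.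
  have K2 : 0 <= (2 * (C + 1))^-1 by rewrite invr_ge0; lra.
  rewrite !E cmodM//.
  have h := le_trans (cmod_le_normD (pint ur x y / l) (pint ui x y / l)) (lerD hr hi).
  apply: le_trans (ler_wpM2r K2 h) _.
  by rewrite le_eqVlt; apply/orP; left; apply/eqP; field.
have pf0 x : 0 <= pint f x y.
  by apply: Rintegral_ge0 => // t _; rewrite mulr_ge0 ?poisson_ge0.
have mpf : measurable_fun setT (fun x => pint f x y `^ p x).
  apply: measurable_powRf => //; first exact: measurable_pint.
  by move=> t; rewrite gt_eqF// (lt_trans ltr01).
apply: (@le_trans _ _ (\int[mu]_x ((C + 1)^-1%:E * (pint f x y `^ p x)%:E))%E).
  apply: ge0_le_integral => //.
  - by move=> x _; rewrite lee_fin powR_ge0.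
  - by apply: measurable_modular => //; exact: measurable_funM.
  - by apply: measurable_funeM; exact/measurable_EFinP.
  - move=> x _; rewrite -EFinM lee_fin.
    apply: le_trans (le_powR _ (cmod_ge0 _ _) (ptw x)) _.
      by rewrite (le_trans ler01)// ltW.
    apply: ge1r_powRZ => //; last exact: ltW.
    by rewrite invr_gt0 K0 invf_le1//; lra.
rewrite ge0_integralZl//; last 3 first.
- exact/measurable_EFinP.
- by move=> x _; rewrite lee_fin powR_ge0.
- by rewrite lee_fin invr_ge0 ltW.
rewrite lee_pdivrMl// mule1; apply: (le_trans (Cbound f mf f0 mod1)).
by rewrite lee_fin; lra.
Qed.

End NormEquivalence.

Theorem theorem4p4 (R : realType) (p : R -> R) :
  measurable_fun setT p -> (forall x, 1 < p x) -> LH p ->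
  exists c C : R, [/\ 0 < c, 0 < C &
    forall Ur Ui : R * R -> R, in_hp p Ur Ui ->
      exists ur ui : R -> R,
        [/\ in_Lp p ur ui, poisson_rep Ur Ui ur ui,
            (c%:E * lp_norm p ur ui <= sup_norm_hp p Ur Ui)%E,
            (sup_norm_hp p Ur Ui <= C%:E * lp_norm p ur ui)%E &
            forall vr vi : R -> R, in_Lp p vr vi -> poisson_rep Ur Ui vr vi ->
              {ae @lebesgue_measure R, forall t, vr t = ur t /\ vi t = ui t}]].
Proof.
move=> mp p1 LHp; have [C C0 Cbound] := poisson_modular mp p1 LHp.
have K0 : 0 < 2 * (C + 1) by lra.
exists 1, (2 * (C + 1)); split => // Ur Ui [hr hi [M HM]].
have sliceM U y : harmonic_on (@upper_half_plane R) U -> 0 < y ->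
    measurable_fun setT (fun x => U (x, y)).
  by move=> hU y0; apply: continuous_measurable_fun; exact: harmonic_slice.
have p0 x : 0 <= p x by rewrite (le_trans ler01)// ltW.
have pn0 x : p x != 0 by rewrite gt_eqF// (lt_trans ltr01).
(* Each component is dominated by the modulus and inherits its modular bound, so the boundary
   functions are constructed separately. *)
have bnd U : harmonic_on (@upper_half_plane R) U ->
    (forall x y, `|U (x, y)| <= cmod (Ur (x, y)) (Ui (x, y))) ->
    forall y, 0 < y -> (\int[@lebesgue_measure R]_t (`|U (t, y)| `^ p t)%:E <= M%:E)%E.
  move=> hU Ule y y0; apply: le_trans (HM y y0); apply: ge0_le_integral => //.
  - apply/measurable_EFinP; apply: measurable_powRf => //.
    by apply: measurableT_comp => //; exact: sliceM.
  - by apply: measurable_modular => //; exact: sliceM.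
  - by move=> x _; rewrite lee_fin; exact: le_powR.
have cp := LH_continuous LHp.
have [ur pur urE] := boundary_value mp p1 cp hr
  (bnd Ur hr (fun x y => cmod_ge_norml (Ur (x, y)) (Ui (x, y)))).
have [ui pui uiE] := boundary_value mp p1 cp hi
  (bnd Ui hi (fun x y => cmod_ge_normr (Ur (x, y)) (Ui (x, y)))).
have mr y : 0 < y -> measurable_fun setT (fun x => pint ur x y).
  move=> y0; rewrite (_ : (fun x => _) = fun x => Ur (x, y)); first exact: sliceM.
  by apply/funext => x; exact: urE.
have mi y : 0 < y -> measurable_fun setT (fun x => pint ui x y).
  move=> y0; rewrite (_ : (fun x => _) = fun x => Ui (x, y)); first exact: sliceM.
  by apply/funext => x; exact: uiE.
have h0 n : 0 < 2^-1 ^+ n :> R by rewrite exprn_gt0// invr_gt0.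
have modE l y : 0 < y ->
    modular p (fun x => pint ur x y / l) (fun x => pint ui x y / l) =
    modular p (fun x => Ur (x, y) / l) (fun x => Ui (x, y) / l).
  by move=> y0; apply: eq_integral => x _; rewrite urE// uiE.
have divr1E (g : R -> R) : (fun x => g x / 1) = g by apply/funext => x; rewrite divr1.
have mur : measurable_fun setT ur by case: pur.
have mui : measurable_fun setT ui by case: pui.
exists ur, ui; split.
- split => //; apply: (@le_lt_trans _ _ M%:E); last exact: ltry.
  rewrite -(divr1E ur) -(divr1E ui); apply: modular_fatou => // n; [exact: mr|exact: mi|].
  by rewrite modE// (divr1E (fun x => Ur _)) (divr1E (fun x => Ui _)); exact: HM.
- by move=> x y y0; rewrite -urE// -uiE//; split;
    rewrite -EFin_Rintegral//; exact: pintegrable_poisson.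
- rewrite mul1e; have S0 : (0 <= sup_norm_hp p Ur Ui)%E.
    apply: (le_trans (lp_norm_ge0 p (fun x => Ur (x, 1)) (fun x => Ui (x, 1)))).
    by apply: ereal_sup_ubound; exists 1 => /=.
  case E : (sup_norm_hp p Ur Ui) S0 => [r| |] // r0; last by rewrite leey.
  (* With the slack e every slice has norm strictly below r + e, hence modular at most 1 at that
     level, whether or not the infimum is attained; Fatou's lemma carries this to the boundary
     functions. *)
  apply/lee_addgt0Pr => e e0; apply: ereal_inf_lbound.
  exists (r + e) => //; split; first by rewrite lee_fin in r0; lra.
  apply: modular_fatou => // n; [exact: mr|exact: mi|].
  rewrite modE//; apply: lp_norm_lt => //; [exact: sliceM|exact: sliceM|].
  apply: (@le_lt_trans _ _ (sup_norm_hp p Ur Ui)).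
    by apply: ereal_sup_ubound; exists (2^-1 ^+ n) => //=.
  by rewrite E lte_fin; lra.
- apply: ge_ereal_sup => _ [y /= y0 <-].
  rewrite -lee_pdivrMl//; apply: le_ereal_inf_tmp => _ [l [l0 ml] <-].
  rewrite lee_pdivrMl// -EFinM; apply: ereal_inf_lbound.
  exists (2 * (C + 1) * l); last by [].
  split; first exact: mulr_gt0.
  rewrite -(modE (2 * (C + 1) * l) y y0).
  have Cy f (mf : measurable_fun setT f) f0 f1 := Cbound f y mf f0 f1 y0.
  exact: (modular_pint_le mp p1 C0 Cy pur pui (mr y y0) (mi y y0) l0 y0 ml).
- move=> vr vi Lv rep; have [mvr mvi _] := Lv.
  have pvr : pintegrable vr.
    by apply: (in_Lp_pintegrable mp p1 Lv) => // t; exact: cmod_ge_norml.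
  have pvi : pintegrable vi.
    by apply: (in_Lp_pintegrable mp p1 Lv) => // t; exact: cmod_ge_normr.
  have vrE x y : 0 < y -> pint vr x y = pint ur x y.
    by move=> y0; have [e _] := rep x y y0; rewrite /pint /Rintegral e /= -urE.
  have viE x y : 0 < y -> pint vi x y = pint ui x y.
    by move=> y0; have [_ e] := rep x y y0; rewrite /pint /Rintegral e /= -uiE.
  have := negligibleU (negligibleU (ae_poisson_cvg pur) (ae_poisson_cvg pui))
                      (negligibleU (ae_poisson_cvg pvr) (ae_poisson_cvg pvi)).
  apply: negligibleS => x /= nE; apply: contrapT.
  move=> /not_orP[/not_orP[/contrapT c1 /contrapT c2] /not_orP[/contrapT c3 /contrapT c4]].
  have Er : (fun n => pint vr x (2^-1 ^+ n)) = (fun n => pint ur x (2^-1 ^+ n)).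
    by apply/funext => n; exact: vrE.
  have Ei : (fun n => pint vi x (2^-1 ^+ n)) = (fun n => pint ui x (2^-1 ^+ n)).
    by apply/funext => n; exact: viE.
  rewrite Er in c3; rewrite Ei in c4; apply: nE; split.
    by rewrite -(cvg_lim (@Rhausdorff R) c1) -(cvg_lim (@Rhausdorff R) c3).
  by rewrite -(cvg_lim (@Rhausdorff R) c2) -(cvg_lim (@Rhausdorff R) c4).
Qed.
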